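(* Let $f=f_1+if_2\colon N\to\mathbb{C}$ be a Lefschetz fibration on a Hermitian manifold $N$ with Kähler form $\Omega$. Let $V\subset N$ be a Lagrangian submanifold containing a critical point $x$ of $f$. Suppose that $f_2$ is constant on $V$ and that the restriction of the Hessian $\mathrm{Hess}(f)(x)$ to the tangent space $T_xV$ is negative definite (respectively positive definite). Write $g_1=f_1|_V$. Take $c$ near $f_1(x)=g_1(x)$. Then $$g_1^{-1}[c,g_1(x)]=f_1^{-1}[c,f_1(x)]\cap V\quad\text{in the negative definite case, or}$$ $$g_1^{-1}[g_1(x),c]=f_1^{-1}[f_1(x),c]\cap V\quad\text{in the positive definite case,}$$ is homeomorphic to a closed ball in $\mathbb{R}^{\dim V}$. This ball is a Lagrangian thimble.
   Context: $N$ is a complex manifold with complex structure $J$, Hermitian metric $h$, associated Riemannian metric $M=\mathrm{Re}\,h$, and Kähler form $\Omega(u,v)=M(Ju,v)$. A Lefschetz fibration $f\colon N\to\mathbb{C}$ is a holomorphic function which has only nondegenerate critical points and such that $df$ is surjective outside a finite set of points; $f_1$ and $f_2$ are its real and imaginary parts. A submanifold $V$ is Lagrangian if $\Omega|_V=0$ and $\dim_{\mathbb{R}}V=\dim_{\mathbb{C}}N$. $\mathrm{Hess}(f)(x)$ is the Hessian bilinear form of $f$ at the critical point $x$; its restriction to $T_xV$ is real because $f_2$ is constant on $V$. Parallel transport between regular fibres is defined by the connection whose horizontal space at $y$ is the $\Omega$-orthogonal of the tangent space to the fibre $f^{-1}(f(y))$. Given a path $\lambda\colon[0,1]\to\mathbb{C}$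 from a regular value $\lambda(0)$ to a critical value $\lambda(1)=f(x)$, and a cycle $\alpha\subset f^{-1}(\lambda(0))$ (a vanishing cycle) whose parallel transports $\alpha_t\subset f^{-1}(\lambda(t))$ satisfy $\alpha_0=\alpha$ and $\alpha_1=x$, the set $\bigcup_{t\in[0,1]}\alpha_t$, topologically a closed disc with boundary $\alpha$, is called a thimble. It is called a Lagrangian thimble if it is a Lagrangian submanifold of $N$.
   Formalization: The set is claimed to be a closed ball and Lagrangian thimble only for its connected component containing x; the whole set can have other components (N=C, f=z^3-3z, V=R, x=-1), and the two agree whenever it is connected. *)

(* Defs.v *)
From mathcomp Require Export all_boot all_order all_algebra.
From mathcomp Require Export complex.
From mathcomp Require Export all_classical all_reals all_analysis.
Export Order.TTheory GRing.Theory Num.Theory numFieldNormedType.Exports.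

Set Implicit Arguments.
Unset Strict Implicit.
Unset Printing Implicit Defensive.

Global Open Scope classical_set_scope.
Global Open Scope complex_scope.
Global Open Scope ring_scope.

(* C^n is presented by real and imaginary parts: (a, b) stands for a + i b, so
   that real calculus applies to it directly.  Note that its library norm is a
   sup norm; only its topology is used. *)
Notation Cn R n := ('rV[R]_n * 'rV[R]_n)%type.

(* Multiplication by i on C^n. *)
Definition J (R : realType) (n : nat) (z : Cn R n) : Cn R n := (- z.2, z.1).

(* C^k maps; meaningful for U open.  In finite dimension the condition on all
   directional derivatives 'D_v F is the condition on the differential. *)
Fixpoint Ck (R : realType) (V W : normedModType R) (k : nat)
    (U : set V) (F : V -> W) : Prop :=
  if k is k'.+1 then
    (forall z, U z -> differentiable F z) /\
    (forall v, Ck k' U (fun z => 'D_v F z))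
  else forall z, U z -> {for z, continuous F}.

Definition smooth (R : realType) (V W : normedModType R)
  (U : set V) (F : V -> W) : Prop := forall k, Ck k U F.

Definition homeo_on (T U : topologicalType) (A : set T) (B : set U)
    (F : T -> U) : Prop :=
  exists G : U -> T,
    [/\ F @` A = B, {in A, cancel F G},
        {within A, continuous F} & {within B, continuous G}].

(* The library norm on 'rV_n is the sup norm, hence the explicit formulas. *)
Definition unit_ball (R : realType) (n : nat) : set 'rV[R]_n :=
  [set v | \sum_(i < n) v 0 i ^+ 2 <= 1].
Definition unit_sphere (R : realType) (n : nat) : set 'rV[R]_n :=
  [set v | \sum_(i < n) v 0 i ^+ 2 = 1].
Arguments unit_ball : clear implicits.
Arguments unit_sphere : clear implicits.

(* cfun and cinv are total functions; their values off cdom, resp. off the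
   image of cdom, are irrelevant. *)
Record chart (R : realType) (n : nat) (T : topologicalType) := Chart {
  cdom : set T;
  cfun :> T -> Cn R n;
  cinv : Cn R n -> T;
  cdom_open : open cdom;
  cimage_open : open (cfun @` cdom);
  cfunK : {in cdom, cancel cfun cinv};
  cfun_continuous : forall p, cdom p -> {for p, continuous cfun};
  cinv_continuous : forall z, (cfun @` cdom) z -> {for z, continuous cinv}
}.

Definition overlap (R : realType) (n : nat) (T : topologicalType)
  (phi psi : chart R n T) : set (Cn R n) := phi @` (cdom phi `&` cdom psi).

Definition transition (R : realType) (n : nat) (T : topologicalType)
  (phi psi : chart R n T) : Cn R n -> Cn R n := psi \o cinv phi.

(* A holomorphic map is a smooth map with complex linear differential. *)
Definition holomorphic_transition (R : realType) (n : nat) (T : topologicalType)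
    (phi psi : chart R n T) : Prop :=
  smooth (overlap phi psi) (transition phi psi) /\
  forall z, overlap phi psi z ->
    forall v, 'd (transition phi psi) z (J v) = J ('d (transition phi psi) z v).

Record complexManifold (R : realType) (n : nat) := ComplexManifold {
  carrier :> topologicalType;
  carrier_hausdorff : hausdorff_space carrier;
  carrier_second_countable : @second_countable carrier;
  atlas : set (chart R n carrier);
  atlas_holomorphic : forall phi psi, atlas phi -> atlas psi ->
    holomorphic_transition phi psi;
  chart_at : carrier -> chart R n carrier;
  chart_at_atlas : forall p, atlas (chart_at p);
  chart_at_dom : forall p, cdom (chart_at p) p
}.

(* The tangent space T_pN is C^n, a tangent vector at p being represented by
   its coordinates in the distinguished chart at p.  All the charts being
   holomorphic, the complex structure of T_pN is then J. *)
(* The vector v based at cinv phi z, given in the chart phi, as an element of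
   the tangent space. *)
Definition to_tangent (R : realType) (n : nat) (N : complexManifold R n)
    (phi : chart R n N) (z v : Cn R n) : Cn R n :=
  'd (transition phi (chart_at (cinv phi z))) z v.

Record hermitianMetric (R : realType) (n : nat) (N : complexManifold R n) :=
  HermitianMetric {
  herm :> N -> Cn R n -> Cn R n -> R[i];
  herm_linear : forall p (a : R) u v w,
    herm p (a *: u + v) w = a%:C * herm p u w + herm p v w;
  herm_J : forall p u w, herm p (J u) w = (0 +i* 1) * herm p u w;
  herm_conj : forall p u v, herm p v u = conjc (herm p u v);
  herm_pos : forall p u, u != 0 -> 0 < herm p u u;
  herm_smooth : forall phi, atlas phi -> forall u v : Cn R n,
    let hphi z := herm (cinv phi z) (to_tangent phi z u) (to_tangent phi z v) in
    smooth (phi @` cdom phi) (fun z => complex.Re (hphi z)) /\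
    smooth (phi @` cdom phi) (fun z => complex.Im (hphi z))
}.

Definition riemannian (R : realType) (n : nat) (N : complexManifold R n)
    (h : hermitianMetric N) (p : N) (u v : Cn R n) : R :=
  complex.Re (h p u v).

Definition kahler_form (R : realType) (n : nat) (N : complexManifold R n)
    (h : hermitianMetric N) (p : N) (u v : Cn R n) : R :=
  riemannian h p (J u) v.

Section Functions.
Variables (R : realType) (n : nat) (N : complexManifold R n) (f : N -> R[i]).

Definition re_part (y : N) : R := complex.Re (f y).
Definition im_part (y : N) : R := complex.Im (f y).

Definition differential (y : N) (v : Cn R n) : R[i] :=
  let phi := chart_at y in
  ('d (re_part \o cinv phi) (phi y) v) +i*
  ('d (im_part \o cinv phi) (phi y) v).

Definition holomorphic : Prop :=
  (forall phi, atlas phi ->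
     smooth (phi @` cdom phi) (re_part \o cinv phi) /\
     smooth (phi @` cdom phi) (im_part \o cinv phi)) /\
  (forall y v, differential y (J v) = (0 +i* 1) * differential y v).

Definition regular_point (y : N) : Prop :=
  forall w : R[i], exists v, differential y v = w.

Definition critical_point (y : N) : Prop := ~ regular_point y.

Definition regular_value (w : R[i]) : Prop :=
  forall y, f y = w -> regular_point y.

(* At a critical point of a holomorphic function this is the complex bilinear
   Hessian form, and it does not depend on the chart. *)
Definition hessian (y : N) (u v : Cn R n) : R[i] :=
  let phi := chart_at y in
  ('D_u (fun z => 'D_v (re_part \o cinv phi) z) (phi y)) +i*
  ('D_u (fun z => 'D_v (im_part \o cinv phi) z) (phi y)).

Definition nondegenerate (y : N) : Prop :=
  forall u, u != 0 -> exists v, hessian y u v != 0.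

Definition lefschetz_fibration : Prop :=
  [/\ holomorphic,
      forall y, critical_point y -> nondegenerate y &
      finite_set [set y | ~ regular_point y]].

End Functions.

Section Submanifolds.
Variables (R : realType) (n : nat) (N : complexManifold R n).

(* Charts of the underlying smooth manifold of real dimension 2n. *)
Definition smooth_chart (s : chart R n N) : Prop :=
  forall phi, atlas phi ->
    smooth (overlap phi s) (transition phi s) /\
    smooth (overlap s phi) (transition s phi).

(* Slice charts modelled on R^n inside C^n: only submanifolds of real
   dimension n, the complex dimension of N, are considered. *)
Definition slice_chart (D : set N) (s : chart R n N) : Prop :=
  smooth_chart s /\ forall q, cdom s q -> (D q <-> (s q).2 = 0).

Definition half_slice_chart (D : set N) (s : chart R n N) : Prop :=
  smooth_chart s /\
  exists i : 'I_n,
    forall q, cdom s q -> (D q <-> (s q).2 = 0 /\ 0 <= (s q).1 0 i).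

Definition submanifold (D : set N) : Prop :=
  forall p, D p -> exists2 s, cdom s p & slice_chart D s.

Definition submanifold_with_boundary (D : set N) : Prop :=
  forall p, D p ->
    exists2 s, cdom s p & slice_chart D s \/ half_slice_chart D s.

Definition tangent (D : set N) (p : N) : set (Cn R n) :=
  [set v | exists s, [/\ cdom s p, slice_chart D s \/ half_slice_chart D s &
    ('d (transition (chart_at p) s) (chart_at p p) v).2 = 0]].

Variable h : hermitianMetric N.

Definition isotropic (D : set N) : Prop :=
  forall p, D p -> forall u v, tangent D p u -> tangent D p v ->
    kahler_form h p u v = 0.

Definition lagrangian (D : set N) : Prop := submanifold D /\ isotropic D.

Definition lagrangian_with_boundary (D : set N) : Prop :=
  submanifold_with_boundary D /\ isotropic D.

End Submanifolds.

(* Used when im_part f is constant on V: the Hessian is then real on T_xV, and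
   its sign is the sign of its real part. *)
Definition hessian_negative_on (R : realType) (n : nat) (N : complexManifold R n)
    (f : N -> R[i]) (V : set N) (x : N) : Prop :=
  forall v, tangent V x v -> v != 0 -> complex.Re (hessian f x v v) < 0.
Definition hessian_positive_on (R : realType) (n : nat) (N : complexManifold R n)
    (f : N -> R[i]) (V : set N) (x : N) : Prop :=
  forall v, tangent V x v -> v != 0 -> 0 < complex.Re (hessian f x v v).

Section Thimbles.
Variables (R : realType) (n : nat) (N : complexManifold R n).
Variables (h : hermitianMetric N) (f : N -> R[i]).

(* At a regular point y the tangent space to the fibre is the kernel of the
   differential. *)
Definition horizontal (y : N) : set (Cn R n) :=
  [set u | forall w, differential f y w = 0 -> kahler_form h y u w = 0].

Definition horizontal_lift (lambda : R -> R[i]) (gamma : R -> N) : Prop :=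
  [/\ {within `[0, 1[, continuous gamma},
      forall t, 0 <= t < 1 -> f (gamma t) = lambda t &
      forall t, 0 < t < 1 ->
        let gammaphi := chart_at (gamma t) \o gamma in
        derivable gammaphi t 1 /\ horizontal (gamma t) ('D_1 gammaphi t)].

Definition smooth_path (lambda : R -> R[i]) : Prop :=
  smooth [set: R] (fun t => complex.Re (lambda t)) /\
  smooth [set: R] (fun t => complex.Im (lambda t)).

(* D is a thimble with vertex x.  For p in the vanishing cycle alpha,
   Gamma p is the horizontal lift of lambda through p, so that the parallel
   transport of alpha is alpha_t = [set Gamma p t | p in alpha] for t < 1.
   Parallel transport to the singular fibre is a limit: alpha_1 = x means that
   alpha_t shrinks to x as t tends to 1. *)
Definition thimble (x : N) (D : set N) : Prop :=
  exists (lambda : R -> R[i]) (alpha : set N) (Gamma : N -> R -> N),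
    let alpha_ t := [set Gamma p t | p in alpha] in
    [/\ [/\ smooth_path lambda,
            forall t, 0 <= t < 1 -> regular_value f (lambda t),
            critical_point f x & lambda 1 = f x],
        forall p, alpha p -> Gamma p 0 = p /\ horizontal_lift lambda (Gamma p),
        forall U, nbhs x U -> \forall t \near (1 : R)^'-, alpha_ t `<=` U,
        D = x |` \bigcup_(t in `[0, 1[) alpha_ t &
        exists Phi : 'rV[R]_n -> N,
          homeo_on (unit_ball R n) D Phi /\ Phi @` (unit_sphere R n) = alpha].

Definition lagrangian_thimble (x : N) (D : set N) : Prop :=
  thimble x D /\ lagrangian_with_boundary h D.

End Thimbles.

(* Main.v *)
Require Import Defs.
From HB Require Import structures.
From mathcomp Require Import ring lra.

(** Everything happens near [x].  A slice chart of [V] at [x] identifies a neighbourhood of [x] in [V]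
    with a neighbourhood of 0 in R^n.  There the height [G = sigma * (f1 x - f1)], with [sigma = 1] or
    [sigma = -1] according to the sign of the Hessian, vanishes to second order at 0 and has a
    positive definite second derivative ([height_hessian]).

    The ball.  The radial derivative of [G] at [z] is at least a multiple of [|z|^2]
    ([radial_growth]).  So [G] increases strictly along the rays of a small cube, the set
    [G <= e] is star-shaped, and [z |-> sqrt (G z / e) z / |z|_2] is a homeomorphism from it onto the
    Euclidean unit ball ([model_ball]).  It is the component of [x] because it is closed,
    connected, and the only part of the level region in a neighbourhood of itself
    ([component_is_ball]).

    The parallel transport.  As [V] is Lagrangian, the tangent space of [N] at a point of [V] is the
    orthogonal sum of the tangent space [T] of [V] and of [J T].  As [f2] is constant on [V], a vector
    [a + J b] with [a] and [b] in [T] is in the kernel of the differential of [f] exactly when [a] and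
    [b] are.  Hence the gradient of the restriction of [f1] to [V], which is tangent to [V], is
    horizontal ([horizontal_of_gradient]).  Let [A] be the matrix of the metric of [V].  The vector
    [y = adj(A) dG] is a multiple of the gradient that needs no division, and
    [W = - (G / dG(y)) y] is normalised so that [dG(W) = - G].  Along an integral curve of [W] the
    height is [e exp(- s)]; with the time [t = 1 - exp(- s)] the image by [f] runs at constant speed on
    the segment from [f1 x - sigma e] to [f1 x], and the curve is a horizontal lift of this segment.
    The field [W] is Lipschitz even at 0 ([local_model]): [G] and [dG(y)] vanish there to second order,
    [y] to first order, and [|dG(y)|] is bounded below by a multiple of [|z|^2] by the Cauchy-Schwarz
    inequality for [A].  So Picard iteration ([ode_exists], [ode_unique]) gives one integral curve
    through every point, and following it backwards to the level [e] shows that the curves starting at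
    the boundary sphere fill the ball minus its centre ([model_foliation]).

    The boundary.  Near a boundary point some partial derivative of [G] does not vanish, and replacing
    this coordinate of the slice chart by [e - G] gives a half-slice chart ([shear_chart]); that the new
    map is a chart is the implicit function theorem in one variable ([shear_surj], [shear_inv_Ck]).
    Vectors tangent to the ball are tangent to [V] ([tangent_subset]), so the ball is isotropic.

    Finally [f] has finitely many critical points, so the segment contains no critical value
    before its end when it is short ([regular_values_near]). *)

Set Implicit Arguments.
Unset Strict Implicit.
Unset Printing Implicit Defensive.

(** * Calculus of C^k maps *)

Section Differential.
Variables (R : realType) (V W : normedModType R).
Implicit Types (f g : V -> W) (x : V).

(** The definition of the differential by Landau symbols, in the form used for explicit estimates. *)
Lemma differential_eps f x (df : {linear V -> W}) : continuous df ->
  (forall e : R, 0 < e ->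
     \forall h \near (0 : V), `|f (h + x) - f x - df h| <= e * `|h|) ->
  differentiable f x /\ 'd f x = df :> (V -> W).
Proof.
move=> cdf H.
have E : f \o shift x = cst (f x) + df +o_ (0 : V) id.
  apply/eqaddoP => e e0; have := H e e0.
  by apply: filterS => h /=; rewrite !fctE /= opprD addrA.
have dE : 'd f x = df :> (V -> W) by exact: diff_unique.
by split => //; apply/diff_locallyP; rewrite dE.
Qed.

Lemma differentiable_eps f x : differentiable f x ->
  forall e : R, 0 < e ->
     \forall h \near (0 : V), `|f (h + x) - f x - 'd f x h| <= e * `|h|.
Proof.
move=> /diff_locally /eqaddoP H e e0; have := H e e0.
by apply: filterS => h /=; rewrite !fctE /= opprD addrA.
Qed.

Lemma near_eq_diff f g x : (\forall z \near x, f z = g z) ->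
  differentiable f x -> differentiable g x /\ 'd g x = 'd f x :> (V -> W).
Proof.
move=> fg df; apply: differential_eps; first exact: diff_continuous.
move=> e e0; have := differentiable_eps df e0.
have fg0 : \forall h \near (0 : V), f (h + x) = g (h + x).
  by move: fg; rewrite (near_shift 0) /= subr0.
move: fg0; apply: filterS2 => h E1.
by rewrite -E1 -(nbhs_singleton fg).
Qed.
End Differential.

Section CkCalculus.
Variable R : realType.
Implicit Types (V W : normedModType R).

(** On an open set the derivatives only depend on the values on the set. *)
Lemma Ck_ext V W k (U : set V) (F G : V -> W) : open U ->
  {in U, F =1 G} -> Ck k U F -> Ck k U G.
Proof.
move=> oU; elim: k F G => [|k IH] F G FG /=.
  move=> CF z Uz; have FGn : \forall y \near z, F y = G y.
    by have := open_nbhs_nbhs (conj oU Uz); apply: filterS => y Uy; apply: FG; rewrite inE.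
  rewrite /prop_for /continuous_at -(FG z) ?inE//.
  by apply: cvg_trans (CF z Uz); apply: near_eq_cvg; apply: filterS FGn => y ->.
have FGn z : U z -> \forall y \near z, F y = G y.
  by move=> Uz; have := open_nbhs_nbhs (conj oU Uz); apply: filterS => y Uy; apply: FG; rewrite inE.
move=> [dF CF]; split=> [z Uz|v].
  by have [] := near_eq_diff (FGn z Uz) (dF z Uz).
apply: IH (CF v) => z; rewrite inE => Uz.
exact: near_eq_derive (FGn z Uz).
Qed.

Lemma CkW V W k (U : set V) (F : V -> W) : Ck k.+1 U F -> Ck k U F.
Proof.
elim: k F => [|k IH] F [dF CF].
  by move=> z Uz; apply: differentiable_continuous; exact: dF.
by split=> // v; apply: IH; exact: CF.
Qed.

Lemma Ck_sub V W k (U U' : set V) (F : V -> W) : U' `<=` U -> Ck k U F -> Ck k U' F.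
Proof.
move=> UU; elim: k F => [|k IH] F /=; first by move=> CF z /UU; exact: CF.
by move=> [dF CF]; split=> [z /UU|v]; [exact: dF|exact: IH].
Qed.

Lemma Ck_cst V W k (U : set V) (a : W) : Ck k U (fun=> a).
Proof.
elim: k a => [|k IH] a /=; first by move=> z _; exact: cst_continuous.
split=> [z _|v]; first exact: differentiable_cst.
rewrite (_ : (fun z => 'D_v (fun=> a) z) = fun=> 0) //.
by apply/funext => z; exact: derive_cst.
Qed.

Lemma Ck_linear_comp V W (W' : normedModType R) (L : {linear W -> W'}) k
  (U : set V) (F : V -> W) : continuous L -> open U ->
  Ck k U F -> Ck k U (fun z => L (F z)).
Proof.
move=> cL oU; elim: k F => [|k IH] F /=.
  by move=> CF z Uz; apply: continuous_comp; [exact: CF|exact: cL].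
have dL y : differentiable L y by exact: linear_differentiable.
move=> [dF CF]; split=> [z Uz|v].
  by apply: differentiable_comp; [exact: dF|exact: dL].
apply: Ck_ext (IH _ (CF v)) => // z; rewrite inE => Uz.
have dFz := dF z Uz.
have dLF : differentiable (L \o F) z by exact: differentiable_comp.
by rewrite [in RHS](deriveE _ dLF) diff_comp// diff_lin//= deriveE.
Qed.

Lemma Ck_linear V W (L : {linear V -> W}) k (U : set V) : continuous L -> Ck k U L.
Proof.
move=> cL; case: k => [|k] /=; first by move=> z _; exact: cL.
split=> [z _|v]; first exact: linear_differentiable.
rewrite (_ : (fun z => 'D_v L z) = fun=> L v); first exact: Ck_cst.
by apply/funext => z; rewrite deriveE ?diff_lin//; exact: linear_differentiable.
Qed.

Lemma Ck_id V k (U : set V) : Ck k U (fun z : V => z).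
Proof. by apply: (@Ck_linear _ _ (idfun : {linear V -> V})) => z; exact: cvg_id. Qed.

Lemma CkD V W k (U : set V) (F G : V -> W) : open U ->
  Ck k U F -> Ck k U G -> Ck k U (fun z => F z + G z).
Proof.
move=> oU; elim: k F G => [|k IH] F G /=.
  by move=> CF CG z Uz; apply: continuousD; [exact: CF|exact: CG].
move=> [dF CF] [dG CG]; split=> [z Uz|v].
  by apply: differentiableD; [exact: dF|exact: dG].
apply: Ck_ext (IH _ _ (CF v) (CG v)) => // z; rewrite inE => Uz.
by rewrite deriveD//; apply: diff_derivable; [exact: dF|exact: dG].
Qed.

Lemma Ck_sum V W k (U : set V) (I : Type) (r : seq I) (P : pred I) (F : I -> V -> W) :
  open U -> (forall i, P i -> Ck k U (F i)) ->
  Ck k U (fun z => \sum_(i <- r | P i) F i z).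
Proof.
move=> oU CF; elim: r => [|i r IH].
  by under eq_fun do rewrite big_nil; exact: Ck_cst.
under eq_fun do rewrite big_cons.
by case Pi : (P i) => //; apply: CkD => //; exact: CF.
Qed.

Lemma CkM V k (U : set V) (F G : V -> R) : open U ->
  Ck k U F -> Ck k U G -> Ck k U (fun z => F z * G z).
Proof.
move=> oU; elim: k F G => [|k IH] F G.
  by move=> CF CG z Uz; apply: continuousM; [exact: CF|exact: CG].
move=> CF' CG'; have [CF1 CG1] := (CkW CF', CkW CG').
move: CF' CG' => [dF CF] [dG CG]; split=> [z Uz|v].
  by apply: differentiableM; [exact: dF|exact: dG].
apply: (Ck_ext oU) (CkD oU (IH _ _ CF1 (CG v)) (IH _ _ CG1 (CF v))) => z; rewrite inE => Uz.
by rewrite deriveM//; apply: diff_derivable; [exact: dF|exact: dG].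
Qed.

Lemma CkN V W k (U : set V) (F : V -> W) : open U ->
  Ck k U F -> Ck k U (fun z => - F z).
Proof.
move=> oU CF; apply: (@Ck_linear_comp _ _ _ (-%R : {linear W -> W})) => //.
exact: opp_continuous.
Qed.

Lemma CkB V W k (U : set V) (F G : V -> W) : open U ->
  Ck k U F -> Ck k U G -> Ck k U (fun z => F z - G z).
Proof. by move=> oU CF CG; apply: CkD => //; exact: CkN. Qed.

Lemma Ck_prod V k (U : set V) (I : Type) (r : seq I) (F : I -> V -> R) :
  open U -> (forall i, Ck k U (F i)) ->
  Ck k U (fun z => \prod_(i <- r) F i z).
Proof.
move=> oU CF; elim: r => [|i r IH].
  by under eq_fun do rewrite big_nil; exact: Ck_cst.
by under eq_fun do rewrite big_cons; exact: CkM.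
Qed.

(** The derivative of the inverse is a product of inverses and of the derivative: induction on [k]. *)
Lemma CkV V k (U : set V) (F : V -> R) : open U ->
  (forall z, U z -> F z != 0) -> Ck k U F -> Ck k U (fun z => (F z)^-1).
Proof.
move=> oU F0; elim: k => [|k IH].
  by move=> CF z Uz; apply: continuousV; [exact: F0|exact: CF].
move=> CF'; have CV := IH (CkW CF').
move: CF' => [dF CF]; split=> [z Uz|v].
  by apply: differentiableV; [exact: dF|exact: F0].
apply: (Ck_ext oU) (CkN oU (CkM oU (CkM oU CV CV) (CF v))) => z; rewrite inE => Uz.
have dFz := dF z Uz.
rewrite deriveV; [|exact: F0|exact: diff_derivable].
by rewrite expr2 invfM scaleNr.
Qed.

Lemma Ck_det V k (U : set V) m (A : V -> 'M[R]_m) : open U ->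
  (forall i j, Ck k U (fun z => A z i j)) -> Ck k U (fun z => \det (A z)).
Proof.
move=> oU CA; apply: Ck_sum => // s _; apply: CkM => //; first exact: Ck_cst.
exact: Ck_prod.
Qed.

Lemma Ck_adj V k (U : set V) m (A : V -> 'M[R]_m) i j : open U ->
  (forall i j, Ck k U (fun z => A z i j)) -> Ck k U (fun z => (\adj (A z)) i j).
Proof.
move=> oU CA; under eq_fun do rewrite mxE /cofactor.
apply: CkM => //; first exact: Ck_cst.
by apply: Ck_det => // i' j'; under eq_fun do rewrite !mxE; exact: CA.
Qed.

(** A finite basis with continuous coordinate forms: all that is used of finite dimension is the
    expansion of directional derivatives in partial derivatives. *)
Record coordinates V := Coordinates {
  cidx : finType;
  cvec : cidx -> V;
  lcoord : cidx -> {linear V -> R};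
  lcoord_continuous : forall i, continuous (lcoord i);
  lcoord_sum : forall v, v = \sum_i lcoord i v *: cvec i }.
Arguments cvec {V} c i.
Arguments lcoord {V} c i.
Arguments lcoord_continuous {V} c i.
Arguments lcoord_sum {V} c v.

Lemma diff_coord V (b : coordinates V) W (F : V -> W) z v : differentiable F z ->
  'D_v F z = \sum_i lcoord b i v *: 'D_(cvec b i) F z.
Proof.
move=> dF; rewrite deriveE// {1}(lcoord_sum b v) linear_sum; apply: eq_bigr => i _.
by rewrite linearZ /= deriveE.
Qed.

(** A vector-valued map is a sum of scalar multiples of fixed vectors, so that products and compositions
    only have to be treated for scalar functions. *)
Lemma Ck_coord V W (b : coordinates W) k (U : set V) (F : V -> W) : open U ->
  (forall i, Ck k U (fun z => lcoord b i (F z))) -> Ck k U F.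
Proof.
move=> oU CF.
rewrite (_ : F = fun z => \sum_i lcoord b i (F z) *: cvec b i); last first.
  by apply/funext => z; rewrite -lcoord_sum.
apply: Ck_sum => // i _.
have lin : linear (fun a : R => a *: cvec b i) by move=> a u w /=; rewrite scalerDl -scalerA.
pose L : {linear R -> W} := HB.pack (fun a : R => a *: cvec b i)
  (GRing.isLinear.Build _ _ _ _ _ lin).
apply: (@Ck_linear_comp _ _ _ L) => //; exact: scalel_continuous.
Qed.

(** By the chain rule the directional derivatives of [G \o F] are sums of products of coordinates of those of
    [F] and of partial derivatives of [G] composed with [F]; finitely many coordinates make this a finite
    sum, whence the induction on [k]. *)
Lemma Ck_comp_scalar V W (b : coordinates W) k (U : set V) (O : set W)
  (F : V -> W) (G : W -> R) : open U -> (forall z, U z -> O (F z)) ->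
  Ck k U F -> Ck k O G -> Ck k U (fun z => G (F z)).
Proof.
move=> oU UO; elim: k G => [|k IH] G.
  by move=> CF CG z Uz; apply: continuous_comp; [exact: CF|exact: (CG _ (UO _ Uz))].
move=> CF' [dG CG]; have CF1 := CkW CF'; move: CF' => [dF CF]; split=> [z Uz|v].
  by apply: differentiable_comp; [exact: dF|exact: (dG _ (UO _ Uz))].
have H : Ck k U (fun z => \sum_i lcoord b i ('D_v F z) * 'D_(cvec b i) G (F z)).
  apply: Ck_sum => // i _; apply: CkM => //; last exact: (IH (fun w => 'D_(cvec b i) G w) CF1 (CG _)).
  by apply: Ck_linear_comp => //; [exact: (lcoord_continuous b i)|exact: CF].
apply: Ck_ext oU _ H => z; rewrite inE => Uz.
have dFz := dF z Uz; have dGz := dG _ (UO z Uz).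
have dGF : differentiable (G \o F) z by exact: differentiable_comp.
rewrite [in RHS](deriveE _ dGF) diff_comp//=.
by rewrite -(deriveE _ dFz) -(deriveE _ dGz) (diff_coord b).
Qed.

Lemma Ck_comp V W W' (b : coordinates W) (b' : coordinates W') k (U : set V)
  (O : set W) (F : V -> W) (G : W -> W') : open U -> (forall z, U z -> O (F z)) ->
  open O -> Ck k U F -> Ck k O G -> Ck k U (fun z => G (F z)).
Proof.
move=> oU UO oO CF CG; apply: (Ck_coord (b := b')) => // i.
apply: (@Ck_comp_scalar _ _ b _ _ O F (fun w => lcoord b' i (G w))) => //.
apply: Ck_linear_comp => //; exact: lcoord_continuous.
Qed.

End CkCalculus.
Arguments cvec {R V} c i.
Arguments lcoord {R V} c i.
Arguments lcoord_continuous {R V} c i.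
Arguments lcoord_sum {R V} c v.

(** * Coordinates and the mean value inequality *)

Section CoordinateInstances.
Variables (R : realType) (n : nat).

Let rv_coord (i : 'I_n) (v : 'rV[R]_n) : R := v 0 i.
Fact rv_coord_linear i : linear (rv_coord i).
Proof. by move=> a u v; rewrite /rv_coord !mxE. Qed.
HB.instance Definition _ i := GRing.isLinear.Build _ _ _ _ (rv_coord i) (rv_coord_linear i).

Definition rV_coordinates : coordinates 'rV[R]_n.
Proof.
refine (@Coordinates R 'rV[R]_n 'I_n (fun i => delta_mx 0 i)
   (fun i => (rv_coord i : {linear 'rV[R]_n -> R})) _ _).
  move=> i; exact: coord_continuous.
exact: row_sum_delta.
Defined.

Let cn_coord (i : 'I_n + 'I_n) (v : Cn R n) : R :=
  match i with inl i => v.1 0 i | inr i => v.2 0 i end.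
Fact cn_coord_linear i : linear (cn_coord i).
Proof. by case: i => i a [u u'] [v v']; rewrite /cn_coord !mxE. Qed.
HB.instance Definition _ i := GRing.isLinear.Build _ _ _ _ (cn_coord i) (cn_coord_linear i).

Definition Cn_coordinates : coordinates (Cn R n).
Proof.
refine (@Coordinates R (Cn R n) ('I_n + 'I_n)%type
   (fun i => match i with inl i => (delta_mx 0 i, 0) | inr i => (0, delta_mx 0 i) end)
   (fun i => (cn_coord i : {linear (Cn R n) -> R})) _ _).
  case=> i v.
    by apply: (@continuous_comp _ _ _ fst (fun u : 'rV[R]_n => u 0 i)); [exact: cvg_fst|exact: coord_continuous].
  by apply: (@continuous_comp _ _ _ snd (fun u : 'rV[R]_n => u 0 i)); [exact: cvg_snd|exact: coord_continuous].
move=> [u v]; rewrite big_sumType/=.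
have -> : \sum_(i < n) u 0 i *: ((delta_mx 0 i, 0) : Cn R n) = (u, 0).
  rewrite {2}(row_sum_delta u); elim/big_ind2 : _ => // [x1 x2 y1 y2 -> ->|i _].
    by congr (_, _); rewrite addr0.
  by congr (_, _); rewrite scaler0.
have -> : \sum_(i < n) v 0 i *: ((0, delta_mx 0 i) : Cn R n) = (0, v).
  rewrite {2}(row_sum_delta v); elim/big_ind2 : _ => // [x1 x2 y1 y2 -> ->|i _].
    by congr (_, _); rewrite addr0.
  by congr (_, _); rewrite scaler0.
by congr (_, _); rewrite ?add0r ?addr0.
Defined.

End CoordinateInstances.

Section Curves.
Variables (R : realType).
Implicit Types (V W : normedModType R).

Lemma is_derive_curve V W (F : V -> W) (c : R -> V) (t : R) (v : V) :
  is_derive t 1 c v -> differentiable F (c t) ->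
  is_derive t 1 (F \o c) ('D_v F (c t)).
Proof.
move=> cv dF.
have dc : differentiable c t by apply/derivable1_diffP; exact: ex_derive.
have dFc : differentiable (F \o c) t by exact: differentiable_comp.
apply: DeriveDef; first exact: diff_derivable.
by rewrite deriveE// diff_comp//= -(deriveE _ dc) (deriveE _ dF) derive_val.
Qed.

Lemma is_derive_line V (b v : V) (t : R) : is_derive t 1 (fun t => b + t *: v) v.
Proof.
rewrite -[X in is_derive _ _ _ X]add0r; apply: is_deriveD.
have d : differentiable ( *:%R^~ v : R -> V) t by [].
apply: DeriveDef; first exact: diff_derivable.
by rewrite deriveE// diff_val scale1r.
Qed.

Lemma is_derive_along_line V W (F : V -> W) (b v : V) (t : R) :
  differentiable F (b + t *: v) ->
  is_derive t 1 (fun t => F (b + t *: v)) ('D_v F (b + t *: v)).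
Proof.
move=> dF.
exact: (@is_derive_curve _ _ F (fun t => b + t *: v) t v (is_derive_line _ _ _) dF).
Qed.

Lemma mean_value_line V (F : V -> R) (b v : V) :
  (forall t, 0 <= t <= 1 -> differentiable F (b + t *: v)) ->
  exists2 t, 0 <= t <= 1 & F (b + v) - F b = 'D_v F (b + t *: v).
Proof.
move=> dF.
have dl (t : R) : t \in `]0, 1[ -> is_derive t 1 (fun t => F (b + t *: v)) ('D_v F (b + t *: v)).
  by rewrite in_itv /= => /andP[t0 t1]; apply: is_derive_along_line; apply: dF; rewrite !ltW.
have [|t] := @MVT_segment R (fun t => F (b + t *: v)) (fun t => 'D_v F (b + t *: v)) 0 1 ler01 dl.
  apply: derivable_within_continuous => t; rewrite in_itv /= => t01.
  by have := is_derive_along_line (dF t t01).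
rewrite in_itv/= => t01; rewrite scale1r scale0r addr0 subr0 mulr1 => E.
by exists t.
Qed.

(** The factor [n] comes from the expansion of a directional derivative in the [n] partial derivatives,
    each coordinate being bounded by the sup norm. *)
Lemma lipschitz_cube n (F : 'rV[R]_n -> R) (r M : R) :
  (forall z, `|z| <= r -> differentiable F z) ->
  (forall z j, `|z| <= r -> `|'D_(delta_mx 0 j) F z| <= M) ->
  forall a b, `|a| <= r -> `|b| <= r -> `|F a - F b| <= n%:R * M * `|a - b|.
Proof.
move=> dF DM a b ar br.
have seg t : 0 <= t <= 1 -> `|b + t *: (a - b)| <= r.
  move=> /andP[t0 t1]; rewrite (_ : b + _ = (1 - t) *: b + t *: a); last first.
    by rewrite scalerBl scale1r scalerBr addrA addrAC.
  rewrite (le_trans (ler_normD _ _))// !normrZ ger0_norm ?subr_ge0// (ger0_norm t0).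
  rewrite (_ : r = (1 - t) * r + t * r); last by ring.
  by apply: lerD; apply: ler_wpM2l => //; rewrite subr_ge0.
have [|t t01] := @mean_value_line _ F b (a - b).
  by move=> t t01; apply: dF; exact: seg.
rewrite [b + (a - b)]addrC subrK => ->.
rewrite (diff_coord (rV_coordinates R n)); last by apply: dF; exact: seg.
rewrite (le_trans (ler_norm_sum _ _ _))//.
have -> : n%:R = \sum_(j < n) (1 : R) by rewrite sumr_const card_ord.
rewrite -mulrA mulr_suml.
apply: ler_sum => i _; rewrite mul1r normrM mulrC.
apply: ler_pM => //; first by apply: DM; exact: seg.
rewrite [leRHS]/Num.Def.normr/= mx_normrE.
exact: (le_bigmax _ _ (0, i)).
Qed.

End Curves.

(** * Implicit function theorem in one variable *)

Section Shear.
Variables (R : realType) (W : normedModType R) (e : W) (l : {linear W -> R}).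
Hypotheses (lc : continuous l) (le1 : l e = 1).
Variable g : W -> R.

(** With [l e = 1] this replaces the coordinate [l] by [g] and keeps the class modulo [e]. *)
Definition shear (z : W) : W := z + (g z - l z) *: e.

Lemma shear_coord z : l (shear z) = g z.
Proof. by rewrite linearD linearZ /= le1 [_ *: _]mulr1 addrC subrK. Qed.

Variables (O : set W) (k : R).
Hypotheses (oO : open O)
  (segO : forall z s t, O z -> O (z + s *: e) -> 0 <= t <= 1 -> O (z + t *: (s *: e)))
  (dg : forall z, O z -> differentiable g z)
  (Dg : forall z, O z -> 0 < k * 'D_e g z).

Lemma shear_mono z s : O z -> O (z + s *: e) -> 0 < s -> k * g z < k * g (z + s *: e).
Proof.
move=> Oz Oz' s0; rewrite -subr_gt0 -mulrBr.
have [t t01|t t01 ->] := @mean_value_line _ _ g z (s *: e).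
  by apply: dg; exact: segO.
have Ot : O (z + t *: (s *: e)) by exact: segO.
have dgt := dg Ot.
by rewrite (deriveE _ dgt) linearZ -(deriveE _ dgt)/= mulrCA mulr_gt0// Dg.
Qed.

(** Two points with the same image differ by a multiple of [e] and have the same value of [g], which is
    strictly monotone in the direction [e]. *)
Lemma shear_inj z z' : O z -> O z' -> shear z = shear z' -> z = z'.
Proof.
move=> Oz Oz' E.
have gE : k * g z = k * g z' by rewrite -!shear_coord E.
have [s zE] : exists s, z' = z + s *: e.
  exists ((g z - l z) - (g z' - l z')).
  by rewrite scalerBl addrA -/(shear z) E addrK.
have zE' : z = z' + (- s) *: e by rewrite zE scaleNr addrK.
have [s0|s0|s0] := ltgtP s 0.
- have := @shear_mono z' (- s) Oz'; rewrite -zE' gE ltxx oppr_gt0.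
  by move=> /(_ Oz s0).
- by have := @shear_mono z s Oz; rewrite -zE gE ltxx => /(_ Oz' s0).
- by rewrite zE s0 scale0r addr0.
Qed.

(** The equation [shear z = w] is solved on the line through [w] directed by [e], where it says that [g] takes
    the value [l w]: the intermediate value theorem applies since [g] is strictly monotone on such lines.
    The solution is as close to [z1] as wanted, which gives at once that the image is open and that the
    inverse is continuous. *)
Lemma shear_surj z1 (d : R) : O z1 -> 0 < d ->
  \forall w \near shear z1, exists z, [/\ O z, `|z - z1| < d & shear z = w].
Proof.
move=> Oz1 d0.
have [r /= r0 rO] : exists2 r : R, 0 < r & ball z1 r `<=` O.
  by have /nbhs_ballP[r r0 rO] := open_nbhs_nbhs (conj oO Oz1); exists r.
pose m := Num.min r d.
have m0 : 0 < m by rewrite lt_min r0 d0.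
have mO z : `|z - z1| < m -> O z.
  by move=> zm; apply: rO; rewrite -ball_normE/= distrC (lt_le_trans zm)// ge_min lexx.
(* Moving by at most [eta] along [e] costs half of the distance [m] allowed, moving [w] the other half. *)
pose eta := m / 2 / (1 + `|e|).
have e10 : 0 < 1 + `|e| by rewrite ltr_pwDl.
have eta0 : 0 < eta by rewrite !divr_gt0.
have etae : eta * `|e| <= m / 2.
  rewrite /eta mulrAC ler_pdivrMr// ler_pM2l ?divr_gt0//; by rewrite lerDr.
pose p w := (w - shear z1) - l (w - shear z1) *: e.
pose zz w s := z1 + p w + s *: e.
have zz0 s : zz (shear z1) s = z1 + s *: e.
  by rewrite /zz /p subrr linear0 scale0r subr0 addr0.
have pc : continuous p.
  move=> w; apply: cvgB; first by apply: cvgB; [exact: cvg_id|exact: cvg_cst].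
  apply: (@continuous_comp _ _ _ (fun w => l (w - shear z1)) ( *:%R^~ e)).
    apply: (@continuous_comp _ _ _ (fun w => w - shear z1) l); last exact: lc.
    by apply: cvgB; [exact: cvg_id|exact: cvg_cst].
  exact: scalel_continuous.
have zzc s : continuous (zz^~ s).
  move=> w; apply: cvgD; last exact: cvg_cst.
  by apply: cvgD; [exact: cvg_cst|exact: pc].
have p0 : p (shear z1) = 0 by rewrite /p subrr linear0 scale0r subr0.
have near_p : \forall w \near shear z1, `|p w| < m / 2.
  have := pc (shear z1); rewrite /continuous_at p0 => /cvgr0Pnorm_lt /(_ (m / 2)).
  by apply; rewrite divr_gt0.
have zzm w s : `|p w| < m / 2 -> `|s| <= eta -> `|zz w s - z1| < m.
  move=> pm sm; rewrite /zz addrC !addrA addNr add0r.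
  rewrite (le_lt_trans (ler_normD _ _))// (splitr m) ltr_leD// normrZ.
  by rewrite (le_trans _ etae)// ler_wpM2r.
have nshear : `|p (shear z1)| < m / 2 by rewrite p0 normr0 divr_gt0.
have gc s : `|s| <= eta -> {for shear z1, continuous (fun w => k * (g (zz w s) - l w))}.
  move=> sm; apply: continuousM; first exact: cst_continuous.
  apply: continuousB; last exact: lc.
  apply: continuous_comp; first exact: zzc.
  by apply: differentiable_continuous; apply: dg; apply: mO; exact: zzm.
have Eeta : `|eta| <= eta by rewrite ger0_norm// ltW.
have ENeta : `|- eta| <= eta by rewrite normrN.
have Oz s : `|s| <= eta -> O (z1 + s *: e) by move=> sm; rewrite -zz0; apply: mO; exact: zzm.
have npos : \forall w \near shear z1, 0 < k * (g (zz w eta) - l w).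
  apply: (@cvgr_gt _ _ _ _ _ _ (gc _ Eeta)).
  rewrite zz0 shear_coord mulrBr subr_gt0; apply: shear_mono => //; exact: Oz.
have nneg : \forall w \near shear z1, k * (g (zz w (- eta)) - l w) < 0.
  apply: (@cvgr_lt _ _ _ _ _ _ (gc _ ENeta)).
  rewrite zz0 shear_coord mulrBr subr_lt0.
  have := @shear_mono (z1 + (- eta) *: e) eta (Oz _ ENeta).
  by rewrite scaleNr subrK; apply.
have k0 : k != 0 by apply/eqP => k0; have := Dg Oz1; rewrite k0 mul0r ltxx.
near=> w.
have pw : `|p w| < m / 2 by near: w.
have wpos : 0 < k * (g (zz w eta) - l w) by near: w.
have wneg : k * (g (zz w (- eta)) - l w) < 0 by near: w.
have zzO s : s \in `[- eta, eta] -> O (zz w s).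
  by rewrite in_itv /= -ler_norml => sm; apply: mO; exact: zzm.
have [|||s sI /eqP] := @IVT R (fun s => k * (g (zz w s) - l w)) (- eta) eta 0.
- by rewrite lerNl (le_trans _ (ltW eta0))// oppr_le0 ltW.
- apply: derivable_within_continuous => s sI.
  apply: derivableM => //; apply: derivableB => //.
  by have := is_derive_along_line (dg (zzO _ sI)).
- by rewrite ge_min le_max (ltW wneg) (ltW wpos) orbT.
rewrite mulf_eq0 (negbTE k0)/= subr_eq0 => /eqP gE.
have sm : `|s| <= eta by move: sI; rewrite in_itv /= -ler_norml.
exists (zz w s); split; first exact: zzO.
  by rewrite (lt_le_trans (zzm _ _ pw sm))// ge_min lexx orbT.
rewrite /shear gE.
have lp : l (p w) = 0.
  by rewrite /p linearB linearZ /= le1 [_ *: _]mulr1 subrr.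
have -> : l (zz w s) = l z1 + s.
  by rewrite /zz [l (_ + s *: e)]linearD [l (z1 + _)]linearD lp linearZ /= le1 [_ *: 1]mulr1 addr0.
rewrite /zz /p linearB /= shear_coord /shear opprD !addrA [z1 + w]addrC addrK.
rewrite -!addrA -!scaleNr -!scalerDl [X in _ + X *: e](_ : _ = 0) ?scale0r ?addr0//.
ring.
Unshelve. all: by end_near. Qed.

Lemma shear_open : open (shear @` O).
Proof.
rewrite openE => _ [z1 Oz1 <-].
have := shear_surj Oz1 ltr01; rewrite /interior.
by apply: filterS => w [z [Oz _ <-]]; exists z.
Qed.

Variable H : W -> W.
Hypothesis HK : forall z, O z -> H (shear z) = z.

Lemma shear_inv_continuous w : (shear @` O) w -> {for w, continuous H}.
Proof.
move=> [z1 Oz1 <-]; rewrite /prop_for /continuous_at HK//.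
apply/cvgrPdist_lt => d d0; have := shear_surj Oz1 d0.
by apply: filterS => w' [z [Oz zd <-]]; rewrite HK// distrC.
Qed.

Let mu z v := (l v - 'd g z v) / 'D_e g z.

(** The displacement of the solution is the displacement of the data plus a multiple [del] of [e]; solving
    the first order expansion of [g] for [del] gives [mu], up to an error that is absorbed because [g] has
    a nonzero derivative along [e]. *)
Lemma shear_inv_diff z : O z -> differentiable H (shear z) /\
  forall v, 'd H (shear z) v = v + mu z v *: e.
Proof.
move=> Oz; have dgz := dg Oz.
have D0 : 'D_e g z != 0 by apply/eqP => D0; have := Dg Oz; rewrite D0 mulr0 ltxx.
have muP a u v : mu z (a *: u + v) = a * mu z u + mu z v.
  have El : l (a *: u + v) = a * l u + l v by exact: linearP.
  have Ed : 'd g z (a *: u + v) = a * 'd g z u + 'd g z v by exact: linearP.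
  by rewrite /mu El Ed; ring.
have lin : linear (fun v => v + mu z v *: e).
  by move=> a u v; rewrite muP scalerDl -scalerA scalerDr addrACA.
pose L : {linear W -> W} := HB.pack (fun v => v + mu z v *: e)
  (GRing.isLinear.Build _ _ _ _ _ lin).
have mlin : linear (mu z : W -> R) by exact: muP.
pose M : {linear W -> R} := HB.pack (mu z) (GRing.isLinear.Build _ _ _ _ _ mlin).
have cM : continuous M.
  move=> v; apply: cvgMl; apply: cvgB; first exact: lc.
  exact: diff_continuous.
have cL : continuous L.
  move=> v; apply: cvgD; first exact: cvg_id.
  apply: (@continuous_comp _ _ _ (mu z) ( *:%R^~ e)); first exact: cM.
  exact: scalel_continuous.
have [C C0 MC] := linear_lipschitz cM.
suff [dH EH] : differentiable H (shear z) /\ 'd H (shear z) = L :> (W -> W).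
  by split=> // v; rewrite EH.
apply: differential_eps => // eps eps0.
set D := 'D_e g z.
pose K := 1 + C * `|e| + `|e|.
have K0 : 0 < K.
  rewrite /K -addrA ltr_pwDl// addr_ge0// mulr_ge0//; exact: ltW.
have aD : 0 < `|D| by rewrite normr_gt0.
(* The error in the expansion of [g] is [E * (K * |h| + x * |e|)], where [x = |mu - del|]; this [E] makes the
   term in [x] at most [x * |D| / 2], to be absorbed. *)
pose E := Num.min 1 eps * `|D| / 2 / (1 + `|e|) / K.
have m0 : 0 < Num.min 1 eps by rewrite lt_min ltr01.
have e1 : 0 < 1 + `|e| by rewrite ltr_pwDl.
have E0 : 0 < E by rewrite !divr_gt0// mulr_gt0.
have Hc := @shear_inv_continuous (shear z) (ex_intro2 _ _ z Oz erefl).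
have dH0 : (fun h => H (h + shear z) - z) @ (0 : W) --> (0 : W).
  rewrite -[X in _ --> X](subrr z); apply: cvgB; last exact: cvg_cst.
  rewrite -{2}(HK Oz).
  have Hs : (fun h => h + shear z) @ (0 : W) --> shear z.
    by rewrite -[X in _ --> X]add0r; apply: cvgD; [exact: cvg_id|exact: cvg_cst].
  exact: (cvg_comp _ _ Hs Hc).
have G0 : \forall h \near (0 : W), let z' := H (h + shear z) - z in
    `|g (z' + z) - g z - 'd g z z'| <= E * `|z'|.
  exact: dH0 _ (differentiable_eps dgz E0).
have S0 : \forall h \near (0 : W), exists z', [/\ O z', `|z' - z| < 1 & shear z' = h + shear z].
  have := shear_surj Oz ltr01; rewrite (near_shift 0) subr0; exact.
rewrite HK//.
move: G0 S0; apply: filterS2 => h /= + [z' [Oz' _ hE]].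
rewrite -hE HK// subrK => Gh.
have hE' : h = shear z' - shear z by rewrite hE addrK.
pose del := (l z' - g z') - (l z - g z).
have zE : z' - z = h + del *: e.
  have -> : del = - ((g z' - l z') - (g z - l z)) by rewrite /del; ring.
  rewrite hE' /shear; move: (g z' - l z') (g z - l z) => a' a.
  by rewrite scaleNr scalerBl opprD addrACA addrK.
have gE : l h = g z' - g z by rewrite hE' linearB !shear_coord.
rewrite zE in Gh.
have Edel : mu z h - del = (g z' - g z - 'd g z (h + del *: e)) / D.
  have Ed : 'd g z (h + del *: e) = 'd g z h + del * D.
    by rewrite /D (deriveE _ dgz) linearD; congr (_ + _); exact: linearZ.
  by rewrite Ed /mu gE -/D; field.
rewrite zE /L /= opprD addrACA subrr add0r -scalerBl normrZ distrC.
set x := `|mu z h - del|.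
have xD : x * `|D| <= E * `|h + del *: e|.
  by rewrite /x Edel normrM normfV mulfVK ?normr_eq0.
have he : `|h + del *: e| <= K * `|h| + x * `|e|.
  rewrite (le_trans (ler_normD _ _))// normrZ.
  have : `|del| <= `|mu z h| + x.
    by rewrite /x -{1}(subrK (mu z h) del) addrC (le_trans (ler_normD _ _))// distrC.
  move=> dx; have Mh := MC h; rewrite /M /= in Mh.
  have := ler_wpM2r (normr_ge0 e) dx; have := ler_wpM2r (normr_ge0 e) Mh.
  rewrite /K; have : 0 <= `|e| * `|h| by rewrite mulr_ge0.
  by nra.
have x0 : 0 <= x by exact: normr_ge0.
have EK : E * K = Num.min 1 eps * `|D| / 2 / (1 + `|e|).
  by rewrite /E divfK// gt_eqF.
have K1 : 1 <= K by rewrite /K -addrA lerDl addr_ge0// mulr_ge0// ltW.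
have EE : E * `|e| <= `|D| / 2.
  apply: (@le_trans _ _ (E * K * (1 + `|e|))).
    by apply: ler_pM => //; [exact: ltW|rewrite ler_peMr// ltW|rewrite lerDr].
  by rewrite EK divfK ?gt_eqF// -mulrA ler_piMl ?divr_ge0// ge_min lexx.
have xx : x * (`|D| / 2) <= E * K * `|h|.
  have := ler_wpM2l (ltW E0) he; have := ler_wpM2l x0 EE; nra.
have xh : x * (1 + `|e|) <= Num.min 1 eps * `|h|.
  rewrite EK in xx; rewrite -(ler_pM2r (divr_gt0 aD (ltr0Sn R 1))) mulrAC.
  rewrite -ler_pdivlMr// (le_trans xx)//; rewrite le_eqVlt; apply/orP; left; apply/eqP; ring.
apply: (@le_trans _ _ (x * (1 + `|e|))).
  by rewrite ler_wpM2l// lerDr.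
by rewrite (le_trans xh)// ler_wpM2r// ge_min lexx orbT.
Qed.

(** The formula for the differential of the inverse involves the inverse itself only through its values:
    each order of differentiability yields the next one. *)
Lemma shear_inv_Ck k' : (forall k, Ck k O g) -> forall b : coordinates W,
  Ck k' (shear @` O) H.
Proof.
move=> Cg b; elim: k' => [|k' IH].
  by move=> w; exact: shear_inv_continuous.
split=> [_ [z Oz <-]|v]; first by have [] := shear_inv_diff Oz.
have oS := shear_open.
have HO w : (shear @` O) w -> O (H w) by move=> [z Oz <-]; rewrite HK.
have D0 z : O z -> 'D_e g z != 0.
  by move=> Oz; apply/eqP => D0; have := Dg Oz; rewrite D0 mulr0 ltxx.
have CD u : Ck k' (shear @` O) (fun w => 'D_u g (H w)).
  apply: (@Ck_comp_scalar _ _ _ b _ _ O H (fun w => 'D_u g w)) => //.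
  by have [_] := Cg k'.+1; exact.
have lin : linear (fun a : R => a *: e) by move=> a u w /=; rewrite scalerDl -scalerA.
pose L : {linear R -> W} := HB.pack (fun a : R => a *: e)
  (GRing.isLinear.Build _ _ _ _ _ lin).
have C := @Ck_linear_comp _ _ _ _ L k' _ _ (@scalel_continuous _ _ e) oS
  (CkM oS (CkB oS (@Ck_cst _ _ _ k' _ (l v)) (CD v)) (CkV oS (fun w Ow => D0 _ (HO w Ow)) (CD e))).
apply: Ck_ext (CkD oS (@Ck_cst _ _ _ k' _ v) C) => // w.
rewrite inE => -[z Oz <-]; have [dH EH] := shear_inv_diff Oz.
by rewrite [in RHS](deriveE _ dH) EH /L /= HK// /mu -(deriveE _ (dg Oz)).
Qed.

End Shear.

(** * Ordinary differential equations *)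

Section Antiderivative.
Variable R : realType.

Lemma derive_eq_cst (F G f : R -> R) (a b : R) :
  (forall t, a < t < b -> is_derive t 1 F (f t)) ->
  (forall t, a < t < b -> is_derive t 1 G (f t)) ->
  forall s t, a < s < b -> a < t < b -> F t - F s = G t - G s.
Proof.
move=> dF dG.
suff H s t : a < s < b -> a < t < b -> s <= t -> F t - F s = G t - G s.
  move=> s t si ti; have [st|/ltW ts] := leP s t; first exact: H.
  by rewrite -[LHS]opprB -[RHS]opprB (H t s).
move=> /andP[as_ sb] /andP[at_ tb] st.
have dFG (u : R) : a < u < b -> is_derive u 1 (fun u => F u - G u) 0.
  move=> ui; rewrite -(subrr (f u)); apply: is_deriveB; [exact: dF|exact: dG].
have uI (u : R) : u \in `[s, t] -> a < u < b.
  rewrite in_itv /= => /andP[su ut].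
  by rewrite (lt_le_trans as_ su) (le_lt_trans ut tb).
have [||u _] := @MVT_segment R (fun u => F u - G u) (fun=> 0) s t st.
- by move=> u uI'; apply: dFG; apply: uI; move: uI'; rewrite !in_itv/= => /andP[/ltW-> /ltW->].
- apply: derivable_within_continuous => u ui.
  by have [] := dFG u (uI u ui).
by rewrite mul0r => E; lra.
Qed.

(** The integral from [- T] is an antiderivative on the interval of half-length [T]; for different [T] these agree up
    to a constant, so they patch into a function on the whole line. *)
Lemma antiderivative (f : R -> R) : continuous f ->
  exists2 F : R -> R, F 0 = 0 & forall t : R, is_derive t 1 F (f t).
Proof.
move=> fc.
pose I (T x : R) := (\int[lebesgue_measure]_(t in `[- T, x]) f t)%R.
have dI (T x : R) : - T < x < T -> is_derive x 1 (I T) (f x).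
  move=> /andP[Tx xT].
  have int : lebesgue_measure.-integrable `[- T, T] (EFin \o f).
    apply: continuous_compact_integrable; first exact: segment_compact.
    exact: continuous_subspaceT.
  have [dx Ex] := @continuous_FTC1_closed R f (- T) x T xT int Tx (fc x).
  by apply: DeriveDef => //; rewrite -derive1E.
pose F (t : R) := I (`|t| + 1) t - I (`|t| + 1) 0.
have FE (T t : R) : `|t| < T -> F t = I T t - I T 0.
  move=> tT; rewrite /F.
  pose S := Num.min T (`|t| + 1).
  have tS : `|t| < S by rewrite lt_min tT ltrDl ltr01.
  have inS (u : R) : - S < u < S -> - T < u < T /\ - (`|t| + 1) < u < `|t| + 1.
    rewrite /S -!ltr_norml lt_min => /andP[-> ->]; by [].
  have S0 : 0 < S by rewrite (le_lt_trans _ tS).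
  have t0 : - S < t < S by rewrite -ltr_norml.
  have o0 : - S < 0 < S by rewrite oppr_lt0 S0.
  apply: (@derive_eq_cst _ _ f (- S) S) => // u /inS[u1 u2]; exact: dI.
exists F; first by rewrite /F subrr.
move=> t; apply: (@near_eq_is_derive _ _ _ (fun u => I (`|t| + 1) u - I (`|t| + 1) 0)).
  have : \forall u \near t, `|u| < `|t| + 1.
    have := @norm_continuous R R t => /cvgr_lt; apply.
    by rewrite ltrDl.
  by apply: filterS => u /FE.
rewrite -[f t]subr0; apply: is_deriveB.
by apply: dI; rewrite -ltr_norml ltrDl.
Qed.

End Antiderivative.

Section RowFunctions.
Variables (R : realType) (n : nat).

Lemma coord_le_norm (v : 'rV[R]_n) i : `|v 0 i| <= `|v|.
Proof. rewrite [leRHS]/Num.Def.normr/= mx_normrE; exact: (le_bigmax _ _ (0, i)). Qed.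

Lemma norm_le_coord (v : 'rV[R]_n) (c : R) : 0 <= c ->
  (forall i, `|v 0 i| <= c) -> `|v| <= c.
Proof.
move=> c0 H; rewrite [leLHS]/Num.Def.normr/= mx_normrE.
by apply: bigmax_le => // -[i j] _ /=; rewrite ord1.
Qed.

Lemma is_derive_row (c : R -> 'rV[R]_n) (t : R) (v : 'rV[R]_n) :
  (forall i, is_derive t 1 (fun s => c s 0 i) (v 0 i)) -> is_derive t 1 c v.
Proof.
move=> H.
have dc : derivable c t 1 by apply/derivable_mxP => i j; rewrite ord1; have [] := H j.
apply: DeriveDef => //; rewrite derive_mx//; apply/matrixP => i j.
by rewrite !mxE ord1; have [] := H j.
Qed.

Lemma is_derive_coord (c : R -> 'rV[R]_n) (t : R) (v : 'rV[R]_n) i :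
  is_derive t 1 c v -> is_derive t 1 (fun s => c s 0 i) (v 0 i).
Proof.
move=> [dc <-]; apply: DeriveDef; first by move/derivable_mxP : dc.
by rewrite derive_mx// mxE.
Qed.

End RowFunctions.

Lemma continuous_lipschitz (R : realType) (V W : normedModType R) (F : V -> W) (L : R) :
  0 < L -> (forall a b, `|F a - F b| <= L * `|a - b|) -> continuous F.
Proof.
move=> L0 FL a; apply/cvgrPdist_lt => e e0; apply/nbhs_ballP.
exists (L^-1 * e); first by rewrite /= mulr_gt0// invr_gt0.
move=> b; rewrite -ball_normE /= => ab.
by rewrite (le_lt_trans (FL _ _))// -ltr_pdivlMl.
Qed.

Section ODE.
Variables (R : realType) (n : nat) (X : 'rV[R]_n -> 'rV[R]_n) (L M : R).
Hypotheses (L0 : 0 < L) (XL : forall a b, `|X a - X b| <= L * `|a - b|)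
  (XM : forall a, `|X a| <= M).

Let E (t : R) := expR (2 * L * `|t|).

Let E_ge1 t : 1 <= E t.
Proof.
apply: le_trans (expR_ge1Dx _); rewrite lerDl !mulr_ge0//; exact: ltW.
Qed.

Let E_ge0 t : 0 <= E t.
Proof. exact: le_trans ler01 (E_ge1 t). Qed.

(** The weight [E t = exp (2 L |t|)] is chosen so that integrating a bound [L * C * E] returns at most half of
    [C * E]: with it Picard iteration contracts on the whole line at once and no interval has to be cut. *)
Lemma weighted_bound (f df : R -> R) (C : R) : f 0 = 0 ->
  (forall t : R, is_derive t 1 f (df t)) ->
  (forall t, `|df t| <= L * C * E t) -> forall t, `|f t| <= C / 2 * E t.
Proof.
suff H (f' df' : R -> R) : f' 0 = 0 ->
    (forall t : R, is_derive t 1 f' (df' t)) ->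
    (forall t, `|df' t| <= L * C * E t) -> forall t, 0 <= t -> f' t <= C / 2 * E t.
  move=> f0 dfE dfC t.
  have N0 : - f 0 = 0 by rewrite f0 oppr0.
  have dN (s : R) : is_derive s 1 (fun s => - f s) (- df s) by apply: is_deriveN; exact: dfE.
  have dNC s : `|- df s| <= L * C * E s by rewrite normrN.
  have dR (s : R) : is_derive s 1 (fun s => f (- s)) (- df (- s)).
    by rewrite -mulrN1; apply: is_derive1_comp; exact: is_deriveNid.
  have dRC s : `|- df (- s)| <= L * C * E s by rewrite normrN (le_trans (dfC _))// /E normrN.
  have dRN (s : R) : is_derive s 1 (fun s => - f (- s)) (- (- df (- s))) by exact: is_deriveN.
  have dRNC s : `|- (- df (- s))| <= L * C * E s by rewrite normrN.
  have R0 : f (- 0) = 0 by rewrite oppr0.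
  have RN0 : - f (- 0) = 0 by rewrite oppr0.
  rewrite ler_norml; have [t0|/ltW t0] := leP 0 t.
    by rewrite lerNl (H _ _ N0 dN)// (H _ _ f0 dfE).
  rewrite -oppr_ge0 in t0.
  have := H _ _ R0 dR dRC _ t0; have := H _ _ RN0 dRN dRNC _ t0.
  by rewrite /= opprK /E normrN lerNl => -> ->.
move=> f0 dfE dfC t t0.
have C0 : 0 <= C.
  have := le_trans (normr_ge0 _) (dfC 0).
  by rewrite pmulr_lge0 ?(lt_le_trans ltr01)// pmulr_rge0.
pose g s := C / 2 * expR (2 * L * s) - f' s.
have dg (s : R) : is_derive s 1 g (L * C * expR (2 * L * s) - df' s).
  apply: is_deriveB.
  have d2 : is_derive s 1 (fun s : R => 2 * L * s) (2 * L).
    by have := @is_deriveZ _ _ _ id (2 * L) s 1 1 (is_derive_id _ _); rewrite [_ *: 1]mulr1; exact.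
  have := @is_deriveZ _ _ _ _ (C / 2) s 1 _ (is_derive1_comp (is_derive_expR _) d2).
  by rewrite (_ : (C / 2) *: _ = L * C * expR (2 * L * s))// /GRing.scale/=; field.
have [|s + gE] := @MVT_segment R g _ 0 t t0 (fun s _ => dg s).
  by apply: derivable_within_continuous => s _; have [] := dg s.
rewrite in_itv/= => /andP[s0 st].
have : 0 <= g t - g 0.
  rewrite gE mulr_ge0 ?subr0// subr_ge0; have := dfC s; rewrite /E (ger0_norm s0).
  exact: le_trans (ler_norm _).
rewrite /g f0 !mulr0 expR0 mulr1 subr0 /E (ger0_norm t0); lra.
Qed.
(** Two steps of Picard iteration started from functions at weighted distance [C] are at weighted distance
    at most [C / 2]. *)
Lemma contraction (u w a b : R -> 'rV[R]_n) (C : R) : a 0 = b 0 ->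
  (forall t : R, is_derive t 1 a (X (u t))) ->
  (forall t : R, is_derive t 1 b (X (w t))) ->
  (forall t, `|u t - w t| <= C * E t) ->
  forall t, `|a t - b t| <= C / 2 * E t.
Proof.
move=> ab0 da db uw t.
have C0 : 0 <= C.
  by have := le_trans (normr_ge0 _) (uw 0); rewrite pmulr_lge0 ?(lt_le_trans ltr01).
apply: norm_le_coord; first by rewrite !mulr_ge0 ?E_ge0.
move=> i; rewrite !mxE.
apply: (@weighted_bound (fun t => a t 0 i - b t 0 i) (fun t => X (u t) 0 i - X (w t) 0 i)).
- by rewrite ab0 subrr.
- by move=> s; apply: is_deriveB; apply: is_derive_coord.
move=> s; have := coord_le_norm (X (u s) - X (w s)) i; rewrite !mxE => /le_trans; apply.
by rewrite (le_trans (XL _ _))// -mulrA ler_wpM2l// ltW.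
Qed.

Let C0 := M / L.

Let M0 : 0 <= M.
Proof. exact: le_trans (normr_ge0 _) (XM 0). Qed.

(** The field being bounded, the first step of the iteration is at finite weighted distance from a constant. *)
Lemma first_bound (u w a : R -> 'rV[R]_n) : a 0 = u 0 ->
  (forall t : R, is_derive t 1 a (X (w t))) -> (forall t, u t = u 0) ->
  forall t, `|a t - u t| <= C0 * E t.
Proof.
move=> a0 da uc t; apply: norm_le_coord; first by rewrite mulr_ge0 ?divr_ge0 ?E_ge0// ltW.
move=> i; rewrite !mxE uc.
apply: le_trans (@weighted_bound (fun t => a t 0 i - u 0 0 i) (fun t => X (w t) 0 i) C0 _ _ _ t) _.
- by rewrite a0 subrr.
- move=> s; rewrite -[X (w s) 0 i]subr0; apply: is_deriveB.
  exact: is_derive_coord.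
- move=> s; rewrite /C0 mulrCA divff ?gt_eqF// mulr1 (le_trans (coord_le_norm _ _))//.
  by rewrite (le_trans (XM _))// ler_peMr.
- rewrite ler_wpM2r ?E_ge0// ler_pdivrMr// ler_peMr ?ler1n//.
  by rewrite divr_ge0// ltW.
Qed.

Lemma halves_le0 (x C : R) : (forall k, x <= C / 2 ^+ k) -> x <= 0.
Proof.
move=> H; rewrite leNgt; apply/negP => x0.
have C1 : 0 < C by rewrite (lt_le_trans x0)// (le_trans (H 0%N))// expr0 divr1.
have := @cvg_geometric R C (2^-1).
rewrite ger0_norm ?invr_ge0// invf_lt1// ltr1n => /(_ isT).
move=> /cvgr_lt /(_ x x0) [k _ /(_ k (leqnn k))] /=.
by rewrite exprVn ltNge H.
Qed.

(** Two solutions are at finite weighted distance, and a solution is its own Picard iterate: the distance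
    is at most half of itself. *)
Lemma ode_unique0 (c1 c2 : R -> 'rV[R]_n) : c1 0 = c2 0 ->
  (forall t : R, is_derive t 1 c1 (X (c1 t))) ->
  (forall t : R, is_derive t 1 c2 (X (c2 t))) -> c1 = c2.
Proof.
move=> c0 d1 d2.
have H k t : `|c1 t - c2 t| <= (2 * C0) / 2 ^+ k * E t.
  elim: k t => [|k IH] t; last first.
    rewrite exprSr invfM mulrA; exact: contraction d1 d2 IH t.
  have dc s : `|c1 s - c1 0| <= C0 * E s := first_bound (u := fun=> c1 0) (a := c1) erefl d1 (fun=> erefl) s.
  have dc' s : `|c2 s - c2 0| <= C0 * E s := first_bound (u := fun=> c2 0) (a := c2) erefl d2 (fun=> erefl) s.
  rewrite expr0 divr1 -mulrA mulr_natl mulr2n -(subrKA (c1 0)).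
  by rewrite (le_trans (ler_normD _ _))// lerD// distrC c0.
apply/funext => t; apply/eqP; rewrite -subr_eq0 -normr_le0.
apply: (@halves_le0 _ (2 * C0 * E t)) => k; rewrite mulrAC; exact: H.
Qed.

Lemma ode_unique (c1 c2 : R -> 'rV[R]_n) s : c1 s = c2 s ->
  (forall t : R, is_derive t 1 c1 (X (c1 t))) ->
  (forall t : R, is_derive t 1 c2 (X (c2 t))) -> c1 = c2.
Proof.
have shift (c : R -> 'rV[R]_n) : (forall t : R, is_derive t 1 c (X (c t))) ->
    forall t : R, is_derive t 1 (fun t => c (t + s)) (X (c (t + s))).
  move=> d t; have [dc <-] := d (t + s).
  have ds : is_derive t 1 (fun t : R => t + s) 1.
    by rewrite -[X in is_derive _ _ _ X]addr0; apply: is_deriveD.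
  by apply: (is_derive_curve ds); apply/derivable1_diffP.
move=> cs d1 d2.
have H : (fun t => c1 (t + s)) = (fun t => c2 (t + s)).
  by apply: ode_unique0 (shift _ d1) (shift _ d2); rewrite add0r.
by apply/funext => t; have := congr1 (fun c => c (t - s)) H; rewrite /= subrK.
Qed.

Lemma continuous_derivable (V : normedModType R) (c : R -> V) (v : R -> V) :
  (forall t : R, is_derive t 1 c (v t)) -> continuous c.
Proof.
by move=> dc t; apply/differentiable_continuous/derivable1_diffP; have [] := dc t.
Qed.

(** Picard iteration converges geometrically for the weighted distance.  The iterates are all [M]-Lipschitz,
    hence so is the limit, whose next iterate makes sense and is the limit again. *)
Theorem ode_exists (y : 'rV[R]_n) : exists c : R -> 'rV[R]_n,
  c 0 = y /\ forall t : R, is_derive t 1 c (X (c t)).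
Proof.
have [N NE] : exists N : (R -> 'rV[R]_n) -> (R -> 'rV[R]_n), forall u, continuous u ->
    N u 0 = y /\ forall t : R, is_derive t 1 (N u) (X (u t)).
  suff /choice[N NE] : forall u : R -> 'rV[R]_n, exists a : R -> 'rV[R]_n, continuous u ->
      a 0 = y /\ forall t : R, is_derive t 1 a (X (u t)) by exists N.
  move=> u; have [uc|nu] := pselect (continuous u); last by exists u.
  have /choice[F FE] : forall i, exists F : R -> R, F 0 = 0 /\
      forall t : R, is_derive t 1 F (X (u t) 0 i).
    move=> i; have [|F F0 dF] := @antiderivative R (fun t => X (u t) 0 i).
      move=> t; apply: (@continuous_comp _ _ _ (X \o u) (fun v : 'rV[R]_n => v 0 i)).
        by apply: continuous_comp; [exact: uc|exact: (continuous_lipschitz L0 XL)].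
      exact: coord_continuous.
    by exists F.
  exists (fun t => \row_i (y 0 i + F i t)) => _; split.
    by apply/rowP => i; rewrite mxE (FE i).1 addr0.
  move=> t; apply: is_derive_row => i.
  rewrite (_ : (fun s => _) = fun s => y 0 i + F i s); last by apply/funext => s; rewrite mxE.
  rewrite -[X in is_derive _ _ _ X]add0r; apply: is_deriveD; exact: (FE i).2.
pose u k := iter k N (fun=> y).
have uc k : continuous (u k).
  elim: k => [|k IH]; first exact: cst_continuous.
  exact: continuous_derivable (NE _ IH).2.
have u0 k : u k 0 = y by case: k => // k; exact: (NE _ (uc k)).1.
have du k (t : R) : is_derive t 1 (u k.+1) (X (u k t)) by exact: (NE _ (uc k)).2.
have d1 k t : `|u k.+1 t - u k t| <= C0 / 2 ^+ k * E t.
  elim: k t => [|k IH] t; last first.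
    rewrite exprSr invfM mulrA; apply: contraction (du k.+1) (du k) IH t.
    by rewrite !u0.
  by rewrite expr0 divr1; apply: (first_bound (u := u 0%N)) (du 0%N) _ t; rewrite ?u0.
have C00 : 0 <= C0 by rewrite divr_ge0// ltW.
have dm k m t : `|u (k + m)%N t - u k t| <= 2 * C0 / 2 ^+ k * E t.
  suff : `|u (k + m)%N t - u k t| <= (2 - 2 / 2 ^+ m) * (C0 / 2 ^+ k * E t).
    move=> /le_trans; apply.
    rewrite [leRHS](_ : _ = 2 * (C0 / 2 ^+ k * E t)); last by rewrite !mulrA.
    apply: ler_wpM2r; first by rewrite !mulr_ge0 ?invr_ge0 ?exprn_ge0 ?(ltW L0).
    by rewrite lerBlDr lerDl divr_ge0// exprn_ge0.
  elim: m => [|m IH]; first by rewrite addn0 subrr normr0 expr0 divr1 subrr mul0r.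
  rewrite addnS -(subrKA (u (k + m)%N t)) (le_trans (ler_normD _ _))//.
  apply: le_trans (lerD (d1 _ t) IH) _.
  rewrite exprD exprS !invfM; move: (2 ^+ m)^-1 (2 ^+ k)^-1 => p q.
  by rewrite le_eqVlt; apply/orP; left; apply/eqP; field.
have cvgu t i : cvgn (fun k => u k t 0 i).
  apply: cauchy_cvg; apply: cauchy_exP => e e0.
  have [k kE] : exists k, 2 * C0 / 2 ^+ k * E t < e.
    apply: contrapT => /forallNP H; have : e <= 0; last by rewrite leNgt e0.
    by apply: (@halves_le0 _ (2 * C0 * E t)) => k; rewrite mulrAC leNgt; apply/negP; exact: H.
  exists (u k t 0 i); exists k => // m /= km.
  rewrite -ball_normE /= distrC -(subnKC km).
  have := coord_le_norm (u (k + (m - k))%N t - u k t) i; rewrite !mxE.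
  by move=> /le_lt_trans; apply; rewrite (le_lt_trans (dm _ _ _)).
pose v t := \row_i limn (fun k => u k t 0 i).
have uv k t : `|u k t - v t| <= 2 * C0 / 2 ^+ k * E t.
  apply: norm_le_coord => [|i].
    by rewrite !mulr_ge0 ?invr_ge0 ?exprn_ge0 ?(ltW L0).
  rewrite !mxE; apply: (@cvgr_to_le _ \oo _ _ (fun m => `|u k t 0 i - u m t 0 i|)).
    apply: cvg_norm; apply: (@cvgB _ _ _ _ _ (fun=> u k t 0 i) (fun m => u m t 0 i)).
      exact: cvg_cst.
    exact: cvgu.
  exists k => // m /= km; rewrite distrC -(subnKC km).
  have := coord_le_norm (u (k + (m - k))%N t - u k t) i; rewrite !mxE.
  by move=> /le_trans; apply.
have uL k s t : `|u k s - u k t| <= M * `|s - t|.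
  apply: norm_le_coord => [|i]; first by rewrite mulr_ge0.
  rewrite !mxE; wlog st : s t / s <= t.
    by move=> H; have [/H//|/ltW/H] := leP s t; rewrite distrC [X in _ * X]distrC.
  case: k => [|k]; first by rewrite subrr normr0 mulr_ge0.
  have dk (r : R) := @is_derive_coord _ _ _ r _ i (du k r).
  have [|r _] := @MVT_segment R (fun r => u k.+1 r 0 i) _ s t st (fun r _ => dk r).
    by apply: derivable_within_continuous => r _; have [] := dk r.
  rewrite distrC => ->; rewrite normrM distrC ler_wpM2r//.
  by rewrite (le_trans (coord_le_norm _ _)).
have vc : continuous v.
  apply: (@continuous_lipschitz _ _ _ _ (M + 1)); first by rewrite ltr_wpDl.
  move=> s t.
  rewrite -subr_le0; apply: (@halves_le0 _ (2 * C0 * (E s + E t))) => k.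
  rewrite lerBlDl.
  have -> : v s - v t = (u k s - u k t) + ((u k t - v t) - (u k s - v s)).
    by apply/rowP => i; rewrite !mxE; ring.
  rewrite (le_trans (ler_normD _ _))// lerD//.
    by rewrite (le_trans (uL _ _ _))// ler_wpM2r// lerDl.
  rewrite (le_trans (ler_normB _ _))//.
  apply: le_trans (lerD (uv k t) (uv k s)) _.
  by rewrite le_eqVlt; apply/orP; left; apply/eqP; ring.
have [Nv0 dN] := NE _ vc.
suff vE : N v = v.
  by exists v; split; [rewrite -vE|rewrite -{1}vE].
apply/funext => t; apply/eqP; rewrite -subr_eq0 -normr_le0.
apply: (@halves_le0 _ (2 * C0 * E t)) => k.
have H : `|N v t - u k.+1 t| <= 2 * C0 / 2 ^+ k / 2 * E t.
  apply: contraction dN (du k) _ t; first by rewrite Nv0 u0.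
  by move=> s; rewrite distrC.
rewrite -(subrKA (u k.+1 t)) (le_trans (ler_normD _ _))//.
apply: le_trans (lerD H (uv k.+1 t)) _.
rewrite exprS !invfM; move: (2 ^+ k)^-1 => p.
by rewrite le_eqVlt; apply/orP; left; apply/eqP; field.
Qed.
End ODE.

(** * Lipschitz quotients *)

Section Quotient.
Variables (R : realType) (V : normedModType R).

(** The increments of [G] and [P], which vanish to second order at 0, are bounded by the distance times the
    larger norm, so that the two factors [|b|] lost by dividing by [P b] are regained, one from the
    increment and one from [Y a]; hence the assumption [|a| <= |b|]. *)
Lemma quotient_lipschitz (r K k : R) (G P Y : V -> R) : 0 < k -> 0 <= K ->
  G 0 = 0 -> P 0 = 0 -> Y 0 = 0 ->
  (forall a b, `|a| <= r -> `|b| <= r -> `|a| <= `|b| -> `|G a - G b| <= K * `|b| * `|a - b|) ->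
  (forall a b, `|a| <= r -> `|b| <= r -> `|a| <= `|b| -> `|P a - P b| <= K * `|b| * `|a - b|) ->
  (forall a b, `|a| <= r -> `|b| <= r -> `|Y a - Y b| <= K * `|a - b|) ->
  (forall a, `|a| <= r -> k * `|a| ^+ 2 <= `|P a|) ->
  forall a b, `|a| <= r -> `|b| <= r ->
  `|G a * Y a / P a - G b * Y b / P b| <= (2 * K ^+ 2 / k + K ^+ 3 / k ^+ 2) * `|a - b|.
Proof.
move=> k0 K0 G0 P0 Y0 GL PL YL Pk.
suff H a b : `|a| <= r -> `|b| <= r -> `|a| <= `|b| ->
    `|G a * Y a / P a - G b * Y b / P b| <= (2 * K ^+ 2 / k + K ^+ 3 / k ^+ 2) * `|a - b|.
  move=> a b ar br; have [ab|/ltW ba] := leP `|a| `|b|; first exact: H.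
  by rewrite distrC [`|a - b|]distrC H.
move=> ar br ab.
have nz z : `|z| <= r -> z != 0 -> P z != 0.
  move=> zr z0; rewrite -normr_gt0 (lt_le_trans _ (Pk _ zr))// mulr_gt0// exprn_gt0// normr_gt0//.
have r0 : `|0 : V| <= r by rewrite normr0 (le_trans _ ar).
have Gz z : `|z| <= r -> `|G z| <= K * `|z| ^+ 2.
  by move=> zr; have := GL 0 z r0 zr; rewrite G0 !sub0r !normrN normr0 expr2 mulrA; apply.
have Yz z : `|z| <= r -> `|Y z| <= K * `|z|.
  by move=> zr; have := YL 0 z r0 zr; rewrite Y0 !sub0r !normrN; apply.
have GP z : `|z| <= r -> `|G z / P z| <= K / k.
  move=> zr; have [->|z0] := eqVneq z 0; first by rewrite G0 mul0r normr0 divr_ge0// ltW.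
  have Pz : 0 < `|P z| by rewrite normr_gt0 nz.
  rewrite normrM normfV ler_pdivrMr// mulrAC ler_pdivlMr//.
  have := Gz _ zr; have := Pk _ zr; rewrite -(ler_pM2l k0) => h1 h2.
  have := ler_wpM2l K0 (Pk _ zr); nra.
have [b0|b0] := eqVneq b 0.
  have a0 : a = 0 by apply/eqP; rewrite -normr_le0 (le_trans ab)// b0 normr0.
  by rewrite a0 b0 (subrr (G 0 * _ / _)) subrr !normr0 mulr0.
have Pb := nz _ br b0.
have bgt : 0 < `|b| by rewrite normr_gt0.
set d := `|a - b|.
have d0 : 0 <= d by exact: normr_ge0.
have kb : 0 < k * `|b| ^+ 2 by rewrite mulr_gt0// exprn_gt0.
have Q (x : R) : `|x| <= K * `|b| * d -> `|x / P b| <= K / k * (d / `|b|).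
  move=> xK; rewrite normrM normfV ler_pdivrMr ?normr_gt0//.
  apply: le_trans xK _; apply: le_trans (_ : K / k * (d / `|b|) * (k * `|b| ^+ 2) <= _).
    by rewrite le_eqVlt; apply/orP; left; apply/eqP; field; rewrite !gt_eqF.
  by apply: ler_wpM2l; [rewrite !mulr_ge0// ?invr_ge0 ltW|exact: Pk].
have [a0|a0] := eqVneq a 0.
  rewrite a0 G0 !mul0r sub0r normrN mulrAC normrM.
  have -> : d = `|b| by rewrite /d a0 sub0r normrN.
  apply: le_trans (ler_pM _ _ (GP _ br) (Yz _ br)) _ => //.
  rewrite mulrA; apply: ler_wpM2r => //.
  rewrite (_ : K / k * K = K ^+ 2 / k); last by rewrite mulrAC -expr2.
  have : 0 <= K ^+ 2 / k by rewrite divr_ge0 ?exprn_ge0// ltW.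
  have : 0 <= K ^+ 3 / k ^+ 2 by rewrite divr_ge0 ?exprn_ge0// ltW.
  by rewrite -mulrA; lra.
have Pa := nz _ ar a0.
have -> : G a * Y a / P a - G b * Y b / P b =
   ((G a - G b) / P b + (G a / P a) * ((P b - P a) / P b)) * Y a + (G b / P b) * (Y a - Y b).
  by field; rewrite Pa Pb.
have h1 := Q _ (GL _ _ ar br ab).
have h2 : `|(P b - P a) / P b| <= K / k * (d / `|b|) by apply: Q; rewrite distrC PL.
have h3 := GP _ ar; have h4 := GP _ br.
have h5 : `|Y a| <= K * `|b| by rewrite (le_trans (Yz _ ar))// ler_wpM2l.
have h6 := YL _ _ ar br; rewrite -/d in h6.
rewrite (le_trans (ler_normD _ _))//.
have Kk : 0 <= K / k by rewrite divr_ge0// ltW.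
have db : 0 <= d / `|b| by rewrite divr_ge0.
have h7 : `|(G a - G b) / P b + G a / P a * ((P b - P a) / P b)| <=
   K / k * (d / `|b|) + K / k * (K / k * (d / `|b|)).
  by rewrite (le_trans (ler_normD _ _))// lerD// normrM ler_pM.
rewrite (normrM (_ + _)) (normrM (G b / P b)).
apply: le_trans (lerD (ler_pM _ _ h7 h5) (ler_pM _ _ h4 h6)) _ => //.
rewrite le_eqVlt; apply/orP; left; apply/eqP; field.
by rewrite !gt_eqF.
Qed.

End Quotient.

Section Clamp.
Variables (R : realType) (n : nat).

(** A retraction onto the cube of half-side [r], 1-Lipschitz for the sup norm: it extends a Lipschitz field
    on the cube to a bounded Lipschitz field on the whole space. *)
Definition clamp (r : R) (z : 'rV[R]_n) : 'rV[R]_n := \row_i Num.max (- r) (Num.min r (z 0 i)).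

Lemma clamp_norm r z : 0 <= r -> `|clamp r z| <= r.
Proof.
move=> r0; apply: norm_le_coord => // i; rewrite mxE ler_norml le_max lexx/=.
by rewrite ge_max ge_min lexx (le_trans _ r0)// oppr_le0.
Qed.

Lemma clamp_id r z : `|z| <= r -> clamp r z = z.
Proof.
move=> zr; apply/rowP => i; rewrite mxE.
have := le_trans (coord_le_norm z i) zr; rewrite ler_norml => /andP[h1 h2].
by rewrite min_r// max_r.
Qed.

Lemma clamp_lipschitz r a b : `|clamp r a - clamp r b| <= `|a - b|.
Proof.
apply: norm_le_coord => // i; have := coord_le_norm (a - b) i; rewrite !mxE.
move=> h; apply: le_trans h.
have H (x y : R) : x <= y -> 0 <= Num.max (- r) (Num.min r y) - Num.max (- r) (Num.min r x) <= y - x.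
  move=> xy; rewrite /Order.max /Order.min.
  by case: (ltP r y) => ?; case: (ltP r x) => ?; case: ltP => ?; case: ltP => ?; lra.
move: (a 0 i) (b 0 i) => x y; have [xy|/ltW yx] := leP x y.
  have /andP[h0 h1] := H _ _ xy.
  by rewrite distrC [leRHS]distrC !ger0_norm// subr_ge0.
have /andP[h0 h1] := H _ _ yx.
by rewrite !ger0_norm// subr_ge0.
Qed.

Lemma clamp_continuous r : continuous (clamp r).
Proof.
apply: (continuous_lipschitz ltr01) => a b; rewrite mul1r; exact: clamp_lipschitz.
Qed.

End Clamp.

(** * Growth at a nondegenerate minimum *)

Section NearBounds.
Variables (R : realType) (V : normedModType R).

Lemma near_norm_bound (F : V -> R) p : {for p, continuous F} ->
  \forall z \near p, `|F z| <= `|F p| + 1.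
Proof.
move=> Fc.
have : (fun z => `|F z|) @ p --> `|F p| by apply: cvg_norm; exact: Fc.
by move=> /cvgr_le; apply; rewrite ltrDl.
Qed.

Lemma near_norm_bounds (I : finType) (F : I -> V -> R) p :
  (forall i, {for p, continuous (F i)}) ->
  exists2 C : R, 0 <= C & \forall z \near p, forall i, `|F i z| <= C.
Proof.
move=> Fc; exists (\sum_i (`|F i p| + 1)).
  by apply: sumr_ge0 => i _; rewrite addr_ge0.
apply: filter_forall => i; apply: filterS (near_norm_bound (Fc i)) => z /le_trans; apply.
by rewrite (bigD1 i)//= lerDl sumr_ge0// => j _; rewrite addr_ge0.
Qed.

Lemma near_norm_gt (F : V -> R) p : {for p, continuous F} -> F p != 0 ->
  \forall z \near p, `|F p| / 2 <= `|F z|.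
Proof.
move=> Fc Fp.
have : (fun z => `|F z|) @ p --> `|F p| by apply: cvg_norm; exact: Fc.
by move=> /cvgr_ge; apply; rewrite ltr_pdivrMr// ltr_pMr ?normr_gt0// ltr1n.
Qed.

Lemma near_forall (I : finType) (P : I -> V -> Prop) (p : V) :
  (forall i, \forall z \near p, P i z) -> \forall z \near p, forall i, P i z.
Proof. by move=> H; apply: filter_forall. Qed.

Lemma near_and (P Q : V -> Prop) (p : V) : (\forall z \near p, P z) ->
  (\forall z \near p, Q z) -> \forall z \near p, P z /\ Q z.
Proof. by move=> HP HQ; apply: filterS2 HP HQ. Qed.

Lemma near_cube (P : V -> Prop) : (\forall z \near (0 : V), P z) ->
  exists2 r : R, 0 < r & forall z, `|z| <= r -> P z.
Proof.
move=> /nbhs_ballP[r r0 rP]; exists (r / 2); first exact: divr_gt0.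
move=> z zr; apply: rP; rewrite -ball_normE /= sub0r normrN (le_lt_trans zr)//.
by rewrite ltr_pdivrMr// ltr_pMr// ltr1n.
Qed.

End NearBounds.

Section LocalEstimates.
Variables (R : realType) (n : nat).
Implicit Types (U : set 'rV[R]_n).

Lemma derive_row_sum (F : 'rV[R]_n -> R) z v : differentiable F z ->
  'D_v F z = \sum_i v 0 i * 'D_(delta_mx 0 i) F z.
Proof. exact: (diff_coord (rV_coordinates R n)). Qed.

(** The minimum over the unit sphere, which is compact, is positive by homogeneity.  When [n = 0] the sphere is
    empty and any constant works. *)
Lemma quadratic_lower_bound (Q : 'rV[R]_n -> R) : continuous Q ->
  (forall (a : R) v, Q (a *: v) = a ^+ 2 * Q v) ->
  (forall v, v != 0 -> 0 < Q v) ->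
  exists2 c : R, 0 < c & forall v, c * `|v| ^+ 2 <= Q v.
Proof.
move=> Qc QZ Qpos.
pose S := [set v : 'rV[R]_n | `|v| = 1].
have [[v0 Sv0]|nS] := pselect (exists v, S v); last first.
  exists 1 => // v; have [->|v0] := eqVneq v 0.
    by rewrite normr0 expr0n mulr0 -(scale0r (0 : 'rV[R]_n)) QZ expr0n mul0r.
  by exfalso; apply: nS; exists (`|v|^-1 *: v); rewrite /S /= normrZ normfV normr_id mulVf// normr_eq0.
have cS : compact S.
  apply: bounded_closed_compact.
    exists 1; split => // x x1 v /= ->; exact: ltW.
  have -> : S = (fun v : 'rV[R]_n => `|v|) @^-1` [set 1] by [].
  apply: closed_comp; last exact: closed_eq.
  by move=> v _; exact: norm_continuous.
have [|v1 v1S Qmin] := @EVT_min_rV _ _ Q S (ex_intro _ v0 Sv0) cS.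
  exact: continuous_subspaceT.
have v1n : v1 != 0.
  rewrite inE /S /= in v1S; apply/eqP => v10; move: v1S; rewrite v10 normr0 => /eqP.
  by rewrite eq_sym oner_eq0.
exists (Q v1); first exact: Qpos.
move=> v; have [->|v0'] := eqVneq v 0.
  by rewrite normr0 expr0n mulr0 -(scale0r (0 : 'rV[R]_n)) QZ expr0n mul0r.
have nv : `|v| != 0 by rewrite normr_eq0.
have {2}-> : v = `|v| *: (`|v|^-1 *: v) by rewrite scalerA divff// scale1r.
rewrite QZ mulrC ler_wpM2l ?exprn_ge0//; apply: Qmin.
by rewrite inE /S /= normrZ normfV normr_id mulVf.
Qed.

(** The first order expansion of the partial derivatives at 0 shows that the radial derivative is the Hessian
    quadratic form up to a term that is small with respect to [|z|^2]. *)
Lemma radial_growth U (G : 'rV[R]_n -> R) : open U -> U 0 -> Ck 2 U G ->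
  (forall v, 'D_v G 0 = 0) ->
  (forall v, v != 0 -> 0 < 'D_v (fun z => 'D_v G z) 0) ->
  exists2 c : R, 0 < c & \forall z \near (0 : 'rV[R]_n), c * `|z| ^+ 2 <= 'D_z G z.
Proof.
move=> oU U0 [dG CG] dG0 Hpos.
pose g i (z : 'rV[R]_n) := 'D_(delta_mx 0 i) G z.
have dg i z : U z -> differentiable (g i) z by have [H _] := CG (delta_mx 0 i); exact: H.
pose Q (v : 'rV[R]_n) := \sum_i v 0 i * 'd (g i) 0 v.
have QE v : Q v = 'D_v (fun z => 'D_v G z) 0.
  have E : \forall z \near (0 : 'rV[R]_n), \sum_i v 0 i * g i z = 'D_v G z.
    have := open_nbhs_nbhs (conj oU U0); apply: filterS => z Uz.
    by rewrite derive_row_sum//; exact: dG.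
  rewrite -(near_eq_derive v E).
  have dsum i : derivable (fun z => v 0 i * g i z) 0 v.
    by apply: derivableM => //; apply: diff_derivable; exact: dg.
  have -> : (fun z => \sum_i v 0 i * g i z) = \sum_i (fun z => v 0 i * g i z).
    by apply/funext => z; rewrite fct_sumE.
  rewrite derive_sum//; apply: eq_bigr => i _.
  have dgi := dg i 0 U0.
  rewrite deriveM//; last exact: diff_derivable.
  by rewrite derive_cst scaler0 addr0 (deriveE _ dgi).
have Qc : continuous Q.
  suff C0 : Ck 0 [set: 'rV[R]_n] Q by move=> v; exact: C0.
  apply: Ck_sum => [|i _]; first exact: openT.
  apply: CkM; first exact: openT.
    by move=> v _; exact: coord_continuous.
  by move=> v _; apply: diff_continuous; exact: dg.
have QZ (a : R) v : Q (a *: v) = a ^+ 2 * Q v.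
  rewrite /Q mulr_sumr; apply: eq_bigr => i _.
  have -> : 'd (g i) 0 (a *: v) = a * 'd (g i) 0 v by exact: linearZ.
  by rewrite mxE; ring.
have [|c c0 cQ] := quadratic_lower_bound Qc QZ.
  by move=> v v0; rewrite QE; exact: Hpos.
exists (c / 2); first by rewrite divr_gt0.
pose e := c / 2 / (n%:R + 1).
have n1 : 0 < (n%:R + 1 : R) by rewrite ltr_wpDl.
have e0 : 0 < e by rewrite !divr_gt0.
have N1 := open_nbhs_nbhs (conj oU U0).
have N2 : \forall z \near (0 : 'rV[R]_n), forall i, `|g i z - 'd (g i) 0 z| <= e * `|z|.
  apply: near_forall => i; have := differentiable_eps (dg i 0 U0) e0.
  by apply: filterS => z; rewrite addr0 [g i 0]dG0 subr0.
move: N1 N2; apply: filterS2 => z Uz gz.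
rewrite derive_row_sum; last exact: dG.
have : Q z - \sum_i z 0 i * g i z <= c / 2 * `|z| ^+ 2.
  rewrite /Q -sumrB (le_trans (ler_norm _))// (le_trans (ler_norm_sum _ _ _))//.
  apply: (@le_trans _ _ (\sum_(i < n) (e * `|z| ^+ 2))).
    apply: ler_sum => i _; rewrite -mulrBr normrM distrC expr2 mulrCA.
    apply: ler_pM => //; exact: coord_le_norm.
  rewrite sumr_const card_ord [leLHS](_ : _ = e * n%:R * `|z| ^+ 2); last by rewrite -mulr_natr; ring.
  apply: ler_wpM2r; first exact: exprn_ge0.
  rewrite /e mulrAC ler_pdivrMr// ler_wpM2l ?lerDl//; first by rewrite divr_ge0// ltW.
have := cQ z; lra.
Qed.

End LocalEstimates.

(** * The normalised gradient field *)

Section PositiveForm.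
Variables (R : realType) (n : nat) (A : 'M[R]_n).
Hypotheses (Asym : A^T = A)
  (Apos : forall u : 'rV[R]_n, u != 0 -> 0 < (u *m A *m u^T) 0 0).

Let B (u v : 'rV[R]_n) := (u *m A *m v^T) 0 0.

Let B_sym u v : B u v = B v u.
Proof.
have -> : B u v = (u *m A *m v^T)^T 0 0 by rewrite mxE.
by rewrite !trmx_mul trmxK Asym mulmxA.
Qed.

Let B_lin a u v w : B (a *: u + v) w = a * B u w + B v w.
Proof. by rewrite /B !mulmxDl -!scalemxAl !mxE. Qed.

(** Positivity of the form at [B v v *: u - B u v *: v]. *)
Lemma form_cauchy_schwarz (u v : 'rV[R]_n) :
  (u *m A *m v^T) 0 0 ^+ 2 <= (u *m A *m u^T) 0 0 * (v *m A *m v^T) 0 0.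
Proof.
rewrite -/(B u v) -/(B u u) -/(B v v).
have [->|v0] := eqVneq v 0.
  have B0 w : B w 0 = 0 by rewrite /B trmx0 mulmx0 mxE.
  by rewrite !B0 expr0n mulr0.
have Bv : 0 < B v v by exact: Apos.
pose w := (B v v) *: u + (- B u v) *: v.
have Bw : 0 <= B w w.
  have [->|w0] := eqVneq w 0; first by rewrite /B trmx0 mulmx0 mxE.
  by rewrite ltW// /B Apos.
have : B w w = B v v * (B u u * B v v - B u v ^+ 2).
  have Bs x y : B ((- B u v) *: x) y = - B u v * B x y.
    by rewrite -[(- B u v) *: x]addr0 B_lin /B mul0mx mul0mx [X in _ + X]mxE addr0.
  have Bx x : B w x = B v v * B u x - B u v * B v x by rewrite /w B_lin Bs mulNr.
  by rewrite Bx (B_sym u w) (B_sym v w) !Bx (B_sym v u); ring.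
by move=> E; move: Bw; rewrite E pmulr_rge0// subr_ge0.
Qed.

Lemma form_det_neq0 : \det A != 0.
Proof.
apply/negP => /det0P[v v0 vA]; have := Apos v0.
by rewrite vA mul0mx mxE ltxx.
Qed.

Lemma form_bound (C : R) (u : 'rV[R]_n) : (forall i j, `|A i j| <= C) ->
  (u *m A *m u^T) 0 0 <= n%:R ^+ 2 * C * `|u| ^+ 2.
Proof.
move=> AC; rewrite mxE (le_trans (ler_norm _))// (le_trans (ler_norm_sum _ _ _))//.
apply: (@le_trans _ _ (\sum_(i < n) \sum_(j < n) (C * `|u| ^+ 2))); last first.
  rewrite !sumr_const card_ord -(mulr_natr _ n) -(mulr_natr (_ * _) n); rewrite le_eqVlt; apply/orP; left; apply/eqP; ring.
apply: ler_sum => i _; rewrite !mxE normrM.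
apply: (@le_trans _ _ ((\sum_j (`|u| * C)) * `|u|)); last first.
  rewrite mulr_suml; apply: ler_sum => j _; rewrite le_eqVlt; apply/orP; left; apply/eqP; ring.
apply: ler_pM => //; last exact: coord_le_norm.
rewrite (le_trans (ler_norm_sum _ _ _))//; apply: ler_sum => j _.
by rewrite normrM; apply: ler_pM => //; exact: coord_le_norm.
Qed.

End PositiveForm.

Section LocalModel.
Variables (R : realType) (n : nat).

(** Here [y = adj(A) dG], so that [u A y = det A * dG(u)] without inverting [A].  The Cauchy-Schwarz inequality
    for [z] and [y] compares [(det A * dG(z))^2] with [z A z * det A * dG(y)]; since [dG(z)] dominates
    [|z|^2] and [z A z] is at most a multiple of [|z|^2], also [|dG(y)|] dominates [|z|^2].  This is the
    lower bound that makes [G y / dG(y)] Lipschitz. *)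
Theorem local_model (U : set 'rV[R]_n) (G : 'rV[R]_n -> R) (A : 'rV[R]_n -> 'M[R]_n) :
  open U -> U 0 -> smooth U G -> (forall i j, smooth U (fun z => A z i j)) ->
  (forall z, U z -> (A z)^T = A z) ->
  (forall z (u : 'rV[R]_n), U z -> u != 0 -> 0 < (u *m A z *m u^T) 0 0) ->
  G 0 = 0 -> (forall v, 'D_v G 0 = 0) ->
  (forall v, v != 0 -> 0 < 'D_v (fun z => 'D_v G z) 0) ->
  exists r c L M X, [/\ [/\ 0 < r, 0 < c & 0 < L],
    forall z, `|z| <= r -> U z,
    forall z, `|z| <= r -> c * `|z| ^+ 2 <= 'D_z G z,
    [/\ (forall a b, `|X a - X b| <= L * `|a - b|) & forall a, `|X a| <= M] &
    forall z, `|z| <= r -> 'D_(X z) G z = - G z /\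
      exists k, forall u : 'rV[R]_n, (u *m A z *m (X z)^T) 0 0 = k * 'D_u G z].
Proof.
move=> oU U0 CG CA Asym Apos G0 dG0 Hpos.
pose g i (z : 'rV[R]_n) := 'D_(delta_mx 0 i) G z.
pose gc z : 'cV[R]_n := \col_i g i z.
pose y i z := ((\adj (A z)) *m gc z) i 0.
pose yr z : 'rV[R]_n := \row_i y i z.
have dG z : U z -> differentiable G z by have [H _] := CG 1%N; exact: H.
have Cg k i : Ck k U (g i) by have [_] := CG k.+1; exact.
have Cy k i : Ck k U (y i).
  rewrite /y; under eq_fun do rewrite mxE.
  apply: Ck_sum => // j _; apply: CkM => //.
    by apply: Ck_adj => // i' j'; exact: CA.
  by under eq_fun do rewrite mxE; exact: Cg.
have Cdet k : Ck k U (fun z => \det (A z)) by apply: Ck_det => // i j; exact: CA.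
have g0 i : g i 0 = 0 by exact: dG0.
have y0 i : y i 0 = 0.
  by rewrite /y mxE big1// => j _; rewrite [X in _ * X]mxE g0 mulr0.
have DG z v : U z -> 'D_v G z = (v *m gc z) 0 0.
  move=> Uz; rewrite derive_row_sum; last exact: dG.
  by rewrite mxE; apply: eq_bigr => i _; rewrite mxE.
have By z (u : 'rV[R]_n) : U z -> (u *m A z *m (yr z)^T) 0 0 = \det (A z) * 'D_u G z.
  move=> Uz; have -> : (yr z)^T = \adj (A z) *m gc z.
    by apply/matrixP => i j; rewrite !mxE ord1 /y mxE.
  by rewrite -mulmxA [A z *m _]mulmxA mul_mx_adj mul_scalar_mx -scalemxAr mxE DG.
pose P z := 'D_(yr z) G z.
have PE z : U z -> P z = \sum_i g i z * y i z.
  move=> Uz; rewrite /P derive_row_sum; last exact: dG.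
  by apply: eq_bigr => i _; rewrite mxE mulrC.
have [c c0 N1] := radial_growth oU U0 (CG 2%N) dG0 Hpos.
have [C1 C10 N2] := @near_norm_bounds R _ ('I_n * 'I_n)%type
  (fun ij z => 'D_(delta_mx 0 ij.2) (g ij.1) z) 0
  (fun ij => (Cg 1%N ij.1).2 (delta_mx 0 ij.2) 0 U0).
have [C2 C20 N3] := @near_norm_bounds R _ ('I_n * 'I_n)%type
  (fun ij z => 'D_(delta_mx 0 ij.2) (y ij.1) z) 0
  (fun ij => (Cy 1%N ij.1).2 (delta_mx 0 ij.2) 0 U0).
have [C3 C30 N4] := @near_norm_bounds R _ ('I_n * 'I_n)%type
  (fun ij z => A z ij.1 ij.2) 0 (fun ij => CA ij.1 ij.2 0%N 0 U0).
have det0 : \det (A 0) != 0 by apply: form_det_neq0 => // u; exact: Apos.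
have N5 := near_norm_gt (Cdet 0%N 0 U0) det0.
have [r r0 rP] := near_cube (near_and (near_and (open_nbhs_nbhs (conj oU U0)) N1)
   (near_and (near_and N2 N3) (near_and N4 N5))).
pose C := C1 + C2 + C3.
have C0 : 0 <= C by rewrite !addr_ge0.
have rU z : `|z| <= r -> U z by move=> /rP[[]].
have rc z : `|z| <= r -> c * `|z| ^+ 2 <= 'D_z G z by move=> /rP[[]].
have rg z i j : `|z| <= r -> `|'D_(delta_mx 0 j) (g i) z| <= C.
  move=> /rP[_ [[+ _] _]] => /(_ (i, j)) /= /le_trans; apply.
  by rewrite /C -addrA lerDl addr_ge0.
have ry z i j : `|z| <= r -> `|'D_(delta_mx 0 j) (y i) z| <= C.
  move=> /rP[_ [[_ +] _]] => /(_ (i, j)) /= /le_trans; apply.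
  by rewrite /C addrAC lerDr addr_ge0.
have rA z i j : `|z| <= r -> `|A z i j| <= C.
  move=> /rP[_ [_ [+ _]]] => /(_ (i, j)) /= /le_trans; apply.
  by rewrite /C lerDr addr_ge0.
pose dl := `|\det (A 0)| / 2.
have dl0 : 0 < dl by rewrite divr_gt0// normr_gt0.
have rdet z : `|z| <= r -> dl <= `|\det (A z)| by move=> /rP[_ [_ []]].
set N := n%:R : R.
have N0 : 0 <= N by [].
have dg i z : `|z| <= r -> differentiable (g i) z by move=> /rU; exact: (Cg 1%N i).1.
have dy i z : `|z| <= r -> differentiable (y i) z by move=> /rU; exact: (Cy 1%N i).1.
have gL i := lipschitz_cube (dg i) (fun z j => @rg z i j).
have yL i := lipschitz_cube (dy i) (fun z j => @ry z i j).
have n00 : `|0 : 'rV[R]_n| <= r by rewrite normr0 ltW.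
have gz i z : `|z| <= r -> `|g i z| <= N * C * `|z|.
  by move=> zr; have := gL i z 0 zr n00; rewrite g0 !subr0.
have yz i z : `|z| <= r -> `|y i z| <= N * C * `|z|.
  by move=> zr; have := yL i z 0 zr n00; rewrite y0 !subr0.
have NC : 0 <= N * C by rewrite mulr_ge0.
(* One constant for the three estimates: the summands serve for [y], [G] and [P] respectively. *)
pose K := N * C + N * (N * C) + 2 * N * (N * C) * (N * C).
have K0 : 0 <= K by rewrite !addr_ge0 ?mulr_ge0.
have GL a b : `|a| <= r -> `|b| <= r -> `|a| <= `|b| -> `|G a - G b| <= K * `|b| * `|a - b|.
  move=> ar br ab.
  have H (z : 'rV[R]_n) : `|z| <= `|b| -> `|z| <= r by move=> /le_trans; apply.
  apply: le_trans (@lipschitz_cube _ _ G `|b| (N * C * `|b|) _ _ a b ab (lexx _)) _.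
  - by move=> z /H /rU; exact: dG.
  - by move=> z j zb; rewrite (le_trans (gz j z (H _ zb)))// ler_wpM2l.
  apply: ler_wpM2r => //; rewrite mulrA; apply: ler_wpM2r => //.
  by rewrite /K addrAC lerDr addr_ge0// !mulr_ge0.
have YL i a b : `|a| <= r -> `|b| <= r -> `|y i a - y i b| <= K * `|a - b|.
  move=> ar br; apply: le_trans (yL i a b ar br) _; apply: ler_wpM2r => //.
  by rewrite /K -addrA lerDl addr_ge0// !mulr_ge0.
have PL a b : `|a| <= r -> `|b| <= r -> `|a| <= `|b| -> `|P a - P b| <= K * `|b| * `|a - b|.
  move=> ar br ab; rewrite !PE; [|exact: rU|exact: rU].
  rewrite -sumrB (le_trans (ler_norm_sum _ _ _))//.
  apply: (@le_trans _ _ (\sum_(i < n) (2 * (N * C) * (N * C) * `|b| * `|a - b|))).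
    apply: ler_sum => i _.
    have -> : g i a * y i a - g i b * y i b = g i a * (y i a - y i b) + (g i a - g i b) * y i b.
      by ring.
    rewrite (le_trans (ler_normD _ _))// !normrM.
    have h1 : `|g i a| <= N * C * `|b| by rewrite (le_trans (gz i a ar))// ler_wpM2l.
    apply: le_trans (lerD (ler_pM _ _ h1 (yL i a b ar br)) (ler_pM _ _ (gL i a b ar br) (yz i b br))) _ => //.
    by rewrite le_eqVlt; apply/orP; left; apply/eqP; ring.
  rewrite sumr_const card_ord -mulr_natr -/N.
  rewrite [leLHS](_ : _ = 2 * N * (N * C) * (N * C) * (`|b| * `|a - b|)); last by ring.
  rewrite -[leRHS]mulrA; apply: ler_wpM2r; first by rewrite mulr_ge0.
  by rewrite /K lerDr addr_ge0// !mulr_ge0.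
pose k := dl * c ^+ 2 / (N ^+ 2 * C + 1).
have NC1 : 0 < N ^+ 2 * C + 1 by rewrite ltr_wpDl// mulr_ge0// exprn_ge0.
have k0 : 0 < k by rewrite divr_gt0// mulr_gt0// exprn_gt0.
have Pk z : `|z| <= r -> k * `|z| ^+ 2 <= `|P z|.
  move=> zr; have Uz := rU _ zr.
  have [->|z0] := eqVneq z 0; first by rewrite normr0 expr0n mulr0.
  have Ap (u : 'rV[R]_n) : u != 0 -> 0 < (u *m A z *m u^T) 0 0 by exact: Apos.
  have CS := form_cauchy_schwarz (Asym _ Uz) Ap z (yr z).
  rewrite !By// -/(P z) in CS.
  have nz : 0 < `|z| ^+ 2 by rewrite exprn_gt0// normr_gt0.
  rewrite /k mulrAC ler_pdivrMr// -(ler_pM2r nz).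
  have zAz := form_bound z (fun i j => rA z i j zr).
  have zAz0 := ltW (Ap _ z0).
  have dP := ler_norm (\det (A z) * P z).
  rewrite normrM in dP.
  have dz := rdet _ zr.
  have dn : 0 < `|\det (A z)| by exact: lt_le_trans dz.
  rewrite -(ler_pM2l dn).
  have h1 : `|\det (A z)| * (dl * c ^+ 2 * `|z| ^+ 2 * `|z| ^+ 2) <= (\det (A z) * 'D_z G z) ^+ 2.
    rewrite (_ : (_ * _) ^+ 2 = `|\det (A z)| * (`|\det (A z)| * ('D_z G z) ^+ 2)); last first.
      by rewrite mulrA -expr2 real_normK ?num_real// exprMn.
    apply: ler_wpM2l => //.
    rewrite (_ : dl * _ * _ * _ = dl * (c * `|z| ^+ 2) ^+ 2); last by ring.
    have cz : 0 <= c * `|z| ^+ 2 by rewrite mulr_ge0 ?exprn_ge0// ltW.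
    apply: ler_pM => //; [exact: ltW|exact: exprn_ge0|].
    by rewrite !expr2; apply: ler_pM => //; exact: rc.
  apply: le_trans h1 (le_trans CS _).
  have h2 : (z *m A z *m z^T) 0 0 <= (N ^+ 2 * C + 1) * `|z| ^+ 2.
    by rewrite (le_trans zAz)// -/N mulrDl lerDl mul1r ltW.
  apply: le_trans (ler_wpM2l zAz0 dP) _.
  apply: le_trans (ler_wpM2r _ h2) _; first by rewrite mulr_ge0.
  by rewrite le_eqVlt; apply/orP; left; apply/eqP; ring.
have P0 : P 0 = 0 by rewrite PE// big1// => i _; rewrite g0 mul0r.
pose W z : 'rV[R]_n := \row_i - (G z * y i z / P z).
pose L := 2 * K ^+ 2 / k + K ^+ 3 / k ^+ 2 + 1.
have L0 : 0 < L.
  apply: ltr_wpDl => //; apply: addr_ge0; apply: divr_ge0.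
  - by apply: mulr_ge0 => //; exact: exprn_ge0.
  - exact: ltW.
  - exact: exprn_ge0.
  - by apply: exprn_ge0; exact: ltW.
have WL a b : `|a| <= r -> `|b| <= r -> `|W a - W b| <= L * `|a - b|.
  move=> ar br; apply: norm_le_coord => [|i]; first by rewrite mulr_ge0// ltW.
  rewrite !mxE -opprD normrN.
  apply: le_trans (quotient_lipschitz k0 K0 G0 P0 (y0 i) GL PL (YL i) Pk ar br) _.
  by rewrite ler_wpM2r// /L lerDl.
have W0 : W 0 = 0 by apply/rowP => i; rewrite !mxE G0 !mul0r oppr0.
have r0' := ltW r0.
exists r, c, L, (L * r), (fun z => W (clamp r z)); split => //.
- split=> [a b|a].
    apply: le_trans (WL _ _ (clamp_norm _ r0') (clamp_norm _ r0')) _.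
    by rewrite ler_wpM2l ?clamp_lipschitz// ltW.
  have := WL _ 0 (clamp_norm a r0') n00; rewrite W0 !subr0 => /le_trans; apply.
  by rewrite ler_wpM2l ?clamp_norm// ltW.
move=> z zr; rewrite clamp_id//; have Uz := rU _ zr.
have WE : W z = (- (G z / P z)) *: yr z.
  by apply/rowP => i; rewrite !mxE; ring.
split; last first.
  exists (- (G z / P z) * \det (A z)) => u.
  by rewrite WE linearZ /= -scalemxAr mxE By// mulrA.
have dGz := dG _ Uz.
have -> : 'D_(W z) G z = - (G z / P z) * P z.
  by rewrite WE /P (deriveE _ dGz) (deriveE _ dGz); exact: linearZ.
have [->|z0] := eqVneq z 0; first by rewrite G0 mul0r oppr0 mul0r.
have Pz : P z != 0.
  by rewrite -normr_gt0 (lt_le_trans _ (Pk _ zr))// mulr_gt0// exprn_gt0// normr_gt0.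
by rewrite mulNr divfK.
Qed.

End LocalModel.

(** * Sublevel sets and trajectories in slice coordinates *)

(** A continuous bijection from a compact space to a Hausdorff space is closed. *)
Lemma inverse_within_continuous (T U : topologicalType) (K : set T) (f : T -> U) (g : U -> T) :
  hausdorff_space U -> compact K -> {within K, continuous f} ->
  (forall z, K z -> g (f z) = z) -> {within f @` K, continuous g}.
Proof.
move=> hU cK fc gK; apply/continuous_closedP => C cC; apply/closed_subspaceP.
exists (f @` (K `&` C)).
  apply: compact_closed => //; apply: continuous_compact; last exact: compact_closedI.
  by apply: continuous_subspaceW fc => z [].
apply/seteqP; split=> [_ [[z [Kz Cz] <-] _]|w [Cgw [z Kz fzw]]].
  by split; [move: Cz; rewrite -{1}(gK _ Kz)|exists z].
have Cz : C z by rewrite -(gK _ Kz) fzw.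
by split; exists z.
Qed.

Section GenericContinuity.
Variables (R : realType) (V W : normedModType R).

Lemma continuous_scale_id (a : V -> R) p : {for p, continuous a} ->
  {for p, continuous (fun z => a z *: z)}.
Proof. by move=> ac; apply: cvgZ; [exact: ac|exact: cvg_id]. Qed.

Lemma continuous_squeeze0 (F : V -> W) (b : V -> R) p : F p = 0 -> b p = 0 ->
  {for p, continuous b} -> (forall z, `|F z| <= b z) -> {for p, continuous F}.
Proof.
move=> F0 b0 bc Fb; rewrite /prop_for /continuous_at F0.
apply/cvgr0Pnorm_lt => e e0.
have := bc; rewrite /prop_for /continuous_at b0 => /cvgr_lt /(_ e e0).
by apply: filterS => z; exact: le_lt_trans.
Qed.
End GenericContinuity.

Section EuclideanNorm.
Variables (R : realType) (n : nat).
Implicit Types z v : 'rV[R]_n.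

(** The norm of row vectors is the sup norm, while the unit ball is Euclidean. *)
Definition sumsq z := \sum_(i < n) z 0 i ^+ 2.
Definition enorm z := Num.sqrt (sumsq z).

Lemma sumsq_ge0 z : 0 <= sumsq z.
Proof. by apply: sumr_ge0 => i _; exact: sqr_ge0. Qed.

Lemma sumsqZ (a : R) z : sumsq (a *: z) = a ^+ 2 * sumsq z.
Proof. by rewrite /sumsq mulr_sumr; apply: eq_bigr => i _; rewrite mxE exprMn. Qed.

Lemma sumsq_eq0 z : (sumsq z == 0) = (z == 0).
Proof.
apply/idP/eqP => [|->]; last by rewrite /sumsq big1// => i _; rewrite mxE expr0n.
rewrite psumr_eq0 => [/allP z0|i _]; last exact: sqr_ge0.
apply/rowP => i; rewrite mxE; apply/eqP; rewrite -sqrf_eq0.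
exact: (implyP (z0 i (mem_index_enum i))).
Qed.

Lemma enorm_gt0 z : z != 0 -> 0 < enorm z.
Proof. by move=> z0; rewrite sqrtr_gt0 lt_def sumsq_eq0 z0 sumsq_ge0. Qed.

Lemma norm_le_enorm z : `|z| <= enorm z.
Proof.
apply: norm_le_coord => [|i]; first exact: sqrtr_ge0.
rewrite -sqrtr_sqr ler_wsqrtr// /sumsq (bigD1 i)//= lerDl.
by apply: sumr_ge0 => j _; exact: sqr_ge0.
Qed.

Lemma sumsq_continuous : continuous sumsq.
Proof.
suff C0 : Ck 0 [set: 'rV[R]_n] sumsq by move=> v; exact: C0.
apply: Ck_sum => [|i _]; first exact: openT.
have Ci : Ck 0 [set: 'rV[R]_n] (fun z : 'rV[R]_n => z 0 i) by move=> v _; exact: coord_continuous.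
under eq_fun do rewrite expr2.
by apply: (@CkM _ _ 0 setT (fun z : 'rV[R]_n => z 0 i) (fun z : 'rV[R]_n => z 0 i)) => //; exact: openT.
Qed.

Lemma enorm_continuous : continuous enorm.
Proof.
move=> z; apply: (@continuous_comp _ _ _ sumsq (@Num.sqrt R)); first exact: sumsq_continuous.
exact: sqrt_continuous.
Qed.

End EuclideanNorm.

Section Model.
Variables (R : realType) (n : nat) (G : 'rV[R]_n -> R) (r c : R).
Hypotheses (r0 : 0 < r) (c0 : 0 < c) (G0 : G 0 = 0)
  (dG : forall z, `|z| <= r -> differentiable G z)
  (rad : forall z, `|z| <= r -> c * `|z| ^+ 2 <= 'D_z G z).

Implicit Type z : 'rV[R]_n.

Let dray z (t : R) : `|t *: z| <= r -> is_derive t 1 (fun t => G (t *: z)) ('D_z G (t *: z)).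
Proof.
move=> tz; have := @is_derive_along_line _ _ _ G 0 z t.
by rewrite add0r; under eq_fun do rewrite add0r; apply; exact: dG.
Qed.

Let rad_gt z (t : R) : 0 < t -> `|t *: z| <= r -> c * t * `|z| ^+ 2 <= 'D_z G (t *: z).
Proof.
move=> t0 tz; have := rad tz; have dz := dG tz.
have -> : 'D_(t *: z) G (t *: z) = t * 'D_z G (t *: z) by rewrite !(deriveE _ dz); exact: linearZ.
rewrite normrZ exprMn (ger0_norm (ltW t0)) => H.
rewrite -(ler_pM2l t0); apply: le_trans H.
by rewrite le_eqVlt; apply/orP; left; apply/eqP; ring.
Qed.

Let seg z (s t : R) : 0 <= s <= t -> `|t *: z| <= r -> `|s *: z| <= r.
Proof.
move=> /andP[s0 st]; apply: le_trans; rewrite !normrZ ler_wpM2r//.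
by rewrite !ger0_norm// (le_trans s0).
Qed.

Let ray_cont z (s t : R) : 0 <= s -> s <= t -> `|t *: z| <= r ->
  {within `[s, t], continuous (fun t => G (t *: z))}.
Proof.
move=> s0 st tz; apply: derivable_within_continuous => u; rewrite in_itv/= => /andP[su ut].
have uz : `|u *: z| <= r by apply: seg tz; rewrite ut (le_trans s0).
by have [] := dray uz.
Qed.

Lemma model_radial_lt z (s t : R) : z != 0 -> 0 <= s -> s < t -> `|t *: z| <= r ->
  G (s *: z) < G (t *: z).
Proof.
move=> z0 s0 st tz.
have [||u] := @MVT R (fun t => G (t *: z)) (fun t => 'D_z G (t *: z)) s t st.
- move=> u; rewrite in_itv/= => /andP[/ltW su /ltW ut].
  by apply: dray; apply: seg tz; rewrite ut (le_trans s0).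
- exact: ray_cont (ltW st) tz.
rewrite in_itv/= => /andP[su ut] E; rewrite -subr_gt0 E mulr_gt0 ?subr_gt0//.
have u0 : 0 < u by exact: le_lt_trans su.
apply: lt_le_trans (rad_gt u0 _); first by apply: mulr_gt0; [exact: mulr_gt0|rewrite exprn_gt0// normr_gt0].
by apply: seg tz; rewrite !ltW.
Qed.

(** Integrate the bound on the radial derivative along the ray. *)
Lemma model_lower z : `|z| <= r -> c / 2 * `|z| ^+ 2 <= G z.
Proof.
move=> zr.
have z1 : `|1 *: z| <= r by rewrite scale1r.
set C := c / 2 * `|z| ^+ 2.
pose h (t : R) := G (t *: z) - C * t ^+ 2.
have dh (t : R) : 0 <= t <= 1 -> is_derive t 1 h ('D_z G (t *: z) - C * (2 * t)).
  move=> t01; apply: is_deriveB; first by apply: dray; exact: seg z1.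
  have dt : is_derive t 1 (fun t : R => C * t ^+ 2) (C *: (2%:R * t ^+ 1 *: 1)).
    rewrite (_ : (fun t : R => C * t ^+ 2) = C *: ((id : R -> R) ^+ 2)).
      by apply: is_deriveZ; apply: is_deriveX.
    by apply/funext => u; rewrite [RHS]/(C * _) exprfctE.
  by rewrite expr1 [X in C *: X]mulr1 in dt; exact: dt.
have [u u01|t|u] := @MVT R h (fun t => 'D_z G (t *: z) - C * (2 * t)) 0 1 ltr01.
- by apply: dh; move: u01; rewrite in_itv/= => /andP[/ltW-> /ltW->].
- apply: derivable_within_continuous t => t; rewrite in_itv/= => t01.
  by have [] := dh t t01.
rewrite in_itv/= => /andP[u0 u1] E.
have uz : `|u *: z| <= r by apply: seg z1; rewrite !ltW.
have := rad_gt u0 uz => H.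
have : 0 <= h 1 - h 0.
  by rewrite E subr0 mulr1 subr_ge0; apply: le_trans H; rewrite /C; lra.
by rewrite /h scale1r scale0r G0 expr1n expr0n/= mulr1 mulr0 subr0 subr0 subr_ge0.
Qed.

Lemma model_ge0 z : `|z| <= r -> 0 <= G z.
Proof.
by move=> /model_lower; apply: le_trans; rewrite mulr_ge0 ?exprn_ge0// divr_ge0// ltW.
Qed.

Lemma model_eq0 z : `|z| <= r -> G z = 0 -> z = 0.
Proof.
move=> /model_lower H Gz; apply/eqP; rewrite -normr_le0 -(ler_pXn2r (n := 2)) ?nnegrE// expr0n/=.
by move: H; rewrite Gz pmulr_rle0// divr_gt0.
Qed.

(** A small value of [G] keeps a point of the cube away from its faces. *)
Lemma model_norm_lt z (e : R) : e < c / 2 * r ^+ 2 -> `|z| <= r -> G z <= e -> `|z| < r.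
Proof.
move=> er zr Gz; have H := model_lower zr.
rewrite -(ltr_pXn2r (n := 2)) ?nnegrE// ?(ltW r0)//.
have c2 : 0 < c / 2 by rewrite divr_gt0.
by rewrite -(ltr_pM2l c2) (le_lt_trans H)// (le_lt_trans Gz).
Qed.

Lemma model_clamp_continuous : continuous (G \o clamp r).
Proof.
move=> z; apply: (@continuous_comp _ _ _ (@clamp R n r) G); first exact: clamp_continuous.
by apply: differentiable_continuous; apply: dG; apply: clamp_norm; exact: ltW.
Qed.

Section Dynamics.
Variables (X : 'rV[R]_n -> 'rV[R]_n) (L M : R).
Hypotheses (L0 : 0 < L) (XL : forall a b, `|X a - X b| <= L * `|a - b|)
  (XM : forall a, `|X a| <= M)
  (XG : forall z, `|z| <= r -> 'D_(X z) G z = - G z).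

(** Along a trajectory [expR s * G] is constant as long as the trajectory stays in the cube, and then the
    value of [G] keeps the trajectory away from the faces: the set of times at which all is well is open,
    closed and contains [s0]. *)
Lemma model_invariance (g : R -> 'rV[R]_n) (e s0 : R) :
  (forall t : R, is_derive t 1 g (X (g t))) -> 0 < e < c / 2 * r ^+ 2 ->
  0 <= s0 -> `|g s0| <= r -> G (g s0) = e * expR (- s0) ->
  forall s, 0 <= s -> `|g s| < r /\ G (g s) = e * expR (- s).
Proof.
move=> dg /andP[e0 er] s00 gs0 Gs0.
pose phi (s : R) := expR s * G (g s).
have gc : continuous g by exact: continuous_derivable dg.
have phiE (s : R) : phi s = e -> G (g s) = e * expR (- s).
  by move=> <-; rewrite /phi mulrAC expRxMexpNx_1 mul1r.
have phiE' (s : R) : G (g s) = e * expR (- s) -> phi s = e.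
  by rewrite /phi => ->; rewrite mulrCA expRxMexpNx_1 mulr1.
have good (s : R) : 0 <= s -> `|g s| <= r -> phi s = e -> `|g s| < r.
  move=> s0' gs ps; apply: model_norm_lt er gs _.
  by rewrite phiE// ler_piMr ?(ltW e0)// expR_le1 oppr_le0.
suff H T : 0 <= T -> forall s, 0 <= s <= T -> 0 <= s0 <= T -> `|g s| < r /\ phi s = e.
  move=> s s_ge0; pose T := Num.max s s0.
  have [|||gs ps] := H T _ s.
  - by rewrite le_max s_ge0.
  - by rewrite s_ge0 le_max lexx.
  - by rewrite s00 le_max lexx orbT.
  by split=> //; exact: phiE.
move=> T0 s sT s0T.
pose S := [set s : R | 0 <= s <= T /\ `|g s| < r /\ phi s = e].
suff SE : S = `[0, T]%classic by have [] : S s by rewrite SE /= in_itv/=.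
apply: segment_connected.
- by exists s0; split=> //; have p0 := phiE' _ Gs0; split=> //; exact: good.
- exists [set s : R | `|g s| < r /\ phi s = e]; last first.
    by apply/seteqP; split=> u; rewrite /S/= in_itv/=.
  rewrite openE => u [gu pu].
  have nu : \forall v \near u, `|g v| < r.
    have : (fun v => `|g v|) @ u --> `|g u| by apply: cvg_norm; exact: gc.
    by move=> /cvgr_lt; apply.
  have /nbhs_ballP[d /= d0 dP] := nu.
  rewrite /interior; apply/nbhs_ballP; exists d => // v uv /=; split; first exact: dP.
  have dphi (w : R) : u - d < w < u + d -> is_derive w 1 phi 0.
    move=> wI; have gw : `|g w| <= r.
      by apply: ltW; apply: dP; rewrite -ball_normE/= ltr_distlC.
    have dGg : is_derive w 1 (G \o g) (- G (g w)).
      by rewrite -XG//; apply: is_derive_curve => //; exact: dG.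
    rewrite (_ : 0 = expR w *: (- G (g w)) + (G \o g) w *: expR w); first exact: is_deriveM.
    by rewrite /GRing.scale/=; ring.
  have d00 (w : R) : u - d < w < u + d -> is_derive w 1 (cst e : R -> R) 0 by move=> _; exact: is_derive_cst.
  have uI : u - d < u < u + d by rewrite ltrBlDr ltrDl d0.
  have vI : u - d < v < u + d by rewrite -ltr_distlC; move: uv; rewrite -ball_normE.
  have := derive_eq_cst dphi d00 uI vI.
  by rewrite /cst/= subrr pu => /eqP; rewrite subr_eq0 => /eqP.
- exists [set s : R | `|g s| <= r /\ expR s * (G \o clamp r) (g s) = e].
    apply: closedI.
      apply: (@closed_comp _ _ (fun s => `|g s|) [set x | x <= r]); last exact: closed_le.
      by move=> u _; apply: continuous_comp; [exact: gc|exact: norm_continuous].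
    apply: (@closed_comp _ _ (fun s => expR s * (G \o clamp r) (g s)) [set x | x = e]); last exact: closed_eq.
    move=> u _; apply: continuousM; first exact: continuous_expR.
    by apply: (@continuous_comp _ _ _ g (G \o clamp r)); [exact: gc|exact: model_clamp_continuous].
  apply/seteqP; split=> u; rewrite /S/= in_itv/=.
    by move=> [uT [gu pu]]; split=> //; split; rewrite ?clamp_id ?ltW.
  move=> [uT [gu]]; rewrite clamp_id// => pu; split=> //; split=> //.
  by apply: good => //; case/andP: uT.
Qed.

(** The trajectory through [z], shifted so as to reach [z] at the time [s] with [G z = e * expR (- s)], is at
    the level [e] at time 0; by uniqueness it is the trajectory issued from its initial point. *)
Lemma model_foliation : exists sol : 'rV[R]_n -> R -> 'rV[R]_n,
  [/\ forall y, sol y 0 = y,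
      forall y (t : R), is_derive t 1 (sol y) (X (sol y t)) &
  forall e, 0 < e < c / 2 * r ^+ 2 ->
    (forall p s, `|p| <= r -> G p = e -> 0 <= s ->
       `|sol p s| < r /\ G (sol p s) = e * expR (- s)) /\
    (forall z, `|z| <= r -> 0 < G z <= e ->
       exists p s, [/\ `|p| <= r, G p = e, 0 <= s & sol p s = z])].
Proof.
have /choice[sol solP] := ode_exists L0 XL XM.
exists sol; split=> [y|y|e eI]; [exact: (solP y).1|exact: (solP y).2|split].
  move=> p s pr Gp s0; have := model_invariance (solP p).2 eI (lexx 0).
  by rewrite (solP p).1 oppr0 expR0 mulr1; apply.
move=> z zr /andP[Gz Ge]; have /andP[e0 er] := eI.
pose s0 := - ln (G z / e).
have Ge0 : 0 < G z / e by rewrite divr_gt0.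
have s00 : 0 <= s0 by rewrite oppr_ge0 ln_le0// ler_pdivrMr// mul1r.
pose g s := sol z (s - s0).
have dg (t : R) : is_derive t 1 g (X (g t)).
  have [dc <-] := (solP z).2 (t - s0).
  have ds : is_derive t 1 (fun t : R => t - s0) 1.
    by rewrite -[X in is_derive _ _ _ X]subr0; apply: is_deriveB.
  by apply: (is_derive_curve ds); apply/derivable1_diffP.
have gs0 : g s0 = z by rewrite /g subrr (solP z).1.
have [||g0r Gg0] := model_invariance dg eI s00 _ _ (lexx 0).
- by rewrite gs0.
- by rewrite gs0 opprK lnK ?posrE// mulrC divfK// gt_eqF.
exists (g 0), s0; split=> //; first exact: ltW.
  by rewrite Gg0 oppr0 expR0 mulr1.
rewrite -gs0; congr (_ s0).
by apply: (ode_unique L0 XL XM (s := 0)) (solP _).2 dg; rewrite (solP _).1.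
Qed.

End Dynamics.

Section Ball.
Variable e : R.
Hypotheses (e0 : 0 < e) (er : e < c / 2 * r ^+ 2).

Let K : set 'rV[R]_n := [set z | `|z| <= r /\ G z <= e].

Lemma model_compact : compact K.
Proof.
have -> : K = (fun z : 'rV[R]_n => `|z|) @^-1` [set x | x <= r] `&`
    (G \o clamp r) @^-1` [set x | x <= e].
  by apply/seteqP; split=> z [zr]; rewrite /= clamp_id.
apply: bounded_closed_compact.
  by exists r; split; [exact: num_real|move=> x rx z [/le_trans zr _]; exact/zr/ltW].
apply: closedI; apply: closed_comp; try exact: closed_le.
  by move=> z _; exact: norm_continuous.
by move=> z _; exact: model_clamp_continuous.
Qed.

Let a z := Num.sqrt (G z / e) / enorm z.
Let Psi z := a z *: z.

Let sumsq_Psi z : `|z| <= r -> sumsq (Psi z) = G z / e.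
Proof.
move=> zr; have [->|z0] := eqVneq z 0.
  by rewrite G0 mul0r /Psi scaler0; apply/eqP; rewrite sumsq_eq0.
rewrite /Psi sumsqZ /a expr_div_n sqr_sqrtr ?sqr_sqrtr ?sumsq_ge0//; last first.
  by rewrite divr_ge0 ?model_ge0// ltW.
by rewrite divfK// sumsq_eq0.
Qed.

Let Psi_continuous z : K z -> {for z, continuous Psi}.
Proof.
move=> [zr Gz].
have Gc : {for z, continuous G} by apply: differentiable_continuous; exact: dG.
have bc : {for z, continuous (fun z => Num.sqrt (G z / e))}.
  apply: (@continuous_comp _ _ _ (fun z => G z / e) (@Num.sqrt R)); last exact: sqrt_continuous.
  by apply: (@continuous_comp _ _ _ G (fun x => x / e)) => //; exact: mulrr_continuous.
have [z0|z0] := eqVneq z 0.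
  apply: (@continuous_squeeze0 _ _ _ _ (fun z => Num.sqrt (G z / e))) => //.
  - by rewrite z0 /Psi scaler0.
  - by rewrite z0 G0 mul0r sqrtr0.
  move=> w; have [->|w0] := eqVneq w 0; first by rewrite /Psi scaler0 normr0 sqrtr_ge0.
  have ew := enorm_gt0 w0.
  rewrite /Psi normrZ /a normrM normfV (ger0_norm (sqrtr_ge0 _)) (gtr0_norm ew).
  by rewrite mulrAC ler_pdivrMr// ler_wpM2l ?sqrtr_ge0 ?norm_le_enorm.
apply: continuous_scale_id.
apply: continuousM => //; apply: continuousV; last exact: enorm_continuous.
by rewrite gt_eqF// enorm_gt0.
Qed.

Let Psi_inj z w : K z -> K w -> Psi z = Psi w -> z = w.
Proof.
move=> [zr Gz] [wr Gw] E.
have GE : G z = G w.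
  have := congr1 (@sumsq R n) E; rewrite !sumsq_Psi//.
  by move/(mulIf _); apply; rewrite invr_neq0// gt_eqF.
have [z0|z0] := eqVneq z 0.
  by rewrite z0; apply/esym; apply: model_eq0 => //; rewrite -GE z0 G0.
have [w0|w0] := eqVneq w 0.
  by rewrite w0; apply: model_eq0 => //; rewrite GE w0 G0.
have apos y : `|y| <= r -> y != 0 -> 0 < a y.
  move=> yr y0; rewrite divr_gt0 ?enorm_gt0// sqrtr_gt0 divr_gt0//.
  by rewrite lt_def model_ge0// andbT; apply: contra y0 => /eqP /model_eq0 ->.
have az := apos _ zr z0; have aw := apos _ wr w0.
have zE : z = (a w / a z) *: w.
  by rewrite mulrC -scalerA -[a w *: w]E scalerA mulVf ?gt_eqF// scale1r.
set t := a w / a z in zE.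
have t0 : 0 < t by rewrite divr_gt0.
have [t1|t1|t1] := ltgtP t 1.
- have := @model_radial_lt w t 1 w0 (ltW t0) t1.
  by rewrite scale1r -zE GE ltxx => /(_ wr).
- have := @model_radial_lt w 1 t w0 ler01 t1.
  by rewrite scale1r -zE GE ltxx => /(_ zr).
- by rewrite zE t1 scale1r.
Qed.

Let Psi_surj v : sumsq v <= 1 -> exists2 z, K z & Psi z = v.
Proof.
move=> v1; have [->|v0] := eqVneq v 0.
  by exists 0; [split; rewrite ?normr0 ?G0 ltW|rewrite /Psi scaler0].
have vn : 0 < `|v| by rewrite normr_gt0.
pose T := r / `|v|.
have T0 : 0 < T by rewrite divr_gt0.
have Tv : `|T *: v| = r by rewrite normrZ gtr0_norm// divfK// gt_eqF.
have Tv' : `|T *: v| <= r by rewrite Tv.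
have sv : 0 < sumsq v by rewrite lt_def sumsq_eq0 v0 sumsq_ge0.
have GT : e * sumsq v <= G (T *: v).
  apply: le_trans (model_lower Tv'); rewrite Tv (le_trans _ (ltW er))//.
  by rewrite ler_piMr// ltW.
have [||t tI Gt] := @IVT R (fun t => G (t *: v)) 0 T (e * sumsq v) (ltW T0).
- by apply: ray_cont => //; exact: ltW.
- rewrite scale0r G0 ge_min le_max GT orbT andbT; apply/orP; left.
  by rewrite mulr_ge0// ltW.
move: tI; rewrite in_itv/= => /andP[t0 tT].
have tv : `|t *: v| <= r by apply: seg Tv'; rewrite t0.
have tn : 0 < t.
  rewrite lt_def t0 andbT; apply/eqP => t00; move: Gt; rewrite t00 scale0r G0.
  by move=> /esym/eqP; rewrite mulf_eq0 gt_eqF//= gt_eqF.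
exists (t *: v); first by split; rewrite // Gt ler_piMr// ltW.
have sq : 0 < Num.sqrt (sumsq v) by rewrite sqrtr_gt0.
have -> : Psi (t *: v) = (a (t *: v) * t) *: v by rewrite /Psi scalerA.
have -> : a (t *: v) = t^-1.
  rewrite /a Gt (_ : e * sumsq v / e = sumsq v); last by rewrite mulrAC divff ?mul1r// gt_eqF.
  rewrite /enorm sumsqZ sqrtrM ?sqr_ge0// sqrtr_sqr (gtr0_norm tn).
  by field; rewrite !gt_eqF.
by rewrite mulVf ?scale1r// gt_eqF.
Qed.

(** [Psi] sends [z] to the point of its ray at Euclidean distance [sqrt (G z / e)] from 0: it is bijective since
    [G] is continuous and strictly increasing along rays, and its inverse [Phi] is continuous by
    compactness. *)
Lemma model_ball : exists Phi Psi : 'rV[R]_n -> 'rV[R]_n,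
  [/\ Phi @` unit_ball R n = K,
      {in unit_ball R n, cancel Phi Psi},
      {within unit_ball R n, continuous Phi},
      forall z, K z -> {for z, continuous Psi} &
      Phi @` unit_sphere R n = [set z | `|z| <= r /\ G z = e]].
Proof.
have /choice[Phi PhiP] : forall v, exists z, sumsq v <= 1 -> K z /\ Psi z = v.
  move=> v; have [v1|nv] := pselect (sumsq v <= 1); last by exists 0.
  by have [z Kz zv] := Psi_surj v1; exists z.
have PsiK z : K z -> sumsq (Psi z) <= 1.
  by move=> [zr Gz]; rewrite sumsq_Psi// ler_pdivrMr// mul1r.
have PhiK z : K z -> Phi (Psi z) = z.
  by move=> Kz; have [KP E] := PhiP _ (PsiK _ Kz); exact: Psi_inj.
have PsiE : Psi @` K = unit_ball R n.
  apply/seteqP; split=> [_ [z Kz <-]|v v1]; first exact: PsiK.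
  by have [Kv <-] := PhiP v v1; exists (Phi v).
exists Phi, Psi; split.
- apply/seteqP; split=> [_ [v v1 <-]|z Kz]; first exact: (PhiP v v1).1.
  by exists (Psi z); [exact: PsiK|exact: PhiK].
- by move=> v; rewrite inE => v1; exact: (PhiP v v1).2.
- rewrite -PsiE; apply: inverse_within_continuous.
  + exact: norm_hausdorff.
  + exact: model_compact.
  + apply: continuous_in_subspaceT => z; rewrite inE; exact: Psi_continuous.
  + exact: PhiK.
- exact: Psi_continuous.
apply/seteqP; split=> [_ [v v1 <-]|z [zr Gz]].
  have v1' : sumsq v <= 1 by rewrite /sumsq v1.
  have [[Pr PG] E] := PhiP v v1'; split=> //.
  have := sumsq_Psi Pr; rewrite E /sumsq v1 => H.
  by rewrite -[LHS](divfK (lt0r_neq0 e0)) -H mul1r.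
have Kz : K z by split=> //; rewrite Gz.
by exists (Psi z); [rewrite /unit_sphere /= -/(sumsq _) sumsq_Psi// Gz divff// gt_eqF|exact: PhiK].
Qed.

End Ball.

End Model.

(** * Charts *)

Section Nearness.
Variable X : topologicalType.
Implicit Types (A : set X) (x : X) (P Q : X -> Prop).

Lemma open_near A x : open A -> A x -> \forall y \near x, A y.
Proof. by move=> oA Ax; exact: open_nbhs_nbhs. Qed.

Lemma near_open A : (forall x, A x -> \forall y \near x, A y) -> open A.
Proof. by rewrite openE. Qed.

Lemma near_mono P Q x : (forall y, P y -> Q y) -> (\forall y \near x, P y) ->
  \forall y \near x, Q y.
Proof. by move=> PQ; apply: filterS. Qed.

Lemma near_conj P Q x : (\forall y \near x, P y) -> (\forall y \near x, Q y) ->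
  \forall y \near x, P y /\ Q y.
Proof. by move=> HP HQ; apply: filterI. Qed.

End Nearness.

Lemma diff_comp_apply (R : realType) (U V W : normedModType R) (f : U -> V) (g : V -> W) x v :
  differentiable f x -> differentiable g (f x) -> 'd (g \o f) x v = 'd g (f x) ('d f x v).
Proof. by move=> df dg; rewrite diff_comp. Qed.

Lemma shear_Ck (R : realType) (W : normedModType R) (e : W) (l : {linear W -> R}) (g : W -> R)
  (O : set W) k : continuous l -> open O -> Ck k O g -> Ck k O (shear e l g).
Proof.
move=> lc oO Cg.
have lin : linear (fun a : R => a *: e) by move=> a u w /=; rewrite scalerDl -scalerA.
pose L : {linear R -> W} := HB.pack (fun a : R => a *: e)
  (GRing.isLinear.Build _ _ _ _ _ lin).
apply: (CkD oO (@Ck_id _ _ _ _)).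
apply: (@Ck_linear_comp _ _ _ _ L) => //; first exact: scalel_continuous.
by apply: CkB => //; exact: Ck_linear.
Qed.

Section Charts.
Variables (R : realType) (n : nat) (T : topologicalType).
Implicit Types (a b c : chart R n T) (z w : Cn R n) (p : T).

Lemma chartK a p : cdom a p -> cinv a (a p) = p.
Proof. by move=> ap; apply: cfunK; rewrite inE. Qed.

Lemma cinv_dom a z : (a @` cdom a) z -> cdom a (cinv a z).
Proof. by move=> [p ap <-]; rewrite chartK. Qed.

Lemma cinvK a z : (a @` cdom a) z -> a (cinv a z) = z.
Proof. by move=> [p ap <-]; rewrite chartK. Qed.

Lemma overlapP a b z : overlap a b z <-> (a @` cdom a) z /\ cdom b (cinv a z).
Proof.
split=> [[p [ap bp] <-]|[az bz]]; first by split; [exists p|rewrite chartK].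
by exists (cinv a z); [split=> //; exact: cinv_dom|exact: cinvK].
Qed.

Lemma cinv_near a z (A : set T) : (a @` cdom a) z -> open A -> A (cinv a z) ->
  \forall w \near z, A (cinv a w).
Proof.
by move=> az oA Az; have := cinv_continuous az; apply; exact: open_nbhs_nbhs.
Qed.

Lemma cfun_near a p (A : set (Cn R n)) : cdom a p -> open A -> A (a p) ->
  \forall q \near p, A (a q).
Proof.
by move=> ap oA Ap; have := cfun_continuous ap; apply; exact: open_nbhs_nbhs.
Qed.

Lemma overlap_open a b : open (overlap a b).
Proof.
apply: near_open => z /overlapP[az bz].
have := near_conj (open_near (@cimage_open _ _ _ a) az) (cinv_near az (@cdom_open _ _ _ b) bz).
by apply: near_mono => w [aw bw]; apply/overlapP.
Qed.

Lemma overlap_chart a b p : cdom a p -> cdom b p -> overlap a b (a p).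
Proof. by move=> ap bp; exists p. Qed.

Lemma transition_chart a b p : cdom a p -> transition a b (a p) = b p.
Proof. by move=> ap; rewrite /transition /= chartK. Qed.

Lemma cinv_transition a b z : overlap a b z -> cinv b (transition a b z) = cinv a z.
Proof. by move=> /overlapP[az bz]; rewrite /transition /= chartK. Qed.

Lemma transition_overlap a b z : overlap a b z -> overlap b a (transition a b z).
Proof. by move=> [p [ap bp] <-]; rewrite transition_chart//; exists p. Qed.

Lemma transition_comp_near a b c p : cdom a p -> cdom b p -> cdom c p ->
  \forall z \near a p, (transition b c \o transition a b) z = transition a c z.
Proof.
move=> ap bp cp; have := open_near (@overlap_open a b) (overlap_chart ap bp).
by apply: near_mono => z ab; rewrite /= /transition /= -/(transition a b z) cinv_transition.
Qed.

(** The cocycle relation between transition maps, on tangent vectors. *)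
Lemma transition_comp_diff a b c p : cdom a p -> cdom b p -> cdom c p ->
  differentiable (transition a b) (a p) -> differentiable (transition b c) (b p) ->
  differentiable (transition a c) (a p) /\
  forall v, 'd (transition a c) (a p) v = 'd (transition b c) (b p) ('d (transition a b) (a p) v).
Proof.
move=> ap bp cp dab dbc.
have tE : transition a b (a p) = b p by exact: transition_chart.
have dbc' : differentiable (transition b c) (transition a b (a p)) by rewrite tE.
have dcomp := differentiable_comp dab dbc'.
have [dac E] := near_eq_diff (transition_comp_near ap bp cp) dcomp.
split; first exact dac.
move=> v; apply: (etrans (congr1 (fun F => F v) E)).
apply: (etrans (diff_comp_apply v dab dbc')).
by rewrite tE.
Qed.

Lemma transition_self_diff a p : cdom a p ->
  differentiable (transition a a) (a p) /\ forall v, 'd (transition a a) (a p) v = v.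
Proof.
move=> ap.
have E : \forall z \near a p, idfun z = transition a a z.
  have := open_near (@overlap_open a a) (overlap_chart ap ap).
  by apply: near_mono => z /overlapP[az _]; rewrite /transition /= cinvK.
have ci : continuous (idfun : Cn R n -> Cn R n) by move=> z; exact: cvg_id.
have [d dE] := near_eq_diff E (linear_differentiable (a p) ci).
split; first exact d.
move=> v; apply: (etrans (congr1 (fun F => F v) dE)).
by rewrite diff_lin.
Qed.

Lemma transition_diffK a b p v : cdom a p -> cdom b p ->
  differentiable (transition a b) (a p) -> differentiable (transition b a) (b p) ->
  'd (transition b a) (b p) ('d (transition a b) (a p) v) = v.
Proof.
move=> ap bp dab dba; have [_ H] := transition_comp_diff ap bp ap dab dba.
exact: etrans (esym (H v)) ((transition_self_diff ap).2 v).
Qed.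

End Charts.

Section SmoothCharts.
Variables (R : realType) (n : nat) (N : complexManifold R n).
Implicit Types (s phi : chart R n N) (p : N).

Lemma smooth_diff (V W : normedModType R) (U : set V) (F : V -> W) z :
  smooth U F -> U z -> differentiable F z.
Proof. by move=> /(_ 1%N)[dF _]; exact: dF. Qed.

Lemma atlas_smooth_chart phi : atlas phi -> smooth_chart phi.
Proof.
move=> aphi psi apsi; split; exact: (atlas_holomorphic _ _).1.
Qed.

(** Two smooth charts are compared through the distinguished holomorphic chart at the point. *)
Lemma smooth_chart_diff s s' p : smooth_chart s -> smooth_chart s' -> cdom s p -> cdom s' p ->
  differentiable (transition s s') (s p).
Proof.
move=> Ss Ss' sp s'p.
have ap := chart_at_atlas p; have pp := chart_at_dom p.
have [_ d1] := Ss _ ap; have [d2 _] := Ss' _ ap.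
by have [] := transition_comp_diff sp pp s'p
  (smooth_diff d1 (overlap_chart sp pp)) (smooth_diff d2 (overlap_chart pp s'p)).
Qed.

(** ** Restriction of a chart to an open set *)
Section Restrict.
Variables (s : chart R n N) (A : set N).
Hypothesis oA : open A.

Fact restrict_image : s @` (cdom s `&` A) = (s @` cdom s) `&` [set z | A (cinv s z)].
Proof.
apply/seteqP; split=> [_ [p [sp Ap] <-]|z [[p sp <-]]]; first by split; [exists p|rewrite /= chartK].
by rewrite /= chartK// => Ap; exists p.
Qed.

Fact restrict_image_open : open (s @` (cdom s `&` A)).
Proof.
rewrite restrict_image; apply: near_open => z [sz Az].
exact: near_conj (open_near (@cimage_open _ _ _ s) sz) (cinv_near sz oA Az).
Qed.

Fact restrictK : {in cdom s `&` A, cancel s (cinv s)}.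
Proof. by move=> p; rewrite inE => -[sp _]; exact: chartK. Qed.

Fact restrict_cfun_continuous p : (cdom s `&` A) p -> {for p, continuous s}.
Proof. by move=> [sp _]; exact: cfun_continuous. Qed.

Fact restrict_cinv_continuous z : (s @` (cdom s `&` A)) z -> {for z, continuous (cinv s)}.
Proof. by move=> [p [sp _] <-]; apply: cinv_continuous; exists p. Qed.

(** Used for interior points of the ball, where the slice chart of [V] has to be cut to a domain that meets [V] in
    the ball only. *)
Definition restrict : chart R n N :=
  @Chart R n N (cdom s `&` A) s (cinv s) (openI (@cdom_open _ _ _ s) oA) restrict_image_open
    restrictK restrict_cfun_continuous restrict_cinv_continuous.

Lemma restrict_smooth : smooth_chart s -> smooth_chart restrict.
Proof.
move=> Ss phi aphi; have [S1 S2] := Ss phi aphi; split=> k.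
  by apply: Ck_sub (S1 k) => _ [p [ap [sp _]] <-]; exists p.
by apply: Ck_sub (S2 k) => _ [p [[sp _] ap] <-]; exists p.
Qed.

End Restrict.

(** ** Composition of a chart with a shear *)
Section ShearChart.
Variables (s : chart R n N) (i : 'I_n) (g : Cn R n -> R) (O : set (Cn R n)) (k : R).

Let e : Cn R n := (delta_mx 0 i, 0).
Let l : {linear Cn R n -> R} := lcoord (Cn_coordinates R n) (inl i).

Hypotheses (oO : open O) (Os : O `<=` s @` cdom s)
  (segO : forall z a t, O z -> O (z + a *: e) -> 0 <= t <= 1 -> O (z + t *: (a *: e)))
  (Cg : smooth O g)
  (Dg : forall z, O z -> 0 < k * 'D_e g z).

Let lc : continuous l. Proof. exact: lcoord_continuous. Qed.
Let le1 : l e = 1. Proof. by rewrite /l /= mxE !eqxx. Qed.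
Let dg z : O z -> differentiable g z. Proof. exact: smooth_diff. Qed.

Let Psi := shear e l g.

Fact shear_inverse : exists H : Cn R n -> Cn R n, forall z, O z -> H (Psi z) = z.
Proof.
have /choice[H HP] : forall w, exists z, (Psi @` O) w -> O z /\ Psi z = w.
  move=> w; have [[z Oz <-]|nw] := pselect ((Psi @` O) w); first by exists z.
  by exists 0.
exists H => z Oz; have [OH E] := HP (Psi z) (ex_intro2 _ _ z Oz erefl).
exact: (shear_inj le1 segO dg Dg OH Oz E).
Qed.

Let H := sval (cid shear_inverse).
Let HK z : O z -> H (Psi z) = z. Proof. exact: (svalP (cid shear_inverse)). Qed.

Let A := [set p : N | cdom s p /\ O (s p)].

Fact shear_dom_open : open A.
Proof.
apply: near_open => p [sp Op].
exact: near_conj (open_near (@cdom_open _ _ _ s) sp) (cfun_near sp oO Op).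
Qed.

Fact shear_image : (Psi \o s) @` A = Psi @` O.
Proof.
apply/seteqP; split=> [_ [p [sp Op] <-]|_ [z Oz <-]]; first by exists (s p).
have sz := Os Oz; exists (cinv s z); last by rewrite /= cinvK.
by split; [exact: cinv_dom|rewrite cinvK].
Qed.

Fact shear_image_open : open ((Psi \o s) @` A).
Proof. by rewrite shear_image; exact: (shear_open lc le1 oO segO dg Dg). Qed.

Fact shear_chartK : {in A, cancel (Psi \o s) (cinv s \o H)}.
Proof. by move=> p; rewrite inE => -[sp Op]; rewrite /= HK// chartK. Qed.

Fact shear_cfun_continuous p : A p -> {for p, continuous (Psi \o s)}.
Proof.
move=> [sp Op]; apply: continuous_comp; first exact: cfun_continuous.
have dP : Ck 0 O Psi := shear_Ck e lc oO (Cg 0%N).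
exact: dP.
Qed.

Fact shear_cinv_continuous z : ((Psi \o s) @` A) z -> {for z, continuous (cinv s \o H)}.
Proof.
rewrite shear_image => -[y Oy <-]; apply: continuous_comp.
  apply: (shear_inv_continuous lc le1 oO segO dg Dg HK); by exists y.
by apply: cinv_continuous; rewrite HK//; exact: Os.
Qed.

(** Used at boundary points, with [g] the defining function of the half-space. *)
Definition shear_chart : chart R n N :=
  @Chart R n N A (Psi \o s) (cinv s \o H) shear_dom_open shear_image_open
    shear_chartK shear_cfun_continuous shear_cinv_continuous.

Lemma shear_chart_snd p : (shear_chart p).2 = (s p).2.
Proof. by rewrite /= /Psi /shear /= scaler0 addr0. Qed.

Lemma shear_chart_fst p : (shear_chart p).1 0 i = g (s p).
Proof. exact: (shear_coord le1). Qed.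

Let smooth_shear : smooth O Psi.
Proof. by move=> j; exact: (shear_Ck e lc oO (Cg j)). Qed.

Lemma shear_chart_smooth : smooth_chart s -> smooth_chart shear_chart.
Proof.
move=> Ss phi aphi; have [S1 S2] := Ss phi aphi; split=> j.
  apply: (@Ck_comp _ _ _ _ (Cn_coordinates R n) (Cn_coordinates R n) j
    (overlap phi shear_chart) O (transition phi s) Psi) => //.
  - exact: overlap_open.
  - by move=> _ [p [ap [sp Op]] <-]; rewrite transition_chart.
  - by apply: Ck_sub (S1 j) => _ [p [ap [sp Op]] <-]; exists p.
apply: (@Ck_comp _ _ _ _ (Cn_coordinates R n) (Cn_coordinates R n) j
    (overlap shear_chart phi) (overlap s phi) H (transition s phi)) => //.
- exact: overlap_open.
- by move=> _ [p [[sp Op] ap] <-]; rewrite /= HK//; exists p.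
- exact: overlap_open.
apply: (@Ck_sub _ _ _ _ (Psi @` O)).
  by move=> _ [p [[sp Op] ap] <-]; exists (s p).
exact: (shear_inv_Ck lc le1 oO segO dg Dg HK j Cg (Cn_coordinates R n)).
Qed.

End ShearChart.

End SmoothCharts.

(** * Horizontal vectors along a Lagrangian *)

Section Metric.
Variables (R : realType) (n : nat) (N : complexManifold R n) (h : hermitianMetric N) (p : N).
Implicit Types (u v w : Cn R n).
Local Notation M := (riemannian h p).

Lemma riemannian_linear (a : R) u v w : M (a *: u + v) w = a * M u w + M v w.
Proof.
rewrite /riemannian herm_linear.
by case: (h p u w) => x y; case: (h p v w) => x' y' /=; rewrite mul0r subr0.
Qed.

Lemma riemannian_sym u v : M u v = M v u.
Proof. by rewrite /riemannian (herm_conj h p v u); case: (h p v u). Qed.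

Lemma riemannian_pos u : u != 0 -> 0 < M u u.
Proof. by move=> /(herm_pos h p); rewrite /riemannian ltcE => /andP[]. Qed.

(** The metric is the real part of a Hermitian form, for which [J] is unitary. *)
Lemma riemannian_JJ u v : M (J u) (J v) = M u v.
Proof.
rewrite /riemannian herm_J herm_conj herm_J (herm_conj h p u v).
by case: (h p u v) => x y /=; ring.
Qed.

Lemma kahler_J u v : kahler_form h p u (J v) = M u v.
Proof. by rewrite /kahler_form riemannian_JJ. Qed.

Lemma riemannian0 w : M 0 w = 0.
Proof.
have := riemannian_linear 1 0 0 w; rewrite scaler0 addr0 mul1r => H.
by apply: (addrI (M 0 w)); rewrite addr0 -H.
Qed.

Lemma riemannianD u v w : M (u + v) w = M u w + M v w.
Proof. by rewrite -[u in LHS]scale1r riemannian_linear mul1r. Qed.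

Lemma riemannian_sum (I : Type) (r : seq I) (a : I -> R) (b : I -> Cn R n) w :
  M (\sum_(i <- r) a i *: b i) w = \sum_(i <- r) a i * M (b i) w.
Proof.
by elim: r => [|i r IH]; rewrite ?big_nil ?riemannian0// !big_cons riemannian_linear IH.
Qed.

End Metric.

Lemma J_linear (R : realType) n (a : R) (u v : Cn R n) : J (a *: u + v) = a *: J u + J v.
Proof.
case: u => u1 u2; case: v => v1 v2; rewrite /J /=; congr pair.
rewrite -[LHS]/(- (a *: u2 + v2)) -[RHS]/(a *: (- u2) + - v2).
by rewrite opprD scalerN.
Qed.

Section HorizontalAlgebra.
Variables (R : realType) (n : nat) (N : complexManifold R n) (h : hermitianMetric N) (p : N).
Variables (T : {linear 'rV[R]_n -> Cn R n}).
Hypotheses (Tinj : injective T)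
  (iso : forall a b, kahler_form h p (T a) (T b) = 0).
Local Notation M := (riemannian h p).

Let Lam (ab : Cn R n) : Cn R n := T ab.1 + J (T ab.2).

Let Lam_linear : linear Lam.
Proof.
move=> a u v; rewrite /Lam /= !linearP /= J_linear.
by rewrite scalerDr addrACA.
Qed.

Let Lam_inj ab : Lam ab = 0 -> ab = 0.
Proof.
case: ab => a b E.
have T0 u : M (T u) (T u) = 0 -> u = 0.
  move=> Mu; have [//|u0] := eqVneq u 0.
  have Tu : T u != 0 by apply: contra u0 => /eqP Tu; apply/eqP/Tinj; rewrite Tu linear0.
  by have := riemannian_pos h p Tu; rewrite Mu ltxx.
have a0 : a = 0.
  apply: T0; have : M (Lam (a, b)) (T a) = 0 by rewrite E riemannian0.
  rewrite /Lam /= riemannianD.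
  by have := iso b a; rewrite /kahler_form => ->; rewrite addr0.
have b0 : b = 0.
  apply: T0; rewrite -riemannian_JJ.
  by move: E; rewrite /Lam a0 linear0 add0r /= => ->; rewrite riemannian0.
by rewrite a0 b0.
Qed.

(** The map [(a, b) |-> T a + J (T b)] is injective because [T a] and [J (T b)] are orthogonal and [T] is
    injective; source and target have the same dimension. *)
Lemma lagrangian_decomposition (w : Cn R n) : exists a b, w = T a + J (T b).
Proof.
pose L : {linear Cn R n -> Cn R n} := HB.pack Lam (GRing.isLinear.Build _ _ _ _ _ Lam_linear).
have k0 : lker (linfun L) == 0%VS.
  apply/lker0P => u v; rewrite !lfunE /= => E.
  by apply/eqP; rewrite -subr_eq0; apply/eqP/Lam_inj; rewrite -[LHS]/(L (u - v)) linearB /= E subrr.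
have := memvf w; rewrite -(lker0_limgf k0) => /memv_imgP[[a b] _ ->].
by exists a, b; rewrite lfunE.
Qed.

(** Decompose a vector [w] of the kernel as [T a + J (T b)].  As the differential is real on the image of [T], its
    real part vanishes at [T a] and at [T b].  The form [kahler_form (T u)] vanishes at [T a] by isotropy,
    and at [J (T b)] it is the scalar product of [T u] and [T b], that is a multiple of the differential at [T b]. *)
Lemma horizontal_of_gradient (d : Cn R n -> R[i]) (u : 'rV[R]_n) (k : R) :
  (forall v w, d (v + w) = d v + d w) ->
  (forall v, d (J v) = (0 +i* 1) * d v) ->
  (forall a, complex.Im (d (T a)) = 0) ->
  (forall v, M (T u) (T v) = k * complex.Re (d (T v))) ->
  forall w, d w = 0 -> kahler_form h p (T u) w = 0.
Proof.
move=> dD dJ dT Mu w; have [a [b ->]] := lagrangian_decomposition w.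
rewrite dD dJ => E.
have db : complex.Re (d (T b)) = 0.
  have := congr1 (fun z => complex.Im z) E; have := dT a; have := dT b.
  by case: (d (T a)) => x y; case: (d (T b)) => x' y' /= -> -> ; rewrite !mul0r !mul1r !add0r.
have kD : kahler_form h p (T u) (T a + J (T b)) =
    kahler_form h p (T u) (T a) + kahler_form h p (T u) (J (T b)).
  by rewrite /kahler_form !(riemannian_sym h p (J (T u))) riemannianD.
by rewrite kD iso add0r kahler_J Mu db mulr0.
Qed.

End HorizontalAlgebra.

Section CriticalPoints.
Variables (R : realType) (n : nat) (N : complexManifold R n) (f : N -> R[i]).

Lemma differentialD y u v : differential f y (u + v) = differential f y u + differential f y v.
Proof.
rewrite /differential; move: ('d (re_part f \o _) _) ('d (im_part f \o _) _) => D1 D2.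
by rewrite !linearD.
Qed.

Lemma differentialZ y (a : R) u : differential f y (a *: u) = a%:C * differential f y u.
Proof.
rewrite /differential; move: ('d (re_part f \o _) _) ('d (im_part f \o _) _) => D1 D2.
have E (D : {linear Cn R n -> R}) : D (a *: u) = a * D u by exact: linearZ.
by rewrite !E; apply/eqP; rewrite eq_complex /= !mul0r subr0 addr0 !eqxx.
Qed.

(** A nonzero complex linear form is onto. *)
Lemma critical_differential y : holomorphic f -> critical_point f y ->
  forall v, differential f y v = 0.
Proof.
move=> [_ dJ] cy v; apply: contrapT => /eqP dv0; apply: cy => w.
(* Complex multiples of [v] are reached through [J]. *)
pose q := w / differential f y v.
exists (complex.Re q *: v + complex.Im q *: J v).
rewrite differentialD !differentialZ dJ mulrA -mulrDl.
rewrite (_ : _ + _ = q); last first.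
  by case: q => a b; apply/eqP; rewrite eq_complex /=; apply/andP; split; apply/eqP; ring.
by rewrite /q divfK.
Qed.

End CriticalPoints.

(** * Tangent vectors in a slice chart *)

Section SecondDerivative.
Variables (R : realType) (V W : normedModType R) (b : coordinates W).

(** In the second derivative of [F \o E] the term with the second derivative of [E] has the differential of
    [F] as a factor. *)
Lemma second_derivative_critical (U : set V) (O : set W) (E : V -> W) (F : W -> R) p v :
  open U -> open O -> U p -> (forall z, U z -> O (E z)) -> Ck 2 U E -> Ck 2 O F ->
  (forall w, 'D_w F (E p) = 0) ->
  'D_v (fun z => 'D_v (F \o E) z) p =
  'D_('D_v E p) (fun w => 'D_('D_v E p) F w) (E p).
Proof.
move=> oU oO Up UO [dE CE] [dF CF] F0.
set nu := 'D_v E p.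
pose c k z := lcoord b k ('D_v E z).
pose Fk k w := 'D_(cvec b k) F w.
have dFk k w : O w -> differentiable (Fk k) w by have [H _] := CF (cvec b k); exact: H.
have dEv z : U z -> differentiable (fun z => 'D_v E z) z by have [H _] := CE v; exact: H.
have dc k : differentiable (c k) p.
  apply: (@differentiable_comp _ _ _ _ (fun z => 'D_v E z) (lcoord b k)); first exact: dEv.
  by apply: linear_differentiable; exact: lcoord_continuous.
have dFE k : differentiable (Fk k \o E) p.
  by apply: differentiable_comp; [exact: dE|apply: dFk; exact: UO].
have E1 : \forall z \near p, \sum_k c k z * (Fk k \o E) z = 'D_v (F \o E) z.
  have := open_near oU Up; apply: near_mono => z Uz.
  have dz := dE z Uz; have dFz := dF _ (UO z Uz).
  rewrite (deriveE _ (differentiable_comp dz dFz)) (diff_comp_apply _ dz dFz).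
  by rewrite -(deriveE _ dz) -(deriveE _ dFz) (diff_coord b).
rewrite -(near_eq_derive v E1).
have -> : (fun z => \sum_k c k z * (Fk k \o E) z) = \sum_k (fun z => c k z * (Fk k \o E) z).
  by apply/funext => z; rewrite fct_sumE.
have EF : \forall w \near E p, \sum_k lcoord b k nu * Fk k w = 'D_nu F w.
  have := open_near oO (UO p Up); apply: near_mono => w Ow.
  by rewrite (diff_coord b _ (dF w Ow)).
rewrite -[RHS](near_eq_derive nu EF).
have -> : (fun w => \sum_k lcoord b k nu * Fk k w) = \sum_k (fun w => lcoord b k nu * Fk k w).
  by apply/funext => z; rewrite fct_sumE.
have sumD (X : normedModType R) (I : Type) (r : seq I) (g : I -> X -> R) q u :
    (forall i, derivable (g i) q u) ->
    derivable (\sum_(i <- r) g i) q u /\ 'D_u (\sum_(i <- r) g i) q = \sum_(i <- r) 'D_u (g i) q.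
  move=> dg; elim: r => [|i r [IH1 IH2]].
    by rewrite !big_nil; split; [exact: derivable_cst|exact: derive_cst].
  by rewrite !big_cons; split; [exact (derivableD (dg i) IH1)|rewrite (deriveD (dg i) IH1) IH2].
have dl k : derivable (fun z => c k z * (Fk k \o E) z) p v.
  by apply: derivableM; exact: diff_derivable.
have dr k : derivable (fun w => lcoord b k nu * Fk k w) (E p) nu.
  by apply: derivableM; [exact: derivable_cst|apply: diff_derivable; apply: dFk; exact: UO].
rewrite (sumD _ _ _ _ _ _ dl).2 (sumD _ _ _ _ _ _ dr).2; apply: eq_bigr => k _.
have dFkp := dFk k _ (UO p Up); have dEp := dE p Up.
have z1 : (Fk k \o E) p = 0 := F0 _.
have z2 : 'D_nu (fun=> lcoord b k nu) (E p) = 0 := derive_cst _ _ _.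
have key : 'D_v (Fk k \o E) p = 'D_nu (Fk k) (E p).
  rewrite (deriveE _ (dFE k)) (deriveE _ dFkp).
  by apply: (etrans (diff_comp_apply _ dEp dFkp)); rewrite -(deriveE _ dEp).
have d1 : derivable (c k) p v := diff_derivable (dc k).
have d2 : derivable (Fk k \o E) p v := diff_derivable (dFE k).
have d3 : derivable (fun=> lcoord b k nu) (E p) nu := derivable_cst _ _ _.
have d4 : derivable (Fk k) (E p) nu := diff_derivable dFkp.
apply: (etrans (deriveM d1 d2)); apply: (etrans _ (esym (deriveM d3 d4))).
by rewrite z1 z2 key scale0r scaler0.
Qed.

Lemma derive_constant_along (F : V -> W) p v :
  (\forall t \near (0 : R), F (t *: v + p) = F p) -> 'D_v F p = 0.
Proof.
move=> H; rewrite /derive; apply: lim_near_cst => //.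
apply: cvg_within; move: H; apply: near_mono => t /= Et.
by rewrite Et subrr scaler0.
Qed.

End SecondDerivative.

Section TangentMap.
Variables (R : realType) (n : nat) (N : complexManifold R n).
Implicit Types (s : chart R n N) (p : N) (u : 'rV[R]_n).

Definition in_slice u : Cn R n := (u, 0).

Fact in_slice_linear : linear in_slice.
Proof. by move=> a u v; rewrite /in_slice; congr pair; rewrite /= scaler0 addr0. Qed.
HB.instance Definition _ := GRing.isLinear.Build _ _ _ _ in_slice in_slice_linear.

Lemma in_slice_continuous : continuous in_slice.
Proof.
move=> u; apply: (@cvg_pair _ _ _ (nbhs u) (nbhs u) (nbhs (0 : 'rV[R]_n))); first exact: cvg_id.
exact: cvg_cst.
Qed.

(** The vector of [T_pN] with coordinates [(u, 0)] in the chart [s]. *)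
Definition tangent_map s p : {linear 'rV[R]_n -> Cn R n} :=
  ('d (transition s (chart_at p)) (s p) \o in_slice : {linear 'rV[R]_n -> Cn R n}).

Lemma tangent_mapE s p u :
  tangent_map s p u = 'd (transition s (chart_at p)) (s p) (u, 0).
Proof. by []. Qed.

Lemma tangent_mapK s p u : smooth_chart s -> cdom s p ->
  'd (transition (chart_at p) s) (chart_at p p) (tangent_map s p u) = (u, 0).
Proof.
move=> Ss sp; have Sc := atlas_smooth_chart (chart_at_atlas p).
have pp := chart_at_dom p.
rewrite tangent_mapE; apply: (transition_diffK _ sp pp).
  exact: smooth_chart_diff Ss Sc sp pp.
exact: smooth_chart_diff Sc Ss pp sp.
Qed.

Lemma tangent_map_inj s p : smooth_chart s -> cdom s p -> injective (tangent_map s p).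
Proof.
move=> Ss sp u v E; have := tangent_mapK u Ss sp; rewrite E (tangent_mapK v Ss sp).
by case.
Qed.

Lemma tangent_map_tangent s p u (V : set N) : slice_chart V s -> cdom s p ->
  tangent V p (tangent_map s p u).
Proof.
move=> Ss sp; exists s; split=> //; first by left.
by rewrite (tangent_mapK u Ss.1 sp).
Qed.

(** The differential of a function read in a smooth chart is its differential on the corresponding tangent
    vectors. *)
Lemma function_diff s p (F : N -> R) : smooth_chart s -> cdom s p ->
  differentiable (F \o cinv (chart_at p)) (chart_at p p) ->
  differentiable (F \o cinv s) (s p) /\
  forall v, 'd (F \o cinv s) (s p) v =
    'd (F \o cinv (chart_at p)) (chart_at p p) ('d (transition s (chart_at p)) (s p) v).
Proof.
move=> Ss sp dF; have Sc := atlas_smooth_chart (chart_at_atlas p).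
have pp := chart_at_dom p.
have dt := smooth_chart_diff Ss Sc sp pp.
have tE : transition s (chart_at p) (s p) = chart_at p p by exact: transition_chart.
have dF' : differentiable (F \o cinv (chart_at p)) (transition s (chart_at p) (s p)) by rewrite tE.
have En : \forall z \near s p,
    ((F \o cinv (chart_at p)) \o transition s (chart_at p)) z = (F \o cinv s) z.
  have := open_near (@overlap_open _ _ _ s (chart_at p)) (overlap_chart sp pp).
  by apply: near_mono => z sz /=; rewrite cinv_transition.
have [d dE] := near_eq_diff En (differentiable_comp dt dF').
split; first exact d.
move=> v; apply: (etrans (congr1 (fun F => F v) dE)).
apply: (etrans (diff_comp_apply v dt dF')).
by rewrite tE.
Qed.

Variables (f : N -> R[i]) (V : set N).
Hypotheses (f_hol : holomorphic f)
  (f2_constant : forall y z, V y -> V z -> im_part f y = im_part f z).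

Lemma re_diff p : differentiable (re_part f \o cinv (chart_at p)) (chart_at p p).
Proof.
have [Sre _] := f_hol.1 _ (chart_at_atlas p); apply: smooth_diff Sre _.
by exists p => //; exact: chart_at_dom.
Qed.

Lemma im_diff p : differentiable (im_part f \o cinv (chart_at p)) (chart_at p p).
Proof.
have [_ Sim] := f_hol.1 _ (chart_at_atlas p); apply: smooth_diff Sim _.
by exists p => //; exact: chart_at_dom.
Qed.

Lemma re_differential s p u : smooth_chart s -> cdom s p ->
  complex.Re (differential f p (tangent_map s p u)) = 'D_(u, 0) (re_part f \o cinv s) (s p).
Proof.
move=> Ss sp; have [d dE] := function_diff Ss sp (re_diff p).
by rewrite (deriveE _ d) dE.
Qed.

(** A slice chart maps the lines [t |-> s p + t (u, 0)] into [V], where the imaginary part is constant. *)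
Lemma im_differential s p u : slice_chart V s -> cdom s p -> V p ->
  complex.Im (differential f p (tangent_map s p u)) = 0.
Proof.
move=> Ss sp Vp; have [d dE] := function_diff Ss.1 sp (im_diff p).
suff : 'D_(u, 0) (im_part f \o cinv s) (s p) = 0 by rewrite (deriveE _ d) dE.
apply: derive_constant_along.
have sp2 : (s p).2 = 0 by apply/(Ss.2 p sp).
have lc : (fun t : R => t *: ((u, 0) : Cn R n) + s p) @ (0 : R) --> s p.
  rewrite -[X in _ --> X]add0r -(scale0r ((u, 0) : Cn R n)).
  by apply: cvgD; [exact: scalel_continuous|exact: cvg_cst].
have sI : (s @` cdom s) (s p) by exists p.
have := lc _ (open_near (@cimage_open _ _ _ s) sI).
apply: near_mono => t /= st; apply: f2_constant; last by rewrite chartK.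
apply/(Ss.2 _ (cinv_dom st)); rewrite (cinvK st) /= sp2 scaler0 addr0 //.
Qed.

End TangentMap.

(** * The height in slice coordinates *)

Section SliceCoordinates.
Variables (R : realType) (n : nat) (N : complexManifold R n) (h : hermitianMetric N).
Variables (f : N -> R[i]) (V : set N) (x : N) (s : chart R n N) (sigma : R).
Hypotheses (f_hol : holomorphic f) (V_iso : isotropic h V) (Vx : V x)
  (x_critical : critical_point f x)
  (f2_constant : forall y z, V y -> V z -> im_part f y = im_part f z)
  (Ss : slice_chart V s) (sx : cdom s x).

Local Notation phi := (chart_at x).

Definition slice_point (z : 'rV[R]_n) : Cn R n := in_slice ((s x).1 + z).
Definition slice_param (z : 'rV[R]_n) : N := cinv s (slice_point z).
Definition slice_dom : set 'rV[R]_n := [set z | overlap s phi (slice_point z)].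
Definition height (z : 'rV[R]_n) : R := sigma * (re_part f x - re_part f (slice_param z)).
Definition metric_matrix (z : 'rV[R]_n) : 'M[R]_n :=
  \matrix_(i, j) riemannian h (slice_param z)
    (tangent_map s (slice_param z) (delta_mx 0 i)) (tangent_map s (slice_param z) (delta_mx 0 j)).

Lemma slice_point0 : slice_point 0 = s x.
Proof.
rewrite /slice_point /in_slice addr0; have : (s x).2 = 0 by apply/(Ss.2 _ sx).
by case: (s x) => a b /= ->.
Qed.

Lemma slice_param0 : slice_param 0 = x.
Proof. by rewrite /slice_param slice_point0 chartK. Qed.

Lemma slice_pointE z : slice_point z = in_slice (s x).1 + in_slice z.
Proof. exact: linearD. Qed.

Lemma slice_point_Ck k (U : set 'rV[R]_n) : open U -> Ck k U slice_point.
Proof.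
move=> oU; have -> : slice_point = fun z => in_slice (s x).1 + in_slice z.
  by apply/funext => z; exact: slice_pointE.
apply: CkD => //; first exact: Ck_cst.
by apply: Ck_linear; exact: in_slice_continuous.
Qed.

Lemma slice_point_continuous : continuous slice_point.
Proof. by move=> z; exact: (slice_point_Ck 0 (@openT _)). Qed.

Lemma slice_dom_open : open slice_dom.
Proof.
apply: (@open_comp _ _ slice_point); last exact: overlap_open.
by move=> z _; exact: slice_point_continuous.
Qed.

Lemma slice_dom0 : slice_dom 0.
Proof. by rewrite /slice_dom /= slice_point0; apply: overlap_chart => //; exact: chart_at_dom. Qed.

Lemma slice_domP z : slice_dom z ->
  [/\ (s @` cdom s) (slice_point z), cdom s (slice_param z), cdom phi (slice_param z),
      s (slice_param z) = slice_point z & V (slice_param z)].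
Proof.
move=> /overlapP[sz pz]; have sd := cinv_dom sz.
by split=> //; [rewrite /slice_param cinvK|apply/(Ss.2 _ sd); rewrite cinvK].
Qed.

Lemma slice_point_derive z u : differentiable slice_point z /\ 'D_u slice_point z = in_slice u.
Proof.
have d : differentiable slice_point z by exact: (slice_point_Ck 1 (@openT _)).1.
split; first exact d.
have -> : slice_point = (fun=> in_slice (s x).1) + @in_slice R n.
  by apply/funext => w; exact: slice_pointE.
have di : differentiable (@in_slice R n) z.
  by apply: linear_differentiable; exact: in_slice_continuous.
rewrite deriveD; [|exact: derivable_cst|exact: diff_derivable].
by rewrite derive_cst add0r (deriveE _ di) diff_lin//; exact: in_slice_continuous.
Qed.

Let Sphi : smooth (overlap s phi) (transition s phi).
Proof. by have [] := Ss.1 _ (chart_at_atlas x). Qed.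

Let F := re_part f \o cinv phi.
Let SF : smooth (phi @` cdom phi) F.
Proof. by have [] := f_hol.1 _ (chart_at_atlas x). Qed.

Let chi z := transition s phi (slice_point z).

Let chi_dom z : slice_dom z -> (phi @` cdom phi) (chi z).
Proof. by move=> /transition_overlap /overlapP[]. Qed.

Let chi_smooth : smooth slice_dom chi.
Proof.
move=> k; apply: (@Ck_comp _ _ _ _ (Cn_coordinates R n) (Cn_coordinates R n) k slice_dom
  (overlap s phi) slice_point (transition s phi)) => //.
- exact: slice_dom_open.
- exact: overlap_open.
- by apply: slice_point_Ck; exact: slice_dom_open.
Qed.

Let chiE z : slice_dom z -> cinv phi (chi z) = slice_param z.
Proof. by move=> zd; exact: cinv_transition. Qed.

Let heightE z : slice_dom z -> height z = sigma * (re_part f x - (F \o chi) z).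
Proof. by move=> zd; rewrite /F /= chiE. Qed.

Lemma height_smooth : smooth slice_dom height.
Proof.
move=> k; have oD := slice_dom_open.
have CF : Ck k slice_dom (fun z => F (chi z)).
  exact: (Ck_comp_scalar (Cn_coordinates R n) oD chi_dom (chi_smooth k) (SF k)).
have C := CkM oD (@Ck_cst _ _ _ k slice_dom sigma)
  (CkB oD (@Ck_cst _ _ _ k slice_dom (re_part f x)) CF).
by apply: Ck_ext oD _ C => z; rewrite inE => zd; rewrite heightE.
Qed.

Lemma height0 : height 0 = 0.
Proof. by rewrite /height slice_param0 subrr mulr0. Qed.

Lemma height_derive z u : slice_dom z ->
  'D_u height z = - sigma * complex.Re (differential f (slice_param z) (tangent_map s (slice_param z) u)).
Proof.
move=> zd; have [_ sd _ sE _] := slice_domP zd.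
rewrite (re_differential f_hol u Ss.1 sd) sE.
have [d _] := function_diff Ss.1 sd (re_diff f_hol (slice_param z)).
have {}d : differentiable (re_part f \o cinv s) (slice_point z) by rewrite -sE.
have [dp pE] := slice_point_derive z u.
pose g := (re_part f \o cinv s) \o slice_point.
have dg : differentiable g z := differentiable_comp dp d.
have gE : 'D_u g z = 'D_(u, 0) (re_part f \o cinv s) (slice_point z).
  rewrite (deriveE _ dg) (deriveE _ d).
  by apply: (etrans (diff_comp_apply u dp d)); rewrite -(deriveE _ dp) pE.
have -> : height = sigma *: ((fun=> re_part f x) - g) by [].
have d1 : derivable g z u := diff_derivable dg.
have d2 : derivable ((fun=> re_part f x) : 'rV[R]_n -> R) z u := derivable_cst _ _ _.
rewrite (deriveZ sigma (derivableB d2 d1)) (deriveB d2 d1) gE.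
by rewrite derive_cst sub0r scalerN -scaleNr.
Qed.

Lemma height_critical u : 'D_u height 0 = 0.
Proof.
rewrite (height_derive _ slice_dom0) slice_param0 (critical_differential f_hol x_critical).
by rewrite mulr0.
Qed.

(** The tangent map of the slice parametrisation intertwines both Hessians, [x] being critical. *)
Lemma height_hessian u :
  'D_u (fun z => 'D_u height z) 0 =
  - sigma * complex.Re (hessian f x (tangent_map s x u) (tangent_map s x u)).
Proof.
have oD := slice_dom_open; have D0 := slice_dom0.
have chi0 : chi 0 = phi x by rewrite /chi slice_point0 transition_chart.
have chid : 'D_u chi 0 = tangent_map s x u.
  have [dp pE] := slice_point_derive 0 u.
  have dt : differentiable (transition s phi) (slice_point 0) by exact: smooth_diff Sphi D0.
  have dc : differentiable chi 0 := differentiable_comp dp dt.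
  rewrite (deriveE _ dc); apply: (etrans (diff_comp_apply u dp dt)).
  by rewrite -(deriveE _ dp) pE slice_point0.
have dF0 w : 'D_w F (chi 0) = 0.
  rewrite chi0; have dF : differentiable F (phi x) by exact: re_diff.
  have := critical_differential f_hol x_critical w.
  by rewrite (deriveE _ dF) => /(congr1 (fun c : R[i] => complex.Re c)).
have Ho : open (phi @` cdom phi) by exact: cimage_open.
have H := second_derivative_critical (Cn_coordinates R n) u oD Ho D0 chi_dom
  (chi_smooth 2) (SF 2%N) dF0.
have hE : \forall z \near (0 : 'rV[R]_n), - sigma *: 'D_u (F \o chi) z = 'D_u height z.
  have := open_near oD D0; apply: near_mono => z zd.
  have dchi := smooth_diff chi_smooth zd; have dF := smooth_diff SF (chi_dom zd).
  have d1 : derivable (F \o chi) z u := diff_derivable (differentiable_comp dchi dF).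
  have d2 : derivable ((fun=> re_part f x) : 'rV[R]_n -> R) z u := derivable_cst _ _ _.
  have E : \forall w \near z, (sigma *: ((fun=> re_part f x) - (F \o chi))) w = height w.
    by have := open_near oD zd; apply: near_mono => w wd; rewrite heightE.
  rewrite -(near_eq_derive u E) (deriveZ sigma (derivableB d2 d1)) (deriveB d2 d1).
  by rewrite derive_cst sub0r scalerN scaleNr.
rewrite -(near_eq_derive u hE).
have d3 : derivable (fun z => 'D_u (F \o chi) z) 0 u.
  have CFc : Ck 2 slice_dom (F \o chi).
    exact: (Ck_comp_scalar (Cn_coordinates R n) oD chi_dom (chi_smooth 2) (SF 2%N)).
  by have [_ /(_ u)[dd _]] := CFc; apply: diff_derivable; exact: dd.
rewrite (deriveZ (- sigma) d3) H chid chi0.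
by [].
Qed.

Lemma tangent_map_slice z u : slice_dom z ->
  tangent_map s (slice_param z) u = to_tangent phi (chi z) ('D_(u, 0) (transition s phi) (slice_point z)).
Proof.
move=> zd; have [_ sd pd sE _] := slice_domP zd.
have Sp := atlas_smooth_chart (chart_at_atlas x).
have Sq := atlas_smooth_chart (chart_at_atlas (slice_param z)).
have qq := chart_at_dom (slice_param z).
have d1 := smooth_chart_diff Ss.1 Sp sd pd.
have d2 := smooth_chart_diff Sp Sq pd qq.
have [_ E] := transition_comp_diff sd pd qq d1 d2.
apply: (etrans (E _)); rewrite /to_tangent (chiE zd).
have -> : chi z = phi (slice_param z) by rewrite /chi -sE transition_chart.
have Dv : 'd (transition s phi) (s (slice_param z)) (u, 0) =
    'D_(u, 0) (transition s phi) (slice_point z) by rewrite -sE; exact: esym (deriveE _ d1).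
exact: (congr1 (fun v => 'd (transition phi (chart_at (slice_param z))) (phi (slice_param z)) v) Dv).
Qed.

(** In the holomorphic chart at [x] the tangent vectors [tangent_map] have as coordinates the partial
    derivatives of the transition map; bilinearity reduces the claim to the smoothness of the Hermitian
    metric on constant vectors of this chart. *)
Lemma metric_matrix_smooth i j : smooth slice_dom (fun z => metric_matrix z i j).
Proof.
move=> k; have oD := slice_dom_open; have b := Cn_coordinates R n.
pose c i l z := lcoord (Cn_coordinates R n) l
  ('D_(delta_mx 0 i, 0) (transition s phi) (slice_point z)).
pose H l m w := riemannian h (cinv phi w) (to_tangent phi w (cvec (Cn_coordinates R n) l))
   (to_tangent phi w (cvec (Cn_coordinates R n) m)).
have Cc i' l : Ck k slice_dom (c i' l).
  apply: (@Ck_linear_comp _ _ _ _ (lcoord (Cn_coordinates R n) l) k slice_dom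
    (fun z => 'D_(delta_mx 0 i', 0) (transition s phi) (slice_point z))) => //.
    exact: lcoord_continuous.
  have CD : Ck k (overlap s phi) (fun w => 'D_(delta_mx 0 i', 0) (transition s phi) w).
    by have [_] := Sphi k.+1; apply.
  exact: (Ck_comp (Cn_coordinates R n) (Cn_coordinates R n) oD (fun z zd => zd)
    (@overlap_open _ _ _ s phi) (slice_point_Ck k oD) CD).
have CH l m : Ck k slice_dom (fun z => H l m (chi z)).
  apply: (Ck_comp_scalar (Cn_coordinates R n) oD chi_dom (chi_smooth k)).
  by have [S _] := herm_smooth h (chart_at_atlas x) (cvec (Cn_coordinates R n) l)
       (cvec (Cn_coordinates R n) m); exact: S.
have C : Ck k slice_dom (fun z => \sum_l c i l z * (\sum_m c j m z * H l m (chi z))).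
  apply: Ck_sum => // l _; apply: CkM => //; apply: Ck_sum => // m _; exact: CkM.
apply: Ck_ext oD _ C => z; rewrite inE => zd.
rewrite mxE !tangent_map_slice//.
have tsum v : to_tangent phi (chi z) v = \sum_l lcoord (Cn_coordinates R n) l v *:
    to_tangent phi (chi z) (cvec (Cn_coordinates R n) l).
  rewrite /to_tangent; move: ('d (transition phi _) _) => D.
  rewrite {1}(lcoord_sum (Cn_coordinates R n) v) linear_sum.
  by apply: eq_bigr => l _; rewrite linearZ.
have Hgen u v : riemannian h (slice_param z) (to_tangent phi (chi z) u) (to_tangent phi (chi z) v) =
    \sum_l lcoord (Cn_coordinates R n) l u *
       (\sum_m lcoord (Cn_coordinates R n) m v * H l m (chi z)).
  rewrite (tsum u) riemannian_sum; apply: eq_bigr => l _; congr (_ * _).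
  rewrite riemannian_sym (tsum v) riemannian_sum; apply: eq_bigr => m _.
  by congr (_ * _); rewrite riemannian_sym /H chiE.
exact: esym (Hgen _ _).
Qed.

Lemma metric_matrix_form z (u v : 'rV[R]_n) :
  (u *m metric_matrix z *m v^T) 0 0 = riemannian h (slice_param z)
    (tangent_map s (slice_param z) u) (tangent_map s (slice_param z) v).
Proof.
set T := tangent_map _ _.
have TE w : T w = \sum_i w 0 i *: T (delta_mx 0 i).
  by rewrite {1}(row_sum_delta w) linear_sum; apply: eq_bigr => i _; rewrite linearZ.
rewrite (TE u) riemannian_sum -mulmxA mxE; apply: eq_bigr => i _; congr (_ * _).
rewrite riemannian_sym (TE v) riemannian_sum mxE; apply: eq_bigr => j _.
by rewrite !mxE mulrC riemannian_sym.
Qed.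

Lemma metric_matrix_sym z : (metric_matrix z)^T = metric_matrix z.
Proof. by apply/matrixP => i j; rewrite !mxE riemannian_sym. Qed.

Lemma metric_matrix_pos z (u : 'rV[R]_n) : slice_dom z -> u != 0 ->
  0 < (u *m metric_matrix z *m u^T) 0 0.
Proof.
move=> zd u0; have [_ sd _ _ _] := slice_domP zd.
rewrite metric_matrix_form; apply: riemannian_pos; apply: contra u0 => /eqP Tu.
by apply/eqP/(tangent_map_inj Ss.1 sd); rewrite Tu linear0.
Qed.

Lemma slice_horizontal z (u : 'rV[R]_n) (k : R) : slice_dom z -> sigma != 0 ->
  (forall v : 'rV[R]_n, (v *m metric_matrix z *m u^T) 0 0 = k * 'D_v height z) ->
  horizontal h f (slice_param z) (tangent_map s (slice_param z) u).
Proof.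
move=> zd sig0 uk; have [_ sd _ _ Vz] := slice_domP zd.
have tT w := tangent_map_tangent w Ss sd.
apply: (@horizontal_of_gradient _ _ _ h (slice_param z) (tangent_map s (slice_param z))
  (tangent_map_inj Ss.1 sd) _ (differential f (slice_param z)) u (- (k * sigma))).
- by move=> a b; apply: V_iso => //; exact: tT.
- exact: differentialD.
- exact: f_hol.2.
- by move=> a; exact: (im_differential f_hol f2_constant a Ss sd Vz).
move=> v; rewrite riemannian_sym -metric_matrix_form uk height_derive//.
by rewrite mulrA mulrN.
Qed.

End SliceCoordinates.

(** * Tangent vectors at boundary points *)

Lemma near_right (R : realType) (P : R -> Prop) (x : R) : (\forall t \near x, P t) ->
  \forall t \near x^'+, P t.
Proof. by move=> H; apply: cvg_within. Qed.

Lemma diff_one_sided (R : realType) (V W : normedModType R) (F : V -> W) p v : differentiable F p ->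
  (\forall t \near (0 : R)^'+, F (t *: v + p) = F p) -> 'd F p v = 0.
Proof.
move=> dF H; apply/eqP; rewrite -normr_le0; apply/ler_addgt0Pr => e e0; rewrite add0r.
pose e' := e / (1 + `|v|).
have v1 : 0 < 1 + `|v| by rewrite ltr_pwDl.
have e'0 : 0 < e' by rewrite divr_gt0.
have tv : (fun t : R => t *: v) @ (0 : R) --> (0 : V).
  by rewrite -[X in _ --> X](scale0r v); exact: scalel_continuous.
have H2 : \forall t \near (0 : R)^'+, `|F (t *: v + p) - F p - 'd F p (t *: v)| <= e' * `|t *: v|.
  exact: near_right (tv _ (differentiable_eps dF e'0)).
have : \forall t \near (0 : R)^'+, 0 < t /\
    (F (t *: v + p) = F p /\ `|F (t *: v + p) - F p - 'd F p (t *: v)| <= e' * `|t *: v|).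
  by apply: filterS3 (nbhs_right_gt 0) H H2 => t.
move=> /filter_ex[t [t0 [-> ]]]; rewrite subrr sub0r normrN linearZ /= !normrZ mulrCA gtr0_norm//.
rewrite ler_pM2l// => /le_trans; apply.
by rewrite /e' mulrAC ler_pdivrMr// ler_wpM2l ?lerDr// ltW.
Qed.

Lemma diff_one_sided_linear (R : realType) (V W W' : normedModType R) (L : {linear W -> W'}) (F : V -> W) p v : continuous L ->
  differentiable F p ->
  (\forall t \near (0 : R)^'+, L (F (t *: v + p)) = L (F p)) -> L ('d F p v) = 0.
Proof.
move=> cL dF H.
have dL : differentiable L (F p) by exact: linear_differentiable.
have := diff_one_sided (differentiable_comp dF dL) H.
by move=> E; have := diff_comp_apply v dF dL; rewrite E diff_lin.
Qed.

Section TangentSubset.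
Variables (R : realType) (n : nat) (N : complexManifold R n).

Let psnd (w : Cn R n) : 'rV[R]_n := w.2.
Fact psnd_linear : linear psnd.
Proof. by []. Qed.
HB.instance Definition _ := GRing.isLinear.Build _ _ _ _ psnd psnd_linear.

Let psnd_continuous : continuous psnd.
Proof. by move=> w; exact: cvg_snd. Qed.

(** At a boundary point only one of the two directions [a] and [- a] points into the half-space; the sign of
    [b] selects it. *)
Lemma half_line_in_chart (s : chart R n N) p (B : set N) (a : 'rV[R]_n)
  (O : set (Cn R n)) : open O -> O `<=` s @` cdom s -> O (s p) -> cdom s p -> B p ->
  slice_chart B s \/ half_slice_chart B s ->
  exists2 b : R, b != 0 & \forall t \near (0 : R)^'+,
    O (t *: (b *: ((a, 0) : Cn R n)) + s p) /\
    B (cinv s (t *: (b *: ((a, 0) : Cn R n)) + s p)).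
Proof.
move=> oO Os Op sp Bp SB.
have near_s b : \forall t \near (0 : R)^'+, O (t *: (b *: ((a, 0) : Cn R n)) + s p).
  have lc : (fun t : R => t *: (b *: ((a, 0) : Cn R n)) + s p) @ (0 : R) --> s p.
    rewrite -[X in _ --> X]add0r -(scale0r (b *: ((a, 0) : Cn R n))).
    by apply: cvgD; [exact: scalel_continuous|exact: cvg_cst].
  exact: near_right (lc _ (open_near oO Op)).
have snd0 b (t : R) : (t *: (b *: ((a, 0) : Cn R n)) + s p).2 = (s p).2.
  by rewrite /= !scaler0 add0r.
case: SB => [[Ss SB]|[Ss [i SB]]].
  have p2 : (s p).2 = 0 by apply/(SB p sp).
  exists 1; first exact: oner_neq0.
  apply: filterS (near_s 1) => t st; split=> //.
  by apply/(SB _ (cinv_dom (Os _ st))); rewrite (cinvK (Os _ st)) snd0.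
have [p2 pi] := (SB p sp).1 Bp.
pose b : R := if 0 <= a 0 i then 1 else -1.
have b0 : b != 0 by rewrite /b; case: ifP => _; rewrite ?oppr_eq0 oner_eq0.
have ba : 0 <= b * a 0 i.
  rewrite /b; case: ifPn => [a0|]; first by rewrite mul1r.
  by rewrite -ltNge mulN1r oppr_ge0 => /ltW.
exists b => //.
apply: filterS2 (near_s b) (nbhs_right_gt 0) => t st t0; split=> //.
apply/(SB _ (cinv_dom (Os _ st))); rewrite (cinvK (Os _ st)) snd0; split=> //.
by rewrite /= !mxE addr_ge0// mulr_ge0// ltW.
Qed.

(** Half-lines of [B] lie in [V], so that the normal coordinates of a slice chart of [V] are constant along
    them. *)
Lemma tangent_subset (B V : set N) p v : B `<=` V -> B p -> submanifold V ->
  tangent B p v -> tangent V p v.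
Proof.
move=> BV Bp VS [s [sp SB v2]].
have [t tp St] := VS p (BV p Bp).
exists t; split; [exact: tp|by left|].
have Ss : smooth_chart s by case: SB => -[].
have Sp := atlas_smooth_chart (chart_at_atlas p); have pp := chart_at_dom p.
have d1 := smooth_chart_diff Sp Ss pp sp; have d2 := smooth_chart_diff Ss St.1 sp tp.
have [_ E] := transition_comp_diff pp sp tp d1 d2.
suff key w : w.2 = 0 -> ('d (transition s t) (s p) w).2 = 0.
  exact: (etrans (congr1 (fun w => w.2) (E v)) (key _ v2)).
case: w => a a' /= ->.
have oO := @overlap_open _ _ _ s t.
have Os : overlap s t `<=` s @` cdom s by move=> w /overlapP[].
have [b b0 Hb] := half_line_in_chart a oO Os (overlap_chart sp tp) sp Bp SB.
have tV w : overlap s t w -> V (cinv s w) -> (transition s t w).2 = 0.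
  by move=> /overlapP[sw tw] Vw; apply/(St.2 _ tw).
have : psnd ('d (transition s t) (s p) (b *: ((a, 0) : Cn R n))) = 0.
  apply: diff_one_sided_linear; [exact: psnd_continuous|exact: d2|].
  apply: filterS Hb => tau [st Bt]; apply: (etrans (tV _ st (BV _ Bt))).
  by apply/esym/tV; [exact: overlap_chart|rewrite chartK//; exact: BV].
move: ('d (transition s t) (s p)) => D.
rewrite linearZ /psnd /= => /eqP; rewrite scaler_eq0 (negbTE b0) /= => /eqP; exact.
Qed.

End TangentSubset.

(** * The ball and its foliation by horizontal lifts *)

(** The ball is a union of segments through 0. *)
Lemma unit_ball_connected (R : realType) n : connected (unit_ball R n).
Proof.
have -> : unit_ball R n = \bigcup_(v in unit_ball R n) ((fun t : R => t *: v) @` `[0, 1]).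
  apply/seteqP; split=> [v v1|_ [v v1 [t + <-]]].
    by exists v => //; exists 1; rewrite ?scale1r//= in_itv/= lexx ler01.
  rewrite /= in_itv/= => /andP[t0 t1]; rewrite /unit_ball /= -/(sumsq _) sumsqZ.
  rewrite (le_trans _ v1)// ler_piMl ?sumsq_ge0// expr_le1//.
apply: bigcup_connected.
  by exists 0 => v _; exists 0; rewrite ?scale0r//= in_itv/= lexx ler01.
move=> v _; apply: connected_continuous_connected; first exact: segment_connected.
by apply: continuous_subspaceT; exact: scalel_continuous.
Qed.

Lemma ball_segment (R : realType) (V : normedModType R) (p w a : V) (d t : R) :
  ball p d w -> ball p d (w + a) -> 0 <= t <= 1 -> ball p d (w + t *: a).
Proof.
rewrite -ball_normE /= => h1 h2 /andP[t0 t1].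
have -> : p - (w + t *: a) = (1 - t) *: (p - w) + t *: (p - (w + a)).
  have -> : p - (w + a) = (p - w) - a by rewrite opprD addrA.
  by rewrite [t *: (_ - a)]scalerBr addrA -scalerDl subrK scale1r opprD addrA.
rewrite (le_lt_trans (ler_normD _ _))// !normrZ (ger0_norm t0) ger0_norm ?subr_ge0//.
rewrite (_ : d = (1 - t) * d + t * d); last by ring.
have [->|tn] := eqVneq t 0; first by rewrite subr0 !mul0r !addr0 !mul1r.
apply: ler_ltD; first by rewrite ler_wpM2l ?subr_ge0// ltW.
by rewrite ltr_pM2l// lt_def tn.
Qed.

Section Thimble.
Variables (R : realType) (n : nat) (N : complexManifold R n) (h : hermitianMetric N).
Variables (f : N -> R[i]) (V : set N) (x : N) (s : chart R n N) (sigma : R).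
Hypotheses (f_hol : holomorphic f) (V_lagr : lagrangian h V) (Vx : V x)
  (x_critical : critical_point f x)
  (f2_constant : forall y z, V y -> V z -> im_part f y = im_part f z)
  (Ss : slice_chart V s) (sx : cdom s x) (sigma2 : sigma * sigma = 1).

Local Notation E := (slice_param x s).
Local Notation G := (height f x s sigma).

Variables (r c L M : R) (X : 'rV[R]_n -> 'rV[R]_n).
Hypotheses (r0 : 0 < r) (c0 : 0 < c) (L0 : 0 < L)
  (rdom : forall z, `|z| <= r -> slice_dom x s z)
  (rad : forall z, `|z| <= r -> c * `|z| ^+ 2 <= 'D_z G z)
  (XL : forall a b, `|X a - X b| <= L * `|a - b|) (XM : forall a, `|X a| <= M)
  (XG : forall z, `|z| <= r -> 'D_(X z) G z = - G z)
  (XA : forall z, `|z| <= r -> exists k, forall u : 'rV[R]_n,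
     (u *m metric_matrix h x s z *m (X z)^T) 0 0 = k * 'D_u G z).

Variable e : R.
Hypotheses (e0 : 0 < e) (er : e < c / 2 * r ^+ 2).

Let sigma0 : sigma != 0.
Proof. by apply/eqP => s0; move: sigma2 => /eqP; rewrite s0 mul0r eq_sym oner_eq0. Qed.

Let G0 : G 0 = 0. Proof. exact: (height0 f sigma Vx Ss sx). Qed.

Let dG z : `|z| <= r -> differentiable G z.
Proof. by move=> /rdom; apply: smooth_diff; exact: (height_smooth x sigma f_hol Ss). Qed.

Let K : set 'rV[R]_n := [set z | `|z| <= r /\ G z <= e].
Let B : set N := E @` K.
Let coords (q : N) : 'rV[R]_n := (s q).1 - (s x).1.
Let D : set N := [set q | V q /\ 0 <= sigma * (re_part f x - re_part f q) <= e].

Let K_lt z : K z -> `|z| < r.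
Proof. by move=> [zr Gz]; exact: (model_norm_lt r0 c0 G0 dG rad er zr Gz). Qed.

Let coordsK z : `|z| <= r -> coords (E z) = z.
Proof.
move=> /rdom zd; have [_ _ _ sE _] := slice_domP Ss zd.
by rewrite /coords sE /= addrC addKr.
Qed.

Let paramK q : V q -> cdom s q -> E (coords q) = q.
Proof.
move=> Vq sq; rewrite /slice_param /slice_point /coords addrC subrK.
have : (s q).2 = 0 by apply/(Ss.2 _ sq).
by move=> q2; rewrite -[RHS](chartK sq); congr (cinv s _); rewrite /in_slice -q2; case: (s q).
Qed.

Let E_continuous z : `|z| <= r -> {for z, continuous E}.
Proof.
move=> /rdom zd; have [sz _ _ _ _] := slice_domP Ss zd.
by apply: continuous_comp; [exact: slice_point_continuous|exact: cinv_continuous].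
Qed.

Let coords_continuous q : cdom s q -> {for q, continuous coords}.
Proof.
move=> sq; apply: (@continuous_comp _ _ _ s (fun w : Cn R n => w.1 - (s x).1)).
  exact: cfun_continuous.
apply: (@continuous_comp _ _ _ fst (fun u : 'rV[R]_n => u - (s x).1)).
  exact: cvg_fst.
have C : Ck 0 setT (fun u : 'rV[R]_n => u - (s x).1).
  by apply: CkB; [exact: openT|exact: Ck_id|exact: Ck_cst].
exact: C.
Qed.

Let E_D z : K z -> D (E z).
Proof.
move=> [zr Gz]; have [_ _ _ _ Vz] := slice_domP Ss (rdom zr); split=> //.
by rewrite Gz (model_ge0 c0 G0 dG rad zr).
Qed.

Let E_dom z : `|z| <= r -> cdom s (E z).
Proof. by move=> /rdom zd; have [] := slice_domP Ss zd. Qed.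

Let K0 : K 0.
Proof. by split; rewrite ?normr0 ?G0 ltW. Qed.

Let E0x : E 0 = x. Proof. exact: (slice_param0 Vx Ss sx). Qed.

Let Bx : B x. Proof. by exists 0. Qed.

Let BV : B `<=` V.
Proof. by move=> _ [z /E_D[] + _ <-]. Qed.

Let ball_homeo : exists Phi : 'rV[R]_n -> N,
  homeo_on (unit_ball R n) B Phi /\
  Phi @` unit_sphere R n = E @` [set z | `|z| <= r /\ G z = e].
Proof.
have [Phi [Psi [PB PK Pc Psc PS]]] := model_ball r0 c0 G0 dG rad e0 er.
have PhiK v : unit_ball R n v -> K (Phi v) by move=> v1; rewrite /K -PB; exists v.
exists (E \o Phi); split; last by rewrite -PS image_comp.
exists (Psi \o coords); split.
- by rewrite -image_comp PB.
- move=> v; rewrite inE => v1; rewrite /= coordsK; last exact: (PhiK v v1).1.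
  by apply: PK; rewrite inE.
- apply: within_continuous_comp => // z; rewrite inE => -[v v1 <-].
  by apply: E_continuous; exact: (PhiK v v1).1.
apply: continuous_in_subspaceT => q; rewrite inE => -[z Kz <-].
apply: continuous_comp; first by apply: coords_continuous; apply: E_dom; exact: Kz.1.
by rewrite coordsK ?Kz.1//; exact: Psc.
Qed.

Let B_connected : connected B.
Proof.
have [Phi [[Gi [<- _ Pc _]] _]] := ball_homeo.
by apply: connected_continuous_connected => //; exact: unit_ball_connected.
Qed.

Let B_closed : closed B.
Proof.
apply: compact_closed; first exact: carrier_hausdorff.
apply: continuous_compact; last exact: (model_compact r0 dG).
by apply: continuous_in_subspaceT => z; rewrite inE => -[zr _]; exact: E_continuous.
Qed.

Let tube : set N := [set q | cdom s q /\ `|coords q| < r].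

Let tube_open : open tube.
Proof.
apply: near_open => q [sq qr]; apply: near_conj; first exact: open_near (@cdom_open _ _ _ s) sq.
have nc : {for q, continuous (fun q => `|coords q|)}.
  by apply: (@continuous_comp _ _ _ coords (fun u : 'rV[R]_n => `|u|));
    [exact: coords_continuous|exact: norm_continuous].
by have /cvgr_lt := nc; apply.
Qed.

Let E_tube z : K z -> tube (E z).
Proof.
move=> Kz; have [zr _] := Kz; split; first exact: E_dom.
by rewrite coordsK//; exact: K_lt.
Qed.

Let tube_B q : tube q -> V q -> sigma * (re_part f x - re_part f q) <= e -> B q.
Proof.
move=> [sq qr] Vq qe; exists (coords q); last exact: paramK.
by split; [exact: ltW|rewrite /height paramK].
Qed.

(** The tube is a neighbourhood of the ball that meets the level region [D] in the ball only.  Together with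
    closedness this makes the trace of the ball on a connected part of [D] open and closed. *)
Lemma component_is_ball : connected_component D x = B.
Proof.
apply/seteqP; split; last first.
  by apply: connected_component_max => // _ [z Kz <-]; exact: E_D.
move=> q [C [Cx CD Cc] Cq].
suff CB : C `&` B = C by have [] : (C `&` B) q by rewrite CB.
apply: Cc; first by exists x.
  exists tube; first exact: tube_open.
  apply/seteqP; split=> y [Cy].
    by move=> By; split=> //; have [z Kz <-] := By; exact: E_tube.
  by move=> ty; split=> //; have [Vy /andP[_ ye]] := CD _ Cy; exact: tube_B.
by exists B => //; exact: B_closed.
Qed.

Let inner_point p : B p -> sigma * (re_part f x - re_part f p) < e ->
  exists2 t, cdom t p & slice_chart B t.
Proof.
move=> Bp pe; have [z Kz zp] := Bp.
pose A := [set q | tube q /\ (G \o clamp r) (coords q) < e].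
have oA : open A.
  apply: near_open => q [tq qe]; apply: near_conj; first exact: open_near tube_open tq.
  have gc : {for q, continuous ((G \o clamp r) \o coords)}.
    apply: continuous_comp; first by apply: coords_continuous; exact: tq.1.
    exact: (model_clamp_continuous r0 dG).
  by have /cvgr_lt := gc; apply.
have Ap : A p.
  rewrite -zp; split; first exact: E_tube.
  by rewrite coordsK ?Kz.1//= clamp_id ?Kz.1//; move: pe; rewrite -zp.
exists (restrict s oA); first by split=> //; exact: Ap.1.1.
split; first exact: (restrict_smooth _ Ss.1).
move=> q [sq [tq qe]]; split=> [Bq|q2]; first by apply/(Ss.2 _ sq); exact: BV.
have Vq : V q by apply/(Ss.2 _ sq).
apply: tube_B => //.
have <- : G (coords q) = sigma * (re_part f x - re_part f q) by rewrite /height paramK.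
by move: qe; rewrite /= clamp_id ?(ltW tq.2)// => /ltW.
Qed.

Let boundary_point p : B p -> sigma * (re_part f x - re_part f p) = e ->
  exists2 t, cdom t p & half_slice_chart B t.
Proof.
move=> Bp pe; have [z Kz zp] := Bp.
have zr := K_lt Kz.
have Gz : G z = e by rewrite /height zp.
have z0 : z != 0 by apply/eqP => z0; move: Gz; rewrite z0 G0 => ee; move: e0; rewrite -ee ltxx.
pose Gi i (w : 'rV[R]_n) := 'D_(delta_mx 0 i) G w.
(* The radial derivative is not zero, hence some partial derivative is not. *)
have [i Gi0] : exists i, Gi i z != 0.
  apply: contrapT => /forallNP H.
  have : 0 < 'D_z G z.
    by apply: lt_le_trans (rad (ltW zr)); rewrite mulr_gt0// exprn_gt0// normr_gt0.
  rewrite derive_row_sum; last exact: dG (ltW zr).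
  by rewrite big1 ?ltxx// => i _; have /negP/negPn/eqP := H i; rewrite /Gi => ->; rewrite mulr0.
pose cc (w : Cn R n) : 'rV[R]_n := w.1 - (s x).1.
pose g (w : Cn R n) := e - G (cc w).
(* A constant with the sign of the derivative of [g], which may be negative. *)
pose k := - Gi i z.
have sd : cdom s p by rewrite -zp; exact: (E_dom Kz.1).
have ccp : cc (s p) = z by rewrite -zp; exact: (coordsK Kz.1).
have SG := height_smooth x sigma f_hol Ss.
have Gic : {for z, continuous (Gi i)}.
  by have [_ /(_ (delta_mx 0 i))] := SG 1%N; apply; apply: rdom; exact: ltW.
have oD := @slice_dom_open _ _ _ x s.
have ccl : Ck 1 setT cc.
  apply: CkB; [exact: openT| |exact: Ck_cst].
  have C := @Ck_linear R (Cn R n) 'rV[R]_n fst 1 setT.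
  by apply: C => w; exact: cvg_fst.
have ccc : continuous cc by move=> w; exact: (CkW ccl).
have near_good : \forall w \near s p, (s @` cdom s) w /\
   ((`|cc w| < r /\ slice_dom x s (cc w)) /\ 0 < Gi i z * Gi i (cc w)).
  apply: near_conj; first by apply: open_near (@cimage_open _ _ _ s) _; exists p.
  apply: near_conj; first apply: near_conj.
  - have nc : {for s p, continuous (fun w => `|cc w|)}.
      by apply: (@continuous_comp _ _ _ cc (fun u : 'rV[R]_n => `|u|));
        [exact: ccc|exact: norm_continuous].
    by have /cvgr_lt := nc; apply; rewrite ccp.
  - by apply: ccc; apply: open_nbhs_nbhs; split=> //; rewrite ccp; apply: rdom; exact: ltW.
  have nc : {for s p, continuous (fun w => Gi i z * Gi i (cc w))}.
    apply: continuousM; first exact: cst_continuous.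
    by apply: (@continuous_comp _ _ _ cc (Gi i)); [exact: ccc|rewrite ccp].
  by have /cvgr_gt := nc; apply; rewrite ccp -expr2 exprn_even_gt0.
have /nbhs_ballP[d /= d0 dgood] := near_good.
pose O := ball (s p) d.
have oO : open O by exact: ball_open.
have Os : O `<=` s @` cdom s by move=> w /dgood[].
pose ei : Cn R n := (delta_mx 0 i, 0).
have segO (w : Cn R n) (a t : R) : O w -> O (w + a *: ei) -> 0 <= t <= 1 -> O (w + t *: (a *: ei)).
  exact: ball_segment.
have ccd w : differentiable cc w by exact: ccl.1.
have ccD w : 'D_ei cc w = delta_mx 0 i.
  have -> : cc = fst - (fun=> (s x).1) by [].
  have d1 : differentiable (fst : Cn R n -> 'rV[R]_n) w.
    by apply: linear_differentiable => v; exact: cvg_fst.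
  rewrite deriveB; [|exact: diff_derivable|exact: derivable_cst].
  by rewrite derive_cst subr0 (deriveE _ d1) diff_lin// => v; exact: cvg_fst.
have Cg : smooth O g.
  move=> j; apply: CkB => //; first exact: Ck_cst.
  apply: (Ck_comp_scalar (rV_coordinates R n) oO (O := slice_dom x s)) (SG j).
    by move=> w /dgood[_ [[]]].
  apply: CkB => //; last exact: Ck_cst.
  have C := @Ck_linear R (Cn R n) 'rV[R]_n fst j O.
  by apply: C => w; exact: cvg_fst.
have Dg w : O w -> 0 < k * 'D_ei g w.
  move=> /dgood[_ [[cr cd] cpos]].
  have dGc : differentiable G (cc w) by exact: smooth_diff SG cd.
  have dgc : differentiable (G \o cc) w := differentiable_comp (ccd w) dGc.
  have -> : 'D_ei g w = - Gi i (cc w).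
    have -> : g = (fun=> e) - (G \o cc) by [].
    rewrite deriveB; [|exact: derivable_cst|exact: diff_derivable].
    rewrite derive_cst sub0r; congr (- _).
    rewrite (deriveE _ dgc); apply: (etrans (diff_comp_apply ei (ccd w) dGc)).
    by rewrite -(deriveE _ (ccd w)) ccD -(deriveE _ dGc).
  by rewrite /k mulrNN.
have pO : O (s p) by exact: ballxx.
exists (shear_chart oO Os segO Cg Dg); first by split.
split; first exact: (shear_chart_smooth _ _ _ _ _ Ss.1).
exists i => q [sq Oq]; rewrite shear_chart_snd shear_chart_fst.
have [_ [[qr _] _]] := dgood _ Oq.
have gE : V q -> g (s q) = e - sigma * (re_part f x - re_part f q).
  by move=> Vq; rewrite /g /height -/(coords q) paramK.
split=> [Bq|[q2 ge]].
  have Vq := BV Bq; split; first by apply/(Ss.2 _ sq).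
  rewrite gE// subr_ge0; move: Bq => [y Ky yq].
  by move: (E_D Ky).2 => /andP[_]; rewrite yq.
have Vq : V q by apply/(Ss.2 _ sq).
by move: ge; rewrite gE// subr_ge0 => ge; apply: tube_B => //; split.
Qed.

(** At an interior point the slice chart of [V] is restricted; at a boundary point it is sheared so that
    [e - G] becomes a coordinate. *)
Lemma ball_lagrangian : lagrangian_with_boundary h B.
Proof.
split=> p Bp.
  have [z Kz zp] := Bp; have [_ /andP[_ pe]] := E_D Kz; rewrite zp in pe.
  have [plt|pgt|peq] := ltgtP (sigma * (re_part f x - re_part f p)) e.
  - by have [t tp St] := inner_point Bp plt; exists t => //; left.
  - by move: pe; rewrite leNgt pgt.
  - by have [t tp St] := boundary_point Bp peq; exists t => //; right.
move=> u v Bu Bv; have [VS VI] := V_lagr.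
by apply: VI; [exact: BV|exact: tangent_subset BV Bp VS Bu|exact: tangent_subset BV Bp VS Bv].
Qed.

Hypothesis regular_near : forall t, 0 < t <= e ->
  regular_value f ((re_part f x - sigma * t) +i* im_part f x).

Let tau (t : R) : R := - ln (1 - t).

Let tau_derive (t : R) : t < 1 -> is_derive t 1 tau (1 - t)^-1.
Proof.
move=> t1; have t10 : 0 < 1 - t by rewrite subr_gt0.
have d1 : is_derive t 1 (fun t : R => 1 - t) (- 1).
  by rewrite -[X in is_derive _ _ _ X]sub0r; apply: is_deriveB.
have := is_deriveN (@is_derive1_comp R (@ln R) (fun t : R => 1 - t) t _ _ (is_derive1_ln t10) d1).
by rewrite mulrN1 opprK.
Qed.

Let tau_ge0 (t : R) : 0 <= t -> t < 1 -> 0 <= tau t.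
Proof. by move=> t0 t1; rewrite oppr_ge0 ln_le0// gerBl. Qed.

Let expR_tau (t : R) : t < 1 -> expR (- tau t) = 1 - t.
Proof. by move=> t1; rewrite opprK lnK// posrE subr_gt0. Qed.

Let height_level z : `|z| <= r ->
  f (E z) = (re_part f x - sigma * G z) +i* im_part f x.
Proof.
move=> zr; have [_ _ _ _ Vz] := slice_domP Ss (rdom zr).
have := f2_constant Vz Vx; rewrite /height mulrA sigma2 mul1r subKr /re_part /im_part.
by case: (f (E z)) => a b /= ->.
Qed.

(** The lift through the boundary point [q] is the trajectory of the normalised field issued from [q], at the time
    [tau t = - ln (1 - t)] for which [expR (- tau t) = 1 - t]. *)
Lemma ball_thimble : thimble h f x B.
Proof.
have [sol [sol0 dsol /(_ e)]] := model_foliation r0 c0 G0 dG rad L0 XL XM XG.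
rewrite e0 er => -[] // fwd bwd.
pose lambda (t : R) : R[i] := (re_part f x - sigma * (e * (1 - t))) +i* im_part f x.
pose alpha := E @` [set z | `|z| <= r /\ G z = e].
pose Gamma q t := E (sol (coords q) (tau t)).
have tE z (t : R) : `|z| <= r -> G z = e -> 0 <= t < 1 ->
    `|sol z (tau t)| < r /\ G (sol z (tau t)) = e * (1 - t).
  by move=> zr Gz /andP[t0 t1]; have := fwd z (tau t) zr Gz (tau_ge0 t0 t1); rewrite expR_tau.
exists lambda, alpha, Gamma; split.
- split.
  + split=> k /=; last by apply: Ck_cst.
    have oT : open [set: R] by exact: openT.
    apply: CkB => //; first exact: Ck_cst.
    apply: CkM => //; first exact: Ck_cst.
    apply: CkM => //; first exact: Ck_cst.
    by apply: CkB => //; [exact: Ck_cst|exact: Ck_id].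
  + move=> t /andP[t0 t1]; apply: regular_near.
    apply/andP; split; first by rewrite mulr_gt0// subr_gt0.
    by apply: ler_piMr; [exact: ltW|rewrite gerBl].
  + exact: x_critical.
  + by rewrite /lambda subrr !mulr0 subr0 /re_part /im_part; case: (f x).
- move=> _ [z [zr Gz] <-].
  have GE t : Gamma (E z) t = E (sol z (tau t)) by rewrite /Gamma coordsK.
  split; first by rewrite GE /tau subr0 ln1 oppr0 sol0.
  have cont (t : R) : 0 <= t < 1 -> {for t, continuous (Gamma (E z))}.
    move=> t01; have [sr _] := tE z t zr Gz t01; have /andP[t0 t1] := t01.
    have -> : Gamma (E z) = E \o (sol z \o tau) by apply/funext => u; rewrite GE.
    apply: continuous_comp; last by apply: E_continuous; exact: ltW.
    apply: continuous_comp.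
      by apply/differentiable_continuous/derivable1_diffP; have [] := tau_derive t1.
    by apply/differentiable_continuous/derivable1_diffP; have [] := dsol z (tau t).
  split.
  + by apply: continuous_in_subspaceT => t; rewrite inE /= in_itv/=; exact: cont.
  + move=> t t01; have [sr Gs] := tE z t zr Gz t01.
    by rewrite GE height_level ?ltW// Gs.
  + move=> t /andP[t0 t1] gphi; have t01 : 0 <= t < 1 by rewrite ltW.
    have [sr Gs] := tE z t zr Gz t01.
    pose w := sol z (tau t); pose v := (1 - t)^-1 *: X w.
    have wr : `|w| <= r by exact: ltW.
    have [sw sdw _ sE _] := slice_domP Ss (rdom wr).
    pose Fq := transition s (chart_at (E w)) \o slice_point x s.
    have [dp pE] := slice_point_derive x s w v.
    have dt : differentiable (transition s (chart_at (E w))) (slice_point x s w).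
      rewrite -sE; apply: smooth_chart_diff sdw (chart_at_dom _); first exact: Ss.1.
      exact: atlas_smooth_chart (chart_at_atlas _).
    have dFq : differentiable Fq w := differentiable_comp dp dt.
    have dc : is_derive t 1 (sol z \o tau) v.
      have dsol1 : differentiable (sol z) (tau t).
        by apply/derivable1_diffP; have [] := dsol z (tau t).
      have := is_derive_curve (tau_derive t1) dsol1.
      have -> : 'D_((1 - t)^-1) (sol z) (tau t) = v; last by [].
      rewrite (deriveE _ dsol1) -[(1 - t)^-1]mulr1; apply: (etrans (linearZ _ _)).
      by rewrite -(deriveE _ dsol1); have [_ ->] := dsol z (tau t).
    have gphiE : gphi = Fq \o (sol z \o tau).
      by apply/funext => u; rewrite /gphi /= !GE.
    have dg : is_derive t 1 (Fq \o (sol z \o tau)) ('D_v Fq w) by exact: is_derive_curve.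
    have DF : 'D_v Fq w = tangent_map s (E w) v.
      rewrite (deriveE _ dFq); apply: (etrans (diff_comp_apply v dp dt)).
      by rewrite -(deriveE _ dp) pE -sE.
    rewrite gphiE GE; split; first by have [] := dg.
    have [_ ->] := dg; rewrite DF.
    have [k kP] := XA wr.
    apply: (slice_horizontal f_hol V_lagr.2 f2_constant Ss (k := (1 - t)^-1 * k) (rdom wr) sigma0) => u.
    by rewrite /v linearZ /= -scalemxAr mxE kP mulrA.
- move=> U xU.
  have : \forall z \near (0 : 'rV[R]_n), U (E z).
    have E0c : {for 0, continuous E} by apply: E_continuous; rewrite normr0 ltW.
    by apply: E0c; rewrite E0x.
  move=> /near_cube[d d0 dU].
  have m0 : 0 < c / 2 * d ^+ 2 by rewrite mulr_gt0 ?exprn_gt0// divr_gt0.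
  (* At time [t] the trajectories are at height [e * (1 - t)], which bounds their distance to 0. *)
  near=> t => _ [_ [z [zr Gz] <-] <-].
  have t01 : 0 <= t < 1 by apply/andP; split; near: t; [exact: nbhs_left_ge|exact: nbhs_left_lt].
  have [sr Gs] := tE z t zr Gz t01.
  rewrite /Gamma coordsK//; apply: dU.
  have := model_lower G0 dG rad (ltW sr); rewrite Gs => H.
  rewrite -(ler_pXn2r (n := 2)) ?nnegrE ?(ltW d0)//.
  have c2 : 0 < c / 2 by rewrite divr_gt0.
  rewrite -(ler_pM2l c2) (le_trans H)// -ler_pdivlMl// lerBlDr -lerBlDl.
  near: t; apply: nbhs_left_ge; rewrite gtrBl mulr_gt0// invr_gt0//.
- apply/seteqP; split=> [_ [z [zr Gz] <-]|q].
    have [z0|z0] := eqVneq z 0; first by left; rewrite z0 E0x.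
    right; have Gz0 : 0 < G z.
      rewrite lt_def (model_ge0 c0 G0 dG rad zr) andbT; apply: contra z0 => /eqP Gz0.
      by apply/eqP; exact: (model_eq0 c0 G0 dG rad zr Gz0).
    have [|p [u [pr Gp u0 pz]]] := bwd z zr; first by rewrite Gz0.
    have eu : 0 < expR (- u) by exact: expR_gt0.
    exists (1 - expR (- u)).
      by rewrite /= in_itv/= subr_ge0 expR_le1 oppr_le0 u0 gtrBl.
    exists (E p); first by exists p.
    by rewrite /Gamma coordsK// /tau subKr expRK opprK pz.
  move=> [->//|[t]]; rewrite /= in_itv/= => t01 [_ [z [zr Gz] <-] <-].
  have [sr Gs] := tE z t zr Gz t01; exists (sol z (tau t)); last by rewrite /Gamma coordsK.
  by split; [exact: ltW|rewrite Gs; apply: ler_piMr; [exact: ltW|rewrite gerBl; case/andP: t01]].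
- exact: ball_homeo.
Unshelve. all: by end_near. Qed.

End Thimble.

(** * Choice of the level *)

Section LocalThimble.
Variables (R : realType) (n : nat) (N : complexManifold R n) (h : hermitianMetric N).
Variables (f : N -> R[i]) (V : set N) (x : N).
Hypotheses (f_lefschetz : lefschetz_fibration f) (V_lagr : lagrangian h V) (Vx : V x)
  (x_critical : critical_point f x)
  (f2_constant : forall y z, V y -> V z -> im_part f y = im_part f z).

(** The set [A] of relative heights of the critical points, without 0, is finite, hence closed. *)
Lemma regular_values_near (sigma : R) : sigma * sigma = 1 ->
  exists2 d : R, 0 < d & forall t, 0 < t < d ->
    regular_value f ((re_part f x - sigma * t) +i* im_part f x).
Proof.
move=> s2; have [_ _ Cfin] := f_lefschetz.
pose A := ((fun y => sigma * (re_part f x - re_part f y)) @` [set y | ~ regular_point f y]) `\ 0.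
have Afin : finite_set A by apply: finite_setD; exact: finite_image.
have Ac : closed A.
  by apply: (accessible_finite_set_closed.1 _ _ Afin); apply: hausdorff_accessible; exact: norm_hausdorff.
have A0 : (~` A) 0 by move=> [_]; apply.
have /nbhs_ballP[d /= d0 dA] := open_near (closed_openC Ac) A0.
exists d => // t /andP[t0 td] y fy; apply: contrapT => ny.
have : (~` A) t by apply: dA; rewrite -ball_normE /= sub0r normrN gtr0_norm.
apply; split; last by move=> /= te; move: t0; rewrite te ltxx.
by exists y => //; rewrite /re_part fy /= -/(re_part f x) subKr mulrA s2 mul1r.
Qed.

(** The level [e] has to be smaller than the height at the faces of the cube of the local model, and than the
    distance to the other critical values. *)
Lemma local_thimble (sigma : R) : sigma * sigma = 1 ->
  (forall v, tangent V x v -> v != 0 -> sigma * complex.Re (hessian f x v v) < 0) ->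
  exists2 d : R, 0 < d & forall e, 0 < e < d ->
    let D := [set q | V q /\ 0 <= sigma * (re_part f x - re_part f q) <= e] in
    let B := connected_component D x in
    (exists Phi : 'rV[R]_n -> N, homeo_on (unit_ball R n) B Phi) /\
    lagrangian_thimble h f x B.
Proof.
move=> s2 Hess; have [f_hol _ _] := f_lefschetz.
have [s sx Ss] := V_lagr.1 x Vx.
have Hpos v : v != 0 -> 0 < 'D_v (fun z => 'D_v (height f x s sigma) z) 0.
  move=> v0; rewrite (height_hessian sigma f_hol Vx x_critical Ss sx) mulNr oppr_gt0.
  apply: Hess; first exact: tangent_map_tangent.
  apply: contra v0 => /eqP Tv; apply/eqP/(tangent_map_inj Ss.1 sx); by rewrite Tv linear0.
have [r [c [L [M [X [[r0 c0 L0] rdom rad [XL XM] XGA]]]]]] :=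
  local_model (@slice_dom_open _ _ _ x s) (slice_dom0 Vx Ss sx)
    (height_smooth x sigma f_hol Ss) (metric_matrix_smooth h x Ss)
    (fun z _ => metric_matrix_sym h x s z) (fun z u zd u0 => metric_matrix_pos h Ss zd u0)
    (height0 f sigma Vx Ss sx) (height_critical sigma f_hol Vx x_critical Ss sx) Hpos.
have XG z : `|z| <= r -> 'D_(X z) (height f x s sigma) z = - height f x s sigma z.
  by move=> /XGA[].
have XA z : `|z| <= r -> exists k, forall u : 'rV[R]_n,
    (u *m metric_matrix h x s z *m (X z)^T) 0 0 = k * 'D_u (height f x s sigma) z.
  by move=> /XGA[].
have [d d0 dreg] := regular_values_near s2.
have m0 : 0 < c / 2 * r ^+ 2 by rewrite mulr_gt0 ?exprn_gt0// divr_gt0.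
exists (Num.min d (c / 2 * r ^+ 2)); first by rewrite lt_min d0.
move=> e /andP[e0]; rewrite lt_min => /andP[ed er] D B.
have reg t : 0 < t <= e -> regular_value f ((re_part f x - sigma * t) +i* im_part f x).
  by move=> /andP[t0 te]; apply: dreg; rewrite t0 (le_lt_trans te).
have BE := component_is_ball f_hol Vx Ss sx r0 c0 rdom rad e0 er.
rewrite /B /D BE.
have T := ball_thimble f_hol V_lagr Vx x_critical f2_constant Ss sx s2 r0 c0 L0 rdom rad XL XM XG XA e0 er reg.
have Lb := ball_lagrangian f_hol V_lagr Vx Ss sx r0 c0 rdom rad e0 er.
split; last by split.
by have [lam [al [Gam [_ _ _ _ [Phi [HPhi _]]]]]] := T; exists Phi.
Qed.

End LocalThimble.

Theorem theorem17 (R : realType) (n : nat) (N : complexManifold R n)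
    (h : hermitianMetric N) (f : N -> R[i]) (V : set N) (x : N)
    (f_lefschetz : lefschetz_fibration f)
    (V_lagrangian : lagrangian h V)
    (Vx : V x)
    (x_critical : critical_point f x)
    (f2_constant : forall y z, V y -> V z -> im_part f y = im_part f z) :
  let f1 : N -> R := re_part f in
  let g1 : V -> R := fun y => f1 (set_val y) in
  (hessian_negative_on f V x ->
   \forall c \near (f1 x)^'-,
     let D := f1 @^-1` `[c, f1 x] `&` V in
     let B := connected_component D x in
     [/\ set_val @` (g1 @^-1` `[c, f1 x]) = D,
         exists Phi : 'rV[R]_n -> N, homeo_on (unit_ball R n) B Phi &
         lagrangian_thimble h f x B]) /\
  (hessian_positive_on f V x ->
   \forall c \near (f1 x)^'+,
     let D := f1 @^-1` `[f1 x, c] `&` V in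
     let B := connected_component D x in
     [/\ set_val @` (g1 @^-1` `[f1 x, c]) = D,
         exists Phi : 'rV[R]_n -> N, homeo_on (unit_ball R n) B Phi &
         lagrangian_thimble h f x B]).
Proof.
move=> f1 g1.
have valE (I : set R) : set_val @` (g1 @^-1` I) = f1 @^-1` I `&` V.
  apply/seteqP; split=> [_ [y Iy <-]|q [Iq Vq]]; first by split=> //; exact: set_valP.
  by exists (SigSub (mem_set Vq)).
split=> Hess.
  have [|v Tv v0|d d0 H] := @local_thimble _ _ _ h f V x f_lefschetz V_lagrangian Vx x_critical f2_constant 1.
  - by rewrite mulr1.
  - by rewrite mul1r; exact: Hess.
  near=> c; set D := f1 @^-1` _ `&` V.
  have cx : c < f1 x by near: c; exact: nbhs_left_lt.
  have cd : f1 x - d < c by near: c; apply: nbhs_left_gt; rewrite gtrBl.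
  have [|HB LB] := H (f1 x - c); first by rewrite subr_gt0 cx ltrBlDr addrC -ltrBlDr.
  have DE : [set q | V q /\ 0 <= 1 * (re_part f x - re_part f q) <= f1 x - c] = D.
    apply/seteqP; split=> q; rewrite /D /= in_itv/= mul1r subr_ge0 lerD2l lerN2.
      by move=> [Vq /andP[-> ->]].
    by move=> [/andP[-> ->]].
  by rewrite DE in HB LB; split; [exact: valE|exact: HB|exact: LB].
have [|v Tv v0|d d0 H] := @local_thimble _ _ _ h f V x f_lefschetz V_lagrangian Vx x_critical f2_constant (-1).
- by rewrite mulrNN mulr1.
- by rewrite mulN1r oppr_lt0; exact: Hess.
near=> c; set D := f1 @^-1` _ `&` V.
have cx : f1 x < c by near: c; exact: nbhs_right_gt.
have cd : c < f1 x + d by near: c; apply: nbhs_right_lt; rewrite ltrDl.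
have [|HB LB] := H (c - f1 x); first by rewrite subr_gt0 cx ltrBlDl.
have DE : [set q | V q /\ 0 <= -1 * (re_part f x - re_part f q) <= c - f1 x] = D.
  apply/seteqP; split=> q; rewrite /D /= in_itv/= mulN1r opprB subr_ge0 lerD2r.
    by move=> [Vq /andP[-> ->]].
  by move=> [/andP[-> ->]].
by rewrite DE in HB LB; split; [exact: valE|exact: HB|exact: LB].
Unshelve. all: by end_near. Qed.
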